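(* Fix $k\in\mathbb N$. For $n\ge k$ let $V_{k,n}$ be a random matrix uniformly distributed on the Stiefel manifold $\mathbb V_{k,n}$, regarded as a random element of $[-1,1]^{k\times\infty}$ by appending infinitely many zero columns. Then the sequence $V_{k,n}$, $n\ge k$, satisfies a large deviation principle on $[-1,1]^{k\times\infty}$ at speed $n$ with good convex rate function $\mathbb I:[-1,1]^{k\times\infty}\to[0,+\infty]$ given by $$\mathbb I(A)=\begin{cases}-\frac12\log\det\big(\mathrm{Id}_{k\times k}-AA^*\big) & \text{if } A\in\mathcal R_2^{k\times\infty}\text{ and }\|AA^*\|<1,\\ +\infty & \text{otherwise.}\end{cases}$$
   Context: For $k\le n$, $\mathbb V_{k,n}=\{V\in\mathbb R^{k\times n}: VV^*=\mathrm{Id}_{k\times k}\}$. The uniform distribution $\mu_{k,n}$ on $\mathbb V_{k,n}$ is the unique Borel probability measure invariant under $V\mapsto UVW$ for all orthogonal $U\in\mathcal O(k)$ and $W\in\mathcal O(n)$. $[-1,1]^{k\times\infty}$ is the space of $k\times\infty$ matrices $(A_{ij})_{1\le i\le k,\,j\in\mathbb N}$ with entries in $[-1,1]$, with the topology of entrywise convergence (a compact metrizable space). $\mathcal R_2^{k\times\infty}$ is the set of real $k\times\infty$ matrices all of whose $k$ rows are square summable. For $A\in\mathcal R_2^{k\times\infty}$, $AA^*\in\mathbb R^{k\times k}$ is the Gram matrix of the rows of $A$ and $\|AA^*\|$ is its operator norm. Large deviation principle (LDP): a sequence $(\xi_n)$ of random elements of a metrizable space $M$ satisfies an LDP at speed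 $n$ with rate function $I:M\to[0,+\infty]$, where $I$ is lower semicontinuous, if for every Borel set $B\subset M$ $$-\inf_{x\in B^\circ}I(x)\le\liminf_{n\to\infty}\tfrac1n\log\mathbb P[\xi_n\in B]\le\limsup_{n\to\infty}\tfrac1n\log\mathbb P[\xi_n\in B]\le-\inf_{x\in\overline B}I(x),$$ with $\inf\emptyset=+\infty$, $\log 0=-\infty$. $I$ is good if all sets $\{I\le\alpha\}$, $0\le\alpha<\infty$, are compact. *)

(* Defs.v *)
From mathcomp Require Import all_boot all_order all_algebra.
From mathcomp Require Import all_classical all_reals all_analysis.
From mathcomp Require Import ring lra.

Set Implicit Arguments.
Unset Strict Implicit.
Unset Printing Implicit Defensive.

Import Order.TTheory GRing.Theory Num.Theory.
Import numFieldNormedType.Exports.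

Local Open Scope classical_set_scope.
Local Open Scope ring_scope.

Definition borel (T : topologicalType) : set (set T) := <<s @open T >>.

Section large_deviations.
Context {R : realType} {M : topologicalType}.
Local Open Scope ereal_scope.

Definition rate_function (I : M -> \bar R) : Prop :=
  (forall x, 0 <= I x) /\ lower_semicontinuous I.

Definition good_rate_function (I : M -> \bar R) : Prop :=
  rate_function I /\
  forall a : R, (0 <= a)%R -> compact [set x | I x <= a%:E].

(* The random elements [xi n] may live on different probability spaces.
   Conventions used below: [lne 0 = -oo] and [ereal_inf set0 = +oo]. *)
Definition satisfies_LDP (speed : nat -> R)
    (d : nat -> measure_display) (Omega : forall n, measurableType (d n))
    (P : forall n, probability (Omega n) R) (xi : forall n, Omega n -> M)
    (I : M -> \bar R) : Prop :=
  [/\ forall n B, borel B -> measurable (xi n @^-1` B),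
      rate_function I &
      forall B : set M, borel B ->
        let u n := ((speed n)^-1)%:E * lne (P n (xi n @^-1` B)) in
        [/\ - ereal_inf (I @` B°) <= limn_einf u,
            limn_einf u <= limn_esup u &
            limn_esup u <= - ereal_inf (I @` closure B)]].

End large_deviations.

Section stiefel.
Context {R : realType}.

Definition orthogonal_group (n : nat) : set 'M[R]_n :=
  [set U | U *m U^T = 1%:M].

Definition stiefel (k n : nat) : set 'M[R]_(k, n) :=
  [set V | V *m V^T = 1%:M].

Definition borel_matrix (k n : nat) :=
  g_sigma_algebraType (@open 'M[R]_(k, n)).

(* A Borel probability measure on the (closed) Stiefel manifold is represented
   by a Borel probability measure on all matrices concentrated on it. *)
Definition uniform_on_stiefel (k n : nat)
    (mu : probability (borel_matrix k n) R) : Prop :=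
  mu (@stiefel k n) = 1%E /\
  forall (U : 'M[R]_k) (W : 'M[R]_n),
    orthogonal_group U -> orthogonal_group W ->
    forall B : set (borel_matrix k n), measurable B ->
      mu ((fun V : 'M[R]_(k, n) => U *m V *m W) @^-1` B) = mu B.

End stiefel.

Section infinite_matrices.
Context {R : realType} (k : nat).

(* [set_type] carries the subspace topology and [prod_topology] the product
   topology, i.e. the topology of entrywise convergence. *)
Definition box : Type :=
  prod_topology (fun _ : 'I_k * nat => set_type (`[-1, 1]%classic : set R)).

Definition entries (A : box) (i : 'I_k) (j : nat) : R := \val (A (i, j)).

Definition zero_pad (n : nat) (V : 'M[R]_(k, n)) (i : 'I_k) (j : nat) : R :=
  if insub j is Some j' then V i j' else 0.

Lemma zero_pad_itv (n : nat) (V : 'M[R]_(k, n)) (ij : 'I_k * nat) :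
  stiefel V -> zero_pad V ij.1 ij.2 \in (`[-1, 1]%classic : set R).
Proof.
case: ij => i j VV /=; apply/mem_set; rewrite /zero_pad /=.
case: insubP => [j' _ _|_]; last by rewrite in_itv /=; apply/andP; split; lra.
have := congr1 (fun M : 'M[R]_k => M i i) VV.
rewrite !mxE eqxx => ii.
have : V i j' ^+ 2 <= 1.
  rewrite -[X in _ <= X]ii (bigD1 j') //= mxE -expr2 lerDl sumr_ge0 // => l _.
  by rewrite mxE -expr2 sqr_ge0.
by rewrite in_itv /= => sq; apply/andP; split; nra.
Qed.

Definition embed (n : nat) (V : 'M[R]_(k, n)) (VS : stiefel V) : box :=
  fun ij => exist _ (zero_pad V ij.1 ij.2) (zero_pad_itv ij VS).

Lemma conv_itv (t : {i01 R}) (a b : set_type (`[-1, 1]%classic : set R)) :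
  t%:num * \val a + (1 - t%:num) * \val b \in (`[-1, 1]%classic : set R).
Proof.
case: a => a /= /set_mem /=; case: b => b /= /set_mem /=.
rewrite !in_itv /= => /andP[b1 b2] /andP[a1 a2].
have t0 : 0 <= t%:num :> R by [].
have t1 : t%:num <= 1 :> R by [].
by apply/mem_set; rewrite /= in_itv /=; apply/andP; split; nra.
Qed.

Definition box_conv (t : {i01 R}) (A B : box) : box :=
  fun ij => exist (fun x => x \in (`[-1, 1]%classic : set R))
    (t%:num * \val (A ij) + (1 - t%:num) * \val (B ij))
    (conv_itv t (A ij) (B ij)).

(* In the library [0 * +oo = 0], so the endpoints [t = 0, 1] are harmless. *)
Definition convex_on_box (I : box -> \bar R) : Prop :=
  forall (t : {i01 R}) (A B : box),
    (I (box_conv t A B) <= t%:num%:E * I A + (1 - t%:num)%:E * I B)%E.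

Definition square_summable_rows (A : 'I_k -> nat -> R) : Prop :=
  forall i, cvgn (series (fun j => A i j ^+ 2)).

(* Meaningful when the rows of [A] are square summable: the series then
   converge absolutely. *)
Definition gram (A : 'I_k -> nat -> R) : 'M[R]_k :=
  \matrix_(i, i') limn (series (fun j => A i j * A i' j)).

Definition euclidean_norm (x : 'cV[R]_k) : R :=
  Num.sqrt (\sum_i x i 0 ^+ 2).

Definition operator_norm (M : 'M[R]_k) : R :=
  sup [set euclidean_norm (M *m x) | x in [set x | euclidean_norm x <= 1]].

Definition stiefel_rate (A : box) : \bar R :=
  if `[< square_summable_rows (entries A) /\
         operator_norm (gram (entries A)) < 1 >]
  then (- 2^-1 * ln (\det (1%:M - gram (entries A))))%:E
  else +oo%E.

End infinite_matrices.

Arguments box : clear implicits.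

(* Main.v *)
Require Import Defs.
From mathcomp Require Import all_boot all_order all_algebra.
From mathcomp Require Import all_classical all_reals all_analysis.
From mathcomp Require Import measurable_realfun.
From mathcomp Require Import ring lra zify.

Set Implicit Arguments.
Unset Strict Implicit.
Unset Printing Implicit Defensive.

Import Order.TTheory GRing.Theory Num.Theory.
Import numFieldNormedType.Exports.

Local Open Scope classical_set_scope.
Local Open Scope ring_scope.

(** Let [X] be the block of the first [r] columns of a uniform [V]. The law of
    [X] has a density proportional to a power of [\det (1 - X X^T)] with
    exponent [(n - r - k - 1) / 2], and this is why a small ball around [A] has
    probability about [expR (- n * rate A)] with
    [rate A = - 2^-1 * ln (\det (1 - A A^T))]. The proof does not compute the
    density; it draws the exponential estimates from the rotation invariance.

    Differentiating the invariance under the rotation of a column [i < r] and a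
    column [j >= r] at angle [0], and summing over [j], gives an integration by
    parts ([stein]): for a constant matrix [B] and a test function [phi],
    [(n - r) E (<X, B> phi(X)) = E <(1 - X X^T) B, grad phi(X)>].
    Take for [phi] a bump carried by a ball whose centre [t *: A] moves from [0]
    to [A], and for [B] the matrix [drift A t] for which the field
    [X |-> (1 - X X^T) B] has the value [A] at [t *: A]. Then the derivative in
    [t] of the mean of the bump is [- (n - r) E (<X, B> bump)], up to an error
    whose sign is fixed by letting the radius of the ball grow or shrink in [t].
    As [<t *: A, drift A t>] is the derivative of [rate (t *: A)]
    ([is_derive_rate_path]), Gronwall's inequality ([flow_gronwall]) compares
    the ball around [A] with the ball around [0], whose probability tends to 1.
    A growing radius gives [ball_lower], a shrinking one [ball_upper].

    This needs [1 - A A^T] to be positive definite. Otherwise a unit combination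
    of the rows of [X] keeps nearly all its length near [A]; the moments of that
    length satisfy an exact recursion, again by integration by parts, and
    Markov's inequality makes the probability smaller than every exponential
    ([rowsq_tail], [boundary_upper]).

    The rest is the passage to infinitely many columns. The tangent inequality of
    the concave function [ln \o \det] ([ln_det_tangent]) shows that the rate of
    the first [r] columns increases with [r] and is convex, and that it tends to
    infinity at the boundary. So the rate function is the supremum of the rates
    of the finite blocks ([rate_block_le_stiefel], [stiefel_rate_gt]), which
    makes it convex and lower semicontinuous. As the box is compact and a
    neighbourhood in it constrains finitely many columns, the local estimates
    give the lower bound directly and the upper bound by a covering argument
    ([ldp_lower], [ldp_upper]). *)

(** * Limits of finite-dimensional matrices *)

Section FiniteLimits.
Context {R : realType} {T : Type} (F : set_system T) {FF : Filter F}.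

Lemma cvg_fsum (I : Type) (s : seq I) (Q : pred I) (f : I -> T -> R) (a : I -> R) :
  (forall i, Q i -> f i x @[x --> F] --> a i) ->
  \sum_(i <- s | Q i) f i x @[x --> F] --> \sum_(i <- s | Q i) a i.
Proof. by apply: cvg_big; exact: add_continuous. Qed.

Lemma cvg_fprod (I : Type) (s : seq I) (Q : pred I) (f : I -> T -> R) (a : I -> R) :
  (forall i, Q i -> f i x @[x --> F] --> a i) ->
  \prod_(i <- s | Q i) f i x @[x --> F] --> \prod_(i <- s | Q i) a i.
Proof. by apply: cvg_big; exact: mul_continuous. Qed.

(** Entrywise convergence along any filter: it serves both for truncations
    ([\oo]) and for neighbourhoods in the box, and it depends on no norm. *)
Definition mxcvg m n (f : T -> 'M[R]_(m, n)) (A : 'M[R]_(m, n)) : Prop :=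
  forall i j, f x i j @[x --> F] --> A i j.

Lemma mxcvg_cst m n (A : 'M[R]_(m, n)) : mxcvg (fun=> A) A.
Proof. by move=> i j; exact: cvg_cst. Qed.

Lemma mxcvgB m n (f g : T -> 'M[R]_(m, n)) A B :
  mxcvg f A -> mxcvg g B -> mxcvg (fun x => f x - g x) (A - B).
Proof.
by move=> fA gB i j; rewrite !mxE; under eq_cvg do rewrite !mxE; exact: cvgB.
Qed.

Lemma mxcvgM m n p (f : T -> 'M[R]_(m, n)) (g : T -> 'M[R]_(n, p)) A B :
  mxcvg f A -> mxcvg g B -> mxcvg (fun x => f x *m g x) (A *m B).
Proof.
move=> fA gB i j; rewrite mxE; under eq_cvg do rewrite mxE.
by apply: cvg_fsum => l _; exact: cvgM.
Qed.

Lemma mxcvg_tr m n (f : T -> 'M[R]_(m, n)) A : mxcvg f A -> mxcvg (fun x => (f x)^T) A^T.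
Proof. by move=> fA i j; rewrite mxE; under eq_cvg do rewrite mxE; exact: fA. Qed.

Lemma mxcvgZ m n (s : T -> R) (f : T -> 'M[R]_(m, n)) (a : R) A :
  s x @[x --> F] --> a -> mxcvg f A -> mxcvg (fun x => s x *: f x) (a *: A).
Proof.
by move=> sa fA i j; rewrite mxE; under eq_cvg do rewrite mxE; exact: cvgM.
Qed.

Lemma cvg_mxtrace n (f : T -> 'M[R]_n) A : mxcvg f A -> \tr (f x) @[x --> F] --> \tr A.
Proof. by move=> fA; apply: cvg_fsum. Qed.

Lemma cvg_det n (f : T -> 'M[R]_n) A : mxcvg f A -> \det (f x) @[x --> F] --> \det A.
Proof.
move=> fA; apply: cvg_fsum => s _; apply: cvgM; first exact: cvg_cst.
by apply: cvg_fprod => i _; exact: fA.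
Qed.

Lemma mxcvg_adj n (f : T -> 'M[R]_n) A :
  mxcvg f A -> mxcvg (fun x => \adj (f x)) (\adj A).
Proof.
move=> fA i j; rewrite mxE; under eq_cvg do rewrite mxE.
apply: cvgM; first exact: cvg_cst.
by apply: cvg_det => i' j'; rewrite !mxE; under eq_cvg do rewrite !mxE; exact: fA.
Qed.

Lemma mxcvg_inv n (f : T -> 'M[R]_n) A : (\forall x \near F, f x \in unitmx) ->
  A \in unitmx -> mxcvg f A -> mxcvg (fun x => invmx (f x)) (invmx A).
Proof.
move=> uf uA fA i j.
have adjA : (\det (f x))^-1 * \adj (f x) i j @[x --> F] --> (\det A)^-1 * \adj A i j.
  apply: cvgM; last exact: mxcvg_adj.
  by apply: cvgV; [rewrite -unitfE -unitmxE|exact: cvg_det].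
rewrite /invmx uA mxE; apply: cvg_trans adjA; apply: near_eq_cvg.
near=> x; have -> : f x \in unitmx by near: x.
by rewrite [RHS]mxE.
Unshelve. all: by end_near. Qed.

End FiniteLimits.

(** * Positive definite matrices and the determinant *)

Section PositiveDefinite.
Context {R : realType}.

Lemma entryD m n (A B : 'M[R]_(m, n)) i j : (A + B) i j = A i j + B i j.
Proof. by rewrite mxE. Qed.

Lemma mulmx11 (A B : 'M[R]_1) : (A *m B) 0 0 = A 0 0 * B 0 0.
Proof. by rewrite mxE big_ord1. Qed.

Lemma entryZ m n c (A : 'M[R]_(m, n)) i j : (c *: A) i j = c * A i j.
Proof. by rewrite mxE. Qed.

Lemma entryN m n (A : 'M[R]_(m, n)) i j : (- A) i j = - A i j.
Proof. by rewrite mxE. Qed.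

Definition quad n (M : 'M[R]_n) (x : 'cV[R]_n) : R := (x^T *m M *m x) 0 0.

Definition posdef n (M : 'M[R]_n) : Prop :=
  M^T = M /\ forall x, x != 0 -> 0 < quad M x.

Lemma quadB n (M N : 'M[R]_n) x : quad (M - N) x = quad M x - quad N x.
Proof. by rewrite /quad mulmxBr mulmxBl !mxE. Qed.

Lemma quadD n (M N : 'M[R]_n) x : quad (M + N) x = quad M x + quad N x.
Proof. by rewrite /quad mulmxDr mulmxDl !mxE. Qed.

Lemma quadZ n c (M : 'M[R]_n) x : quad (c *: M) x = c * quad M x.
Proof. by rewrite /quad -scalemxAr -scalemxAl !mxE. Qed.

Lemma quad_gram n r (A : 'M[R]_(n, r)) x :
  quad (A *m A^T) x = \sum_j ((A^T *m x) j 0) ^+ 2.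
Proof.
rewrite /quad mulmxA -[_ *m A^T *m x]mulmxA.
rewrite -{1}(trmxK A) -trmx_mul mxE; apply: eq_bigr => j _.
by rewrite mxE expr2.
Qed.

Lemma quad1 n (x : 'cV[R]_n) : quad 1%:M x = \sum_i x i 0 ^+ 2.
Proof. by rewrite /quad mulmx1 mxE; apply: eq_bigr => j _; rewrite mxE expr2. Qed.

Lemma quad_gram_ge0 n r (A : 'M[R]_(n, r)) x : 0 <= quad (A *m A^T) x.
Proof. by rewrite quad_gram sumr_ge0 // => j _; rewrite sqr_ge0. Qed.

Lemma sumsq_gt0 n (x : 'cV[R]_n) : x != 0 -> 0 < \sum_i x i 0 ^+ 2.
Proof.
move=> x0; rewrite lt_neqAle sumr_ge0 ?andbT => [|i _]; last exact: sqr_ge0.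
apply: contra x0 => /eqP/esym/eqP; rewrite psumr_eq0 => [/allP xi|i _].
  apply/eqP/colP => i; rewrite mxE; apply/eqP; rewrite -sqrf_eq0.
  by apply: xi; rewrite mem_index_enum.
exact: sqr_ge0.
Qed.

Lemma quad_scale n (M : 'M[R]_n) c x : quad M (c *: x) = c ^+ 2 * quad M x.
Proof.
by rewrite /quad [(c *: x)^T]linearZ /= -!scalemxAl -scalemxAr scalerA entryZ expr2.
Qed.

Lemma not_posdef n (M : 'M[R]_n) : M^T = M -> ~ posdef M ->
  exists w, quad 1%:M w = 1 /\ quad M w <= 0.
Proof.
move=> sM nM; have [x [x0 xA]] : exists x, x != 0 /\ quad M x <= 0.
  apply: contrapT => H; apply: nM; split=> // x x0.
  by rewrite ltNge; apply/negP => xA; apply: H; exists x.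
have s0 : 0 < quad 1%:M x by rewrite quad1; exact: sumsq_gt0.
exists ((Num.sqrt (quad 1%:M x))^-1 *: x).
rewrite !quad_scale exprVn (sqr_sqrtr (ltW s0)).
by rewrite mulVf ?gt_eqF //; split=> //; rewrite pmulr_rle0 // invr_gt0.
Qed.

Lemma quad_block m n (a : 'M[R]_m) (b : 'M[R]_(m, n)) (M : 'M[R]_n) u y :
  quad (block_mx a b b^T M) (col_mx u y) =
  quad a u + 2 * (u^T *m b *m y) 0 0 + quad M y.
Proof.
have E : (y^T *m b^T *m u) 0 0 = (u^T *m b *m y) 0 0.
  have trE (Z : 'M[R]_1) : Z 0 0 = Z^T 0 0 by rewrite mxE.
  by rewrite trE !trmx_mul !trmxK mulmxA.
rewrite /quad tr_col_mx mul_row_block mul_row_col !mulmxDl.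
by rewrite !entryD E; ring.
Qed.

(** Induction on the size: the Schur complement [N] of the first entry [a] is
    positive definite, since its form at [y] is the form of [M] at the vector
    that extends [y] by the minimizer [- a^-1 * (b *m y)]. *)
Lemma cholesky n (M : 'M[R]_n) : posdef M ->
  exists C : 'M[R]_n, [/\ is_trig_mx C, forall i, 0 < C i i & M = C *m C^T].
Proof.
elim: n M => [|n IH] M.
  by move=> _; exists 0; split=> [|[]//|]; [exact: mx0_is_trig | rewrite [LHS]thinmx0 [RHS]thinmx0].
rewrite -[n.+1]/(1 + n)%N in M *.
rewrite -[M]submxK; set a := ulsubmx M; set b := ursubmx M.
set M' := drsubmx M.
move=> [sym pd].
have Eb : dlsubmx M = b^T.
  by move: sym; rewrite tr_block_mx => /eq_block_mx[_ _ <-].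
have sM' : M'^T = M' by move: sym; rewrite tr_block_mx => /eq_block_mx[].
rewrite Eb in sym pd *.
have a0 : 0 < a 0 0.
  have := pd (col_mx 1%:M 0); rewrite quad_block /quad !(mulmx0, mul0mx, trmx0).
  rewrite trmx1 mulmx1 mul1mx !mxE !addr0 mulr0 addr0; apply.
  by rewrite col_mx_eq0 negb_and oner_eq0.
have aE : a = (a 0 0)%:M by rewrite [LHS]mx11_scalar.
pose N := M' - (a 0 0)^-1 *: (b^T *m b).
have [] := IH N.
  split=> [|y y0].
    by rewrite /N linearB /= sM' linearZ /= trmx_mul trmxK.
  have := pd (col_mx (- (a 0 0)^-1 *: (b *m y)) y).
  rewrite quad_block col_mx_eq0 negb_and y0 orbT => /(_ isT).
  rewrite /N quadB quadZ.
  have -> : quad (b^T *m b) y = ((b *m y) 0 0) ^+ 2.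
    by rewrite -{2}(trmxK b) quad_gram big_ord1 trmxK.
  set q := quad M' y; set s := (b *m y) 0 0.
  have -> : quad a (- (a 0 0)^-1 *: (b *m y)) = (a 0 0)^-1 * s ^+ 2.
    rewrite /quad !mulmx11 mxE entryZ -/s.
    by field; rewrite gt_eqF.
  have -> : ((- (a 0 0)^-1 *: (b *m y))^T *m b *m y) 0 0 = - ((a 0 0)^-1 * s ^+ 2).
    by rewrite -mulmxA mulmx11 mxE entryZ -/s; ring.
  by rewrite mulrN; lra.
move=> C' [tC' C'0 EN].
have sa : Num.sqrt (a 0 0) ^+ 2 = a 0 0 by rewrite sqr_sqrtr // ltW.
have sa0 : 0 < Num.sqrt (a 0 0) by rewrite sqrtr_gt0.
exists (block_mx (Num.sqrt (a 0 0))%:M 0 ((Num.sqrt (a 0 0))^-1 *: b^T) C'); split.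
- by rewrite is_trig_block_mx // eqxx tC' scalar_mx_is_trig.
- move=> i; rewrite -(@fintype.splitK 1 n i); case: (fintype.split i) => j /=.
    by rewrite block_mxEul mxE eqxx mulr1n.
  by rewrite block_mxEdr.
rewrite tr_block_mx mulmx_block !trmx0 !mulmx0 !mul0mx !addr0.
rewrite linearZ /= trmxK !tr_scalar_mx -!scalar_mxM -expr2 sa -aE.
rewrite mul_scalar_mx mul_mx_scalar !scalerA mulfV ?mulVf ?gt_eqF // !scale1r.
rewrite -scalemxAl -scalemxAr scalerA -EN -expr2 exprVn sa.
by rewrite /N addrC subrK.
Qed.

Lemma posdef_det_gt0 n (M : 'M[R]_n) : posdef M -> 0 < \det M.
Proof.
move=> /cholesky[C [tC C0 ->]]; rewrite det_mulmx det_tr -expr2 exprn_gt0 //.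
by rewrite det_trig // prodr_gt0.
Qed.

Lemma posdef_unit n (M : 'M[R]_n) : posdef M -> M \in unitmx.
Proof. by move=> /posdef_det_gt0 M0; rewrite unitmxE unitfE gt_eqF. Qed.

Lemma posdef_congr n (M C : 'M[R]_n) :
  posdef M -> C \in unitmx -> posdef (C *m M *m C^T).
Proof.
move=> [sM pM] uC; split=> [|x x0]; first by rewrite !trmx_mul trmxK sM mulmxA.
have -> : quad (C *m M *m C^T) x = quad M (C^T *m x).
  by rewrite /quad !trmx_mul trmxK !mulmxA.
apply: pM; apply: contra x0 => /eqP /(congr1 (mulmx (invmx C^T))).
by rewrite mulmx0 mulKmx ?unitmx_tr // => ->.
Qed.

(** A triangular factor [C] reduces the inequality to [x <= expR (x - 1)] for
    the squares of the diagonal entries. *)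
Lemma det_le_expR_trace n (M : 'M[R]_n) : posdef M -> \det M <= expR (\tr M - n%:R).
Proof.
move=> /cholesky[C [tC C0 ->]].
rewrite det_mulmx det_tr -expr2 det_trig // -prodrXl.
apply: (@le_trans _ _ (\prod_i expR (C i i ^+ 2 - 1))).
  apply: ler_prod => i _; rewrite sqr_ge0 /=.
  by rewrite (le_trans _ (expR_ge1Dx _)) // addrC subrK.
rewrite -expR_sum ler_expR sumrB sumr_const card_ord lerD2r.
apply: ler_sum => i _; rewrite mxE (bigD1 i) //= mxE -expr2 lerDl.
by apply: sumr_ge0 => j _; rewrite mxE -expr2 sqr_ge0.
Qed.

Lemma cauchy_schwarz_sum (I : finType) (a b : I -> R) :
  (\sum_i a i * b i) ^+ 2 <= (\sum_i a i ^+ 2) * (\sum_i b i ^+ 2).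
Proof.
have E : \sum_i \sum_j (a i * b j - a j * b i) ^+ 2 =
    2 * ((\sum_i a i ^+ 2) * (\sum_i b i ^+ 2) - (\sum_i a i * b i) ^+ 2).
  have -> : (\sum_i a i * b i) ^+ 2 = \sum_i \sum_j (a i * b i) * (a j * b j).
    by rewrite expr2 mulr_suml; apply: eq_bigr => i _; rewrite mulr_sumr.
  have AB : (\sum_i a i ^+ 2) * (\sum_i b i ^+ 2) = \sum_i \sum_j a i ^+ 2 * b j ^+ 2.
    by rewrite mulr_suml; apply: eq_bigr => i _; rewrite mulr_sumr.
  have BA : (\sum_i a i ^+ 2) * (\sum_i b i ^+ 2) = \sum_i \sum_j a j ^+ 2 * b i ^+ 2.
    by rewrite AB exchange_big.
  rewrite mulr2n mulrDl mul1r addrACA -opprD {1}AB BA -!big_split -sumrB /=.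
  apply: eq_bigr => i _; rewrite -!big_split -sumrB /=.
  by apply: eq_bigr => j _; ring.
rewrite -subr_ge0 -(pmulr_rge0 _ (ltr0n R 2)) -E.
by apply: sumr_ge0 => i _; apply: sumr_ge0 => j _; exact: sqr_ge0.
Qed.

Lemma invmx_mul n (A B : 'M[R]_n) : A \in unitmx -> B \in unitmx ->
  invmx (A *m B) = invmx B *m invmx A.
Proof.
move=> uA uB; have uAB : A *m B \in unitmx by rewrite unitmx_mul uA.
by rewrite -[RHS](mulKmx uAB) -!mulmxA mulKVmx // mulmxV // mulmx1.
Qed.

(** Concavity of [ln \o \det], in tangent form: after the congruence by a
    factor of [M] only the case [M = 1] is left. *)
Lemma ln_det_tangent n (M N : 'M[R]_n) : posdef M -> posdef N ->
  ln (\det N) <= ln (\det M) + \tr (invmx M *m (N - M)).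
Proof.
move=> pM pN; have dM := posdef_det_gt0 pM; have dN := posdef_det_gt0 pN.
have uM := posdef_unit pM.
have [C [_ _ MC]] := cholesky pM.
have uC : C \in unitmx by move: uM; rewrite MC unitmx_mul => /andP[].
have uiC : invmx C \in unitmx by rewrite unitmx_inv.
have := det_le_expR_trace (posdef_congr pN uiC).
rewrite !det_mulmx det_tr det_inv => H.
have {}H : \det N / \det M <= expR (\tr (invmx C *m N *m (invmx C)^T) - n%:R).
  by rewrite MC det_mulmx det_tr invfM mulrCA mulrA mulrAC [X in X * _]mulrC in H *.
have T : \tr (invmx C *m N *m (invmx C)^T) - n%:R = \tr (invmx M *m (N - M)).
  rewrite mulmxBr mulVmx // linearB /= mxtrace1; congr (_ - _).
  by rewrite mxtrace_mulC mulmxA MC invmx_mul ?unitmx_tr // trmx_inv.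
rewrite -lerBlDl -T -ln_div ?posrE // -[leRHS]expRK ler_ln ?posrE ?expR_gt0 //.
by rewrite divr_gt0.
Qed.

(** If [M = C *m C^T] then [x] is the image of [C^T *m x] by the inverse of
    [C^T], so its length is controlled by the entries of that inverse. *)
Lemma posdef_coercive n (M : 'M[R]_n) : posdef M ->
  exists2 c, 0 < c & forall x, c * quad 1%:M x <= quad M x.
Proof.
move=> pM; have [C [tC C0 MC]] := cholesky pM.
have uC : C \in unitmx.
  by move: (posdef_unit pM); rewrite MC unitmx_mul => /andP[].
pose D := (invmx C)^T.
pose c := 1 + \sum_i \sum_j D i j ^+ 2.
have c0 : 0 < c.
  by rewrite ltr_pwDl // sumr_ge0 // => i _; rewrite sumr_ge0 // => j _; exact: sqr_ge0.
exists c^-1 => [|x]; first by rewrite invr_gt0.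
rewrite MC quad_gram ler_pdivrMl //.
set y := C^T *m x.
have xE : x = D *m y.
  by rewrite /D /y trmx_inv mulKmx // unitmx_tr.
have CS i : x i 0 ^+ 2 <= (\sum_j D i j ^+ 2) * (\sum_j y j 0 ^+ 2).
  by rewrite xE mxE; exact: cauchy_schwarz_sum.
rewrite quad1 (le_trans (ler_sum _ (fun i _ => CS i))) // -mulr_suml ler_wpM2r //.
  by apply: sumr_ge0 => j _; exact: sqr_ge0.
by rewrite /c lerDr.
Qed.

Definition defect k r (A : 'M[R]_(k, r)) : 'M[R]_k := 1%:M - A *m A^T.

(** The condition that the operator norm of [A] is less than 1, written without
    a norm: it passes to convex combinations and to limits through [quad]. *)
Definition contraction k r (A : 'M[R]_(k, r)) : Prop := posdef (defect A).

Definition rate k r (A : 'M[R]_(k, r)) : R := - 2^-1 * ln (\det (defect A)).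

Lemma defect_sym k r (A : 'M[R]_(k, r)) : (defect A)^T = defect A.
Proof. by rewrite /defect linearB /= trmx1 trmx_mul trmxK. Qed.

Lemma quad_defect k r (A : 'M[R]_(k, r)) x :
  quad (defect A) x = quad 1%:M x - quad (A *m A^T) x.
Proof. by rewrite quadB. Qed.

Lemma defectZ k r (A : 'M[R]_(k, r)) t :
  defect (t *: A) = 1%:M - (t ^+ 2) *: (A *m A^T).
Proof. by rewrite /defect linearZ /= -scalemxAl -scalemxAr scalerA expr2. Qed.

Lemma contractionZ k r (A : 'M[R]_(k, r)) t :
  contraction A -> 0 <= t <= 1 -> contraction (t *: A).
Proof.
move=> [_ pA] /andP[t0 t1]; split=> [|x x0]; first exact: defect_sym.
apply: lt_le_trans (pA x x0) _; rewrite quad_defect defectZ quadB quadZ lerD2l lerN2.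
by rewrite ler_piMl ?quad_gram_ge0 // expr_le1.
Qed.

Lemma rate_ge0 k r (A : 'M[R]_(k, r)) : contraction A -> 0 <= rate A.
Proof.
move=> pA; rewrite /rate mulNr oppr_ge0 pmulr_rle0 ?invr_gt0 // ln_le0 //.
apply: le_trans (det_le_expR_trace pA) _; rewrite -[leRHS]expR0 ler_expR.
rewrite linearB /= mxtrace1 addrAC subrr sub0r oppr_le0.
by apply: sumr_ge0 => i _; rewrite mxE sumr_ge0 // => j _; rewrite mxE -expr2 sqr_ge0.
Qed.

(** Unlike [defect A], this matrix is affine in [A]; it has the same
    determinant, and is positive definite at the same [A]. *)
Definition dilation k r (A : 'M[R]_(k, r)) : 'M[R]_(k + r) :=
  block_mx 1%:M A A^T 1%:M.

Lemma det_dilation k r (A : 'M[R]_(k, r)) : \det (dilation A) = \det (defect A).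
Proof.
have -> : dilation A = block_mx 1%:M A 0 1%:M *m block_mx (defect A) 0 A^T 1%:M.
  by rewrite mulmx_block !(mulmx0, mul0mx, mulmx1, mul1mx, addr0, add0r) /defect subrK.
by rewrite det_mulmx det_ublock det_lblock !det1 !mul1r mulr1.
Qed.

(** Eliminating the other block gives a determinant of size [r]; for a single
    column it evaluates a rank one perturbation of the identity. *)
Lemma det_dilation_tr k r (A : 'M[R]_(k, r)) : \det (dilation A) = \det (defect A^T).
Proof.
have -> : dilation A = block_mx 1%:M 0 A^T 1%:M *m block_mx 1%:M A 0 (defect A^T).
  rewrite mulmx_block !(mulmx0, mul0mx, mulmx1, mul1mx, addr0, add0r) /defect trmxK.
  by rewrite addrCA subrr addr0.
by rewrite det_mulmx det_ublock det_lblock !det1 !mul1r.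
Qed.

(** Completing the square in the second block leaves the form of [defect A]. *)
Lemma posdef_dilation k r (A : 'M[R]_(k, r)) : posdef (dilation A) <-> contraction A.
Proof.
split=> -[_ pA]; split; first exact: defect_sym.
- move=> x x0; have := pA (col_mx x (- (A^T *m x))).
  rewrite col_mx_eq0 negb_and x0 => /(_ isT).
  rewrite quad_block mulmxN entryN quad_defect quad_gram.
  have -> : quad 1%:M (- (A^T *m x)) = \sum_j (A^T *m x) j 0 ^+ 2.
    by rewrite quad1; apply: eq_bigr => j _; rewrite entryN sqrrN.
  have -> : (x^T *m A *m (A^T *m x)) 0 0 = \sum_j (A^T *m x) j 0 ^+ 2.
    by rewrite -quad_gram /quad !mulmxA.
  by move=> /lt_le_trans; apply; lra.
- by rewrite /dilation tr_block_mx !trmx1 trmxK.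
- move=> z; rewrite -[z]vsubmxK; set x := usubmx z; set y := dsubmx z => z0.
  rewrite quad_block.
  pose w := y + A^T *m x.
  have -> : quad 1%:M x + 2 * (x^T *m A *m y) 0 0 + quad 1%:M y =
      quad (defect A) x + quad 1%:M w.
    rewrite quad_defect quad_gram !quad1.
    have -> : (x^T *m A *m y) 0 0 = \sum_j (A^T *m x) j 0 * y j 0.
      by rewrite -{1}(trmxK A) -trmx_mul mxE; apply: eq_bigr => j _; rewrite mxE.
    have -> : \sum_i w i 0 ^+ 2 = \sum_i y i 0 ^+ 2 +
        2 * (\sum_j (A^T *m x) j 0 * y j 0) + \sum_j (A^T *m x) j 0 ^+ 2.
      rewrite mulr_sumr -!big_split /=; apply: eq_bigr => j _.
      by rewrite /w entryD; ring.
    ring.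
  have [x0|x0] := eqVneq x 0.
    have y0 : y != 0 by apply: contra z0; rewrite x0 => /eqP ->; rewrite col_mx0.
    rewrite /w x0 mulmx0 addr0 quad1 [quad _ 0]/quad mulmx0 mxE add0r.
    exact: sumsq_gt0.
  apply: ltr_pwDl; first exact: pA.
  by rewrite quad1 sumr_ge0 // => i _; exact: sqr_ge0.
Qed.

Lemma dilation_mix k r (A B : 'M[R]_(k, r)) t :
  dilation (t *: A + (1 - t) *: B) = t *: dilation A + (1 - t) *: dilation B.
Proof.
rewrite /dilation !scale_block_mx add_block_mx linearD !linearZ /= -!scalerDl.
by rewrite (_ : t + (1 - t) = 1) ?scale1r //; ring.
Qed.

Lemma contraction_mix k r (A B : 'M[R]_(k, r)) t : 0 <= t <= 1 ->
  contraction A -> contraction B -> contraction (t *: A + (1 - t) *: B).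
Proof.
move=> /andP[t0 t1] /posdef_dilation[sA pA] /posdef_dilation[sB pB].
apply/posdef_dilation; rewrite dilation_mix; split=> [|x x0].
  by rewrite linearD !linearZ /= sA sB.
have /= a0 := pA x x0; have /= b0 := pB x x0.
rewrite quadD !quadZ; move: t0; rewrite le_eqVlt => /predU1P[<-|t0].
  by rewrite mul0r add0r subr0 mul1r.
by rewrite ltr_pwDl ?mulr_gt0 // mulr_ge0 ?subr_ge0 // ltW.
Qed.

(** [rate A] is [- 2^-1 * ln \o \det] at the dilation of [A], which depends
    affinely on [A]; so its convexity is the concavity of [ln \o \det]. *)
Lemma rate_convex k r (A B : 'M[R]_(k, r)) t : 0 <= t <= 1 ->
  contraction A -> contraction B ->
  rate (t *: A + (1 - t) *: B) <= t * rate A + (1 - t) * rate B.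
Proof.
move=> t01 cA cB; have cM := contraction_mix t01 cA cB.
have [/posdef_dilation pA /posdef_dilation pB] := (cA, cB).
have /posdef_dilation pM := cM.
have := ln_det_tangent pM pA; have := ln_det_tangent pM pB.
rewrite !det_dilation; set M := dilation (_ + _).
move=> TB TA; rewrite /rate.
have Z : t * \tr (invmx M *m (dilation A - M)) + (1 - t) * \tr (invmx M *m (dilation B - M)) = 0.
  rewrite -!mxtraceZ -mxtraceD !scalemxAr -mulmxDr !scalerBr addrACA.
  rewrite -dilation_mix -/M -opprD -scalerDl (_ : t + (1 - t) = 1); last by ring.
  by rewrite scale1r subrr mulmx0 mxtrace0.
case/andP: t01 => t0 t1; nra.
Qed.

(** One small value of the form bounds the determinant: this is the tangent
    inequality at [1 - (1 - eta) w w^T], whose determinant is [eta]. *)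
Lemma det_defect_small k r (A : 'M[R]_(k, r)) w eta : contraction A ->
  quad 1%:M w = 1 -> 0 < eta <= 1 -> quad (defect A) w <= eta ->
  ln (\det (defect A)) <= 1 + ln eta.
Proof.
move=> cA w1 /andP[eta0 eta1] wA.
pose W := Num.sqrt (1 - eta) *: w.
have W2 : W *m W^T = (1 - eta) *: (w *m w^T).
  rewrite /W linearZ /= -scalemxAl -scalemxAr scalerA -expr2 sqr_sqrtr //.
  by rewrite subr_ge0.
have ww : w^T *m w = 1%:M.
  by rewrite [LHS]mx11_scalar -w1 /quad mulmx1.
have cW : contraction W.
  split=> [|x x0]; first exact: defect_sym.
  rewrite quad_defect W2 quadZ.
  have /sumsq_gt0 := x0; rewrite -quad1 => xx0.
  have : quad (w *m w^T) x <= quad 1%:M x.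
    rewrite quad_gram big_ord1 mxE.
    apply: le_trans (cauchy_schwarz_sum _ _) _.
    have -> : \sum_i w^T 0 i ^+ 2 = 1.
      by rewrite -w1 quad1; apply: eq_bigr => j _; rewrite mxE.
    by rewrite mul1r quad1.
  have := quad_gram_ge0 w x; nra.
have dW : \det (defect W) = eta.
  rewrite -det_dilation det_dilation_tr /defect trmxK /W [(_ *: w)^T]linearZ /=.
  rewrite -scalemxAl -scalemxAr scalerA -expr2 sqr_sqrtr ?subr_ge0 //.
  by rewrite ww det_mx11 !mxE !eqxx /= !mulr1n mulr1; ring.
have iW : invmx (defect W) = 1%:M + (eta^-1 - 1) *: (w *m w^T).
  apply: (can_inj (mulmxK (posdef_unit cW))); rewrite mulVmx ?posdef_unit //.
  set Q := w *m w^T.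
  have QQ : Q *m Q = Q by rewrite /Q mulmxA -(mulmxA w) ww mulmx1.
  transitivity (1%:M + ((eta^-1 - 1) - (1 - eta + (1 - eta) * (eta^-1 - 1))) *: Q).
    rewrite (_ : _ - _ = 0) ?scale0r ?addr0 //; field; exact: lt0r_neq0.
  rewrite /defect W2 -/Q mulmxBr mulmx1 mulmxDl mul1mx -!scalemxAl -!scalemxAr QQ.
  rewrite -[RHS]addrA; congr (_ + _).
  by rewrite scalerA -scalerDl -scalerBl (mulrC (1 - eta)).
have := ln_det_tangent cW cA; rewrite dW => /le_trans; apply.
rewrite addrC lerD2r mulmxBr mulVmx ?posdef_unit // iW mulmxDl mul1mx -scalemxAl.
rewrite linearB linearD /= mxtraceZ -mulmxA mxtrace_mulC mxtrace1.
have -> : \tr (w^T *m defect A *m w) = quad (defect A) w by rewrite /quad trace_mx11.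
have trA : \tr (defect A) <= k%:R.
  rewrite linearB /= mxtrace1 lerBlDr lerDl.
  by apply: sumr_ge0 => i _; rewrite mxE sumr_ge0 // => j _; rewrite mxE -expr2 sqr_ge0.
have : (eta^-1 - 1) * quad (defect A) w <= (eta^-1 - 1) * eta.
  by rewrite ler_wpM2l // subr_ge0 invf_ge1.
have -> : (eta^-1 - 1) * eta = 1 - eta by field; exact: lt0r_neq0.
lra.
Qed.

End PositiveDefinite.

(** * Operator norm of a Gram matrix *)

Section OperatorNorm.
Context {R : realType} {k : nat}.
Implicit Types (G M : 'M[R]_k) (x y : 'cV[R]_k).

Lemma euclidean_norm_sq x : euclidean_norm x ^+ 2 = quad 1%:M x.
Proof.
by rewrite quad1 sqr_sqrtr //; apply: sumr_ge0 => i _; exact: sqr_ge0.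
Qed.

(** The form at [x + l *: y] is a nonnegative polynomial in [l]. *)
Lemma quad_bilinear_le G x y : G^T = G -> (forall z, 0 <= quad G z) ->
  ((y^T *m G *m x) 0 0) ^+ 2 <= quad G x * quad G y.
Proof.
move=> sG pG; set b := (y^T *m G *m x) 0 0.
have bE : (x^T *m G *m y) 0 0 = b.
  have trE (Z : 'M[R]_1) : Z 0 0 = Z^T 0 0 by rewrite mxE.
  by rewrite trE !trmx_mul trmxK sG mulmxA.
have H l : 0 <= quad G x + 2 * l * b + l ^+ 2 * quad G y.
  have := pG (x + l *: y).
  rewrite /quad [(x + l *: y)^T]linearD /= [(l *: y)^T]linearZ /= !mulmxDl !mulmxDr.
  rewrite -!scalemxAl -!scalemxAr scalerA !(entryD, entryZ) bE -/b -/(quad G x) -/(quad G y).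
  by lra.
have := pG y; rewrite le_eqVlt => /predU1P[d0|d0].
  rewrite -d0 mulr0; have [->|b0] := eqVneq b 0; first by rewrite expr0n.
  (* Without quadratic term the polynomial is affine: at this [l] it is [-1]. *)
  have := H (- (quad G x + 1) / (2 * b)); rewrite -d0 mulr0 addr0.
  have -> : 2 * (- (quad G x + 1) / (2 * b)) * b = - (quad G x + 1) by field.
  by lra.
have := H (- b / quad G y).
have -> : quad G x + 2 * (- b / quad G y) * b + (- b / quad G y) ^+ 2 * quad G y =
   quad G x - b ^+ 2 / quad G y by field; rewrite gt_eqF.
by rewrite subr_ge0 ler_pdivrMr.
Qed.

(** With [quad G <= e * quad 1] and [e < 1], the Cauchy-Schwarz inequality of the
    form [quad G], at [x] and [G *m x], bounds the length of [G *m x] by [e]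
    times that of [x]. The converse only needs [quad G x <= |x| |G x|]. *)
Lemma operator_norm_lt1 G : G^T = G -> (forall x, 0 <= quad G x) ->
  operator_norm G < 1 <-> posdef (1%:M - G).
Proof.
move=> sG pG; pose S := [set euclidean_norm (G *m x) | x in [set x | euclidean_norm x <= 1]].
have en0 x : 0 <= euclidean_norm x by exact: sqrtr_ge0.
have S0 : S !=set0.
  exists (euclidean_norm (G *m 0)); exists 0 => //=.
  by rewrite /euclidean_norm big1 ?sqrtr0 // => i _; rewrite mxE expr0n.
split=> [G1|[_ pd]]; last first.
  have [|c c0 Hc] := posdef_coercive (M := 1%:M - G); first by split=> //; rewrite linearB /= trmx1 sG.
  pose e := Num.max 0 (1 - c).
  have e0 : 0 <= e by rewrite le_max lexx.
  have e1 : e < 1 by rewrite gt_max ltr01 /=; lra.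
  apply: le_lt_trans e1; apply: ge_sup => // _ [x /= x1 <-].
  have Ge y : quad G y <= e * quad 1%:M y.
    have := Hc y; rewrite quadB => Hy.
    apply: (@le_trans _ _ ((1 - c) * quad 1%:M y)); first by lra.
    rewrite ler_wpM2r ?le_max ?lexx ?orbT // quad1.
    by apply: sumr_ge0 => i _; exact: sqr_ge0.
  set y := G *m x; have q1 : quad 1%:M x <= 1 by rewrite -euclidean_norm_sq expr_le1.
  have := quad_bilinear_le x y sG pG; rewrite -/y.
  rewrite -[y^T *m G *m x]mulmxA -/y.
  have -> : (y^T *m y) 0 0 = quad 1%:M y by rewrite /quad mulmx1.
  rewrite -euclidean_norm_sq => H.
  have Hx := Ge x; have Hy := Ge y; rewrite -euclidean_norm_sq in Hy.
  set v := euclidean_norm y in H Hy *; have v0 : 0 <= v by exact: en0.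
  have : (v ^+ 2) ^+ 2 <= e ^+ 2 * v ^+ 2.
    apply: le_trans H _.
    have -> : e ^+ 2 * v ^+ 2 = (e * 1) * (e * v ^+ 2) by ring.
    apply: ler_pM => //; apply: le_trans Hx _; exact: ler_wpM2l.
  have [->|vn] := eqVneq v 0; first by [].
  have vp : 0 < v by rewrite lt_def vn.
  rewrite [X in X <= _]expr2 ler_pM2r ?exprn_gt0 // => H2.
  by rewrite -(@ler_pXn2r _ 2) // nnegrE.
split=> [|x x0]; first by rewrite linearB /= trmx1 sG.
have q0 : 0 < quad 1%:M x by rewrite quad1; exact: sumsq_gt0.
have ubS : has_ubound S.
  pose K := \sum_i \sum_j G i j ^+ 2.
  exists (Num.sqrt K) => _ [y /= y1 <-].
  rewrite ler_wsqrtr //; apply: ler_sum => i _; rewrite mxE.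
  apply: le_trans (cauchy_schwarz_sum _ _) _; rewrite -quad1 -euclidean_norm_sq.
  rewrite ler_piMr ?expr_le1 //.
  by apply: sumr_ge0 => j _; exact: sqr_ge0.
pose s := euclidean_norm x.
have s2 : s ^+ 2 = quad 1%:M x by exact: euclidean_norm_sq.
have s0 : 0 < s by rewrite lt_def en0 andbT; apply: contraTneq q0 => s_0; rewrite -s2 s_0 expr0n ltxx.
pose z := s^-1 *: x.
have xz : x = s *: z by rewrite /z scalerA mulfV ?gt_eqF // scale1r.
have qz : quad 1%:M z = 1 by rewrite /z quad_scale exprVn s2 mulVf // gt_eqF.
have z1 : euclidean_norm z <= 1.
  by rewrite -(@expr_le1 _ 2) // euclidean_norm_sq qz.
have Gz : euclidean_norm (G *m z) < 1.
  by apply: le_lt_trans G1; apply: ub_le_sup => //; exists z.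
rewrite xz quad_scale mulr_gt0 ?exprn_gt0 // quadB qz subr_gt0.
have CS := cauchy_schwarz_sum (fun i => z i 0) (fun i => (G *m z) i 0).
have zE : \sum_i z i 0 * (G *m z) i 0 = quad G z.
  by rewrite /quad -mulmxA [RHS]mxE; apply: eq_bigr => i _; rewrite [z^T _ _]mxE.
rewrite zE -!quad1 qz mul1r -euclidean_norm_sq in CS.
rewrite -(@ltr_pXn2r _ 2) ?nnegrE ?pG ?ler01 // expr1n.
by apply: le_lt_trans CS _; rewrite expr_lt1.
Qed.

End OperatorNorm.

(** * Truncation of infinite matrices *)

Section GramLimits.
Context {R : realType} {k : nat}.
Implicit Types (a : 'I_k -> nat -> R).

Definition block a r : 'M[R]_(k, r) := \matrix_(i, j) a i j.

Lemma gram_blockE a r i i' :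
  (block a r *m (block a r)^T) i i' = series (fun j => a i j * a i' j) r.
Proof.
by rewrite mxE /series /= big_mkord; apply: eq_bigr => j _; rewrite !mxE.
Qed.

Lemma cvg_quad T (F : set_system T) {FF : Filter F} (M : T -> 'M[R]_k) N x :
  mxcvg F M N -> quad (M t) x @[t --> F] --> quad N x.
Proof.
move=> MN; apply: mxcvgM; last exact: mxcvg_cst.
by apply: mxcvgM => //; exact: mxcvg_cst.
Qed.

(** The series of products is dominated since [|x y| <= x^2 + y^2]. *)
Lemma cvg_gram_block a : square_summable_rows a ->
  mxcvg \oo (fun r => block a r *m (block a r)^T) (gram a).
Proof.
move=> sq i i'; rewrite mxE; under eq_cvg do rewrite gram_blockE.
suff : cvgn (series (fun j => a i j * a i' j)) by [].
have cs : cvgn (series (fun j => a i j ^+ 2 + a i' j ^+ 2)).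
  by apply: is_cvg_seriesD; exact: sq.
apply: normed_cvg; apply: series_le_cvg cs.
- by move=> j; exact: normr_ge0.
- by move=> j; rewrite addr_ge0 // sqr_ge0.
move=> j /=; rewrite normrM -(real_normK (num_real (a i j))) -(real_normK (num_real (a i' j))).
have := sqr_ge0 (`|a i j| - `|a i' j|); have := normr_ge0 (a i j); have := normr_ge0 (a i' j).
rewrite sqrrB; nra.
Qed.

Lemma cvg_defect_block a : square_summable_rows a ->
  mxcvg \oo (fun r => defect (block a r)) (1%:M - gram a).
Proof. by move=> sq; apply: mxcvgB; [exact: mxcvg_cst|exact: cvg_gram_block]. Qed.

Lemma gram_sym a : (gram a)^T = gram a.
Proof.
apply/matrixP => i j; rewrite !mxE; congr (limn (series _)).
by apply/funext => l; rewrite mulrC.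
Qed.

Lemma quad_gram_infty_ge0 a : square_summable_rows a -> forall x, 0 <= quad (gram a) x.
Proof.
move=> sq x.
have cq : quad (block a r *m (block a r)^T) x @[r --> \oo] --> quad (gram a) x.
  by apply: cvg_quad; exact: cvg_gram_block.
rewrite -(cvg_lim _ cq) //; apply: limr_ge; first by apply/cvg_ex; eexists; exact: cq.
by apply: nearW => r; exact: quad_gram_ge0.
Qed.

(** The domain where the rate function is finite. *)
Definition subunital a : Prop := square_summable_rows a /\ operator_norm (gram a) < 1.

Lemma subunitalP a : subunital a <-> square_summable_rows a /\ posdef (1%:M - gram a).
Proof.
split=> -[sq H]; split=> //.
  by apply/(operator_norm_lt1 (gram_sym a)) => //; exact: quad_gram_infty_ge0.
by apply/(operator_norm_lt1 (gram_sym a)) => //; exact: quad_gram_infty_ge0.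
Qed.

Lemma gram_blockS a r : block a r.+1 *m (block a r.+1)^T =
  block a r *m (block a r)^T + (\col_i a i r) *m (\col_i a i r)^T.
Proof.
apply/matrixP => i j; rewrite entryD !gram_blockE seriesSr.
by congr (_ + _); rewrite mxE big_ord1 !mxE.
Qed.

Lemma defect_blockS a r :
  defect (block a r.+1) = defect (block a r) - (\col_i a i r) *m (\col_i a i r)^T.
Proof. by rewrite /defect gram_blockS opprD addrA. Qed.

Lemma quad_defect_block_le a r m x : (r <= m)%N ->
  quad (defect (block a m)) x <= quad (defect (block a r)) x.
Proof.
elim: m => [|m IH]; first by rewrite leqn0 => /eqP ->.
rewrite leq_eqVlt => /predU1P[-> //|/IH]; apply: le_trans.
by rewrite defect_blockS quadB lerBlDr lerDl quad_gram_ge0.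
Qed.

Lemma contraction_block_le a r m : (r <= m)%N ->
  contraction (block a m) -> contraction (block a r).
Proof.
move=> rm [_ pm]; split=> [|x x0]; first exact: defect_sym.
exact: lt_le_trans (pm x x0) (quad_defect_block_le a x rm).
Qed.

Lemma subunital_contraction a r : subunital a -> contraction (block a r).
Proof.
move=> /subunitalP[sq [_ pd]]; split=> [|x x0]; first exact: defect_sym.
apply: lt_le_trans (pd x x0) _.
have cq : quad (defect (block a m)) x @[m --> \oo] --> quad (1%:M - gram a) x.
  by apply: cvg_quad; exact: cvg_defect_block.
rewrite -(cvg_lim _ cq) //; apply: limr_le; first by apply/cvg_ex; eexists; exact: cq.
by exists r => // m /= rm; exact: quad_defect_block_le.
Qed.

(** A new column [v] subtracts [v *m v^T] from the defect, and the tangent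
    inequality bounds the change of [ln \o \det] by
    [- v^T *m invmx (defect _) *m v]. *)
Lemma rate_block_le a r m : (r <= m)%N -> contraction (block a m) ->
  rate (block a r) <= rate (block a m).
Proof.
elim: m => [|m IH]; first by rewrite leqn0 => /eqP ->.
rewrite leq_eqVlt => /predU1P[-> //|rm cm].
have cm' := contraction_block_le (leqnSn m) cm.
apply: le_trans (IH rm cm') _.
rewrite /rate !mulNr lerN2 ler_pM2l ?invr_gt0 //.
apply: le_trans (ln_det_tangent cm' cm) _; rewrite gerDl.
rewrite defect_blockS addrAC subrr add0r mulmxN linearN /= oppr_le0.
set v := \col_i _; rewrite mulmxA mxtrace_mulC mulmxA.
have [sM pM] := cm'; have uM := posdef_unit cm'.
rewrite trace_mx11; set M := defect (block a m) in sM pM uM *.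
have -> : (v^T *m invmx M *m v) 0 0 = quad M (invmx M *m v).
  by rewrite /quad trmx_mul trmx_inv sM -!mulmxA mulKVmx.
have [->|z0] := eqVneq (invmx M *m v) 0; first by rewrite /quad mulmx0 mxE.
exact/ltW/pM.
Qed.

Lemma cvg_rate_block a : subunital a ->
  rate (block a r) @[r --> \oo] --> - 2^-1 * ln (\det (1%:M - gram a)).
Proof.
move=> /subunitalP[sq pd]; apply: cvgMl_tmp; apply: continuous_cvg.
  by apply: continuous_ln; exact: posdef_det_gt0.
by apply: cvg_det; exact: cvg_defect_block.
Qed.

(** The finite blocks exhaust the rate function, the rate of a block that is not
    a contraction counting as infinite. When all blocks are contractions but [a]
    is not [subunital], the limit form vanishes or is negative at some unit [w],
    so the determinants tend to 0 by [det_defect_small]. *)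
Lemma rate_block_gt a (L : R) :
  (subunital a -> L < - 2^-1 * ln (\det (1%:M - gram a))) ->
  exists r, contraction (block a r) -> L < rate (block a r).
Proof.
move=> HL; have [su|nsu] := pselect (subunital a).
  have := cvg_rate_block su => /cvgr_gt /(_ L (HL su)) [r _ Hr].
  by exists r => _; apply: Hr => /=.
have [[r nr]|H] := pselect (exists r, ~ contraction (block a r)); first by exists r.
have {}H r : contraction (block a r) by apply: contrapT => nr; apply: H; exists r.
have sq : square_summable_rows a.
  move=> i; apply: nondecreasing_is_cvgn.
    by apply: nondecreasing_series => j _ _; exact: sqr_ge0.
  exists 1 => _ [r _ <-]; have [_ pr] := H r.
  (* Contractions have rows of length at most 1. *)
  pose e : 'cV[R]_k := delta_mx i 0.
  have e0 : e != 0.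
    by apply/eqP => /colP/(_ i); rewrite !mxE !eqxx => /eqP; rewrite oner_eq0.
  have q1 : quad 1%:M e = 1.
    rewrite quad1 (bigD1 i) //= big1 ?addr0 => [|b bi]; first by rewrite mxE !eqxx expr1n.
    by rewrite mxE (negbTE bi) expr0n.
  have := pr e e0; rewrite quad_defect q1 subr_gt0 => /ltW.
  have -> : quad (block a r *m (block a r)^T) e = series (fun j => a i j ^+ 2) r => //.
  have -> : (fun j => a i j ^+ 2) = (fun j => a i j * a i j).
    by apply/funext => j; rewrite expr2.
  rewrite -gram_blockE /quad /e trmx_delta -rowE mxE (bigD1 i) //= big1 ?addr0 => [|b bi].
    by rewrite !mxE !eqxx mulr1.
  by rewrite [delta_mx _ _ _ _]mxE (negbTE bi) mulr0.
have np : ~ posdef (1%:M - gram a) by move=> pd; apply: nsu; apply/subunitalP.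
have [|w [w1 wA]] := not_posdef _ np; first by rewrite linearB /= trmx1 gram_sym.
(* Chosen so that [- 2^-1 * (1 + ln eta) > L]. *)
pose eta := expR (- (2 * `|L| + 2)) : R.
have eta0 : 0 < eta by exact: expR_gt0.
have eta1 : eta <= 1 by rewrite -[leRHS]expR0 ler_expR oppr_le0 addr_ge0 // mulr_ge0.
have cq : quad (defect (block a m)) w @[m --> \oo] --> quad (1%:M - gram a) w.
  by apply: cvg_quad; exact: cvg_defect_block.
have := cq => /cvgr_lt /(_ eta (le_lt_trans wA eta0)) [r _ Hr].
exists r => cr; have := Hr r (leqnn r) => /= /ltW qr.
have := det_defect_small cr w1 _ qr; rewrite eta0 eta1 => /(_ isT).
rewrite /eta expRK /rate mulNr => D.
have := ler_norm L; lra.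
Qed.

End GramLimits.

(** * The rate along a segment from the origin *)

Section RatePath.
Context {R : realType} {k r : nat}.
Implicit Types (A X Y : 'M[R]_(k, r)) (t : R).

Definition dot X Y : R := \sum_a \sum_i X a i * Y a i.

Lemma dotE X Y : dot X Y = \tr (X *m Y^T).
Proof. by apply: eq_bigr => a _; rewrite mxE; apply: eq_bigr => i _; rewrite mxE. Qed.

Lemma dotC X Y : dot X Y = dot Y X.
Proof. by apply: eq_bigr => a _; apply: eq_bigr => i _; rewrite mulrC. Qed.

Lemma dotDl X Y Z : dot (X + Y) Z = dot X Z + dot Y Z.
Proof. by rewrite !dotE mulmxDl linearD. Qed.

Lemma dotBl X Y Z : dot (X - Y) Z = dot X Z - dot Y Z.
Proof. by rewrite !dotE mulmxBl linearB. Qed.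

Lemma dotDr X Y Z : dot Z (X + Y) = dot Z X + dot Z Y.
Proof. by rewrite dotC dotDl ![dot _ Z]dotC. Qed.

Lemma dotBr X Y Z : dot Z (X - Y) = dot Z X - dot Z Y.
Proof. by rewrite dotC dotBl ![dot _ Z]dotC. Qed.

(** The velocity field [X |-> defect X *m drift A t] has the value [A] at
    [t *: A], so that its flow carries [0] to [A] in unit time. *)
Definition drift A t : 'M[R]_(k, r) := invmx (defect (t *: A)) *m A.

Lemma defect_drift A t : contraction (t *: A) -> defect (t *: A) *m drift A t = A.
Proof. by move=> cA; rewrite /drift mulmxA mulmxV ?posdef_unit // mul1mx. Qed.

Lemma contractionN A : contraction A -> contraction (- A).
Proof. by rewrite /contraction /defect linearN /= mulNmx mulmxN opprK. Qed.

Lemma contractionZ_abs A t : contraction A -> `|t| <= 1 -> contraction (t *: A).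
Proof.
move=> cA; have [t0|t0] := leP 0 t; first by rewrite ger0_norm // => t1; apply: contractionZ => //; rewrite t0.
rewrite ltr0_norm // => t1; rewrite -[t]opprK scaleNr; apply: contractionN.
by apply: contractionZ => //; rewrite t1 oppr_ge0 ltW.
Qed.

Lemma mxcvg_path A t : mxcvg (nbhs t) (fun s => defect (s *: A)) (defect (t *: A)).
Proof.
rewrite /defect; apply: mxcvgB; first exact: mxcvg_cst.
have sA : mxcvg (nbhs t) (fun s => s *: A) (t *: A).
  by apply: mxcvgZ; [exact: cvg_id|exact: mxcvg_cst].
by apply: mxcvgM => //; exact: mxcvg_tr.
Qed.

Lemma cvg_rate_path A t : contraction A -> `|t| <= 1 ->
  rate (s *: A) @[s --> t] --> rate (t *: A).
Proof.
move=> cA t1; apply: cvgMl_tmp.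
apply: continuous_cvg; last by apply: cvg_det; exact: mxcvg_path.
by apply: continuous_ln; apply: posdef_det_gt0; exact: contractionZ_abs.
Qed.

(** The tangent inequalities of [ln \o \det] at both ends of a segment squeeze
    the difference quotient between two values of a continuous function. *)
Lemma is_derive_rate_path A t : contraction A -> 0 < t < 1 ->
  is_derive t 1 (fun s => rate (s *: A)) (dot (t *: A) (drift A t)).
Proof.
move=> cA /andP[t0 t1].
pose M s := defect (s *: A); pose G := A *m A^T.
pose g s := \tr (invmx (M s) *m G).
have cM s : `|s| <= 1 -> contraction (s *: A) by exact: contractionZ_abs.
have t1' : `|t| <= 1 by rewrite gtr0_norm // ltW.
have MB s s' : M s - M s' = (s' ^+ 2 - s ^+ 2) *: G.
  by rewrite /M !defectZ opprB addrC addrA subrK scalerBl.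
have up s s' : `|s| <= 1 -> `|s'| <= 1 ->
    ln (\det (M s)) - ln (\det (M s')) <= (s' ^+ 2 - s ^+ 2) * g s'.
  move=> s1 s1'; rewrite lerBlDl.
  by have := ln_det_tangent (cM _ s1') (cM _ s1); rewrite MB -scalemxAr mxtraceZ.
have gcvg : g s @[s --> t] --> g t.
  apply: cvg_mxtrace; apply: mxcvgM; last exact: mxcvg_cst.
  apply: mxcvg_inv; [|exact: posdef_unit (cM _ t1')|exact: mxcvg_path].
  near=> s; apply: posdef_unit; apply: cM; rewrite ltW //.
  by near: s; apply: (cvgr_norm_lt t); [exact: cvg_id|rewrite gtr0_norm].
have E : dot (t *: A) (drift A t) = t * g t.
  rewrite dotE /g /drift trmx_mul trmx_inv defect_sym -scalemxAl mxtraceZ.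
  by rewrite mulmxA mxtrace_mulC -/(M t).
have lim0 : h^-1 *: (((fun s => rate (s *: A)) \o shift t) (h *: 1) - rate (t *: A))
    @[h --> (0:R)^'] --> t * g t.
  have tcvg : (t + h) @[h --> (0:R)^'] --> t.
    rewrite -[X in _ --> X]addr0; apply: cvgD; first exact: cvg_cst.
    exact: cvg_within.
  have gh : g (t + h) @[h --> (0:R)^'] --> g t by exact: cvg_comp tcvg gcvg.
  have th : 2^-1 * (t + (t + h)) @[h --> (0:R)^'] --> t.
    rewrite [X in _ --> X](_ : t = 2^-1 * (t + t)); last by field.
    by apply: cvgMl_tmp; apply: cvgD => //; exact: cvg_cst.
  pose c h := 2^-1 * (t + (t + h)); pose X h := c h * (g (t + h) - g t).
  have Xcvg : `|X h| @[h --> (0:R)^'] --> 0.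
    rewrite [X in _ --> X](_ : 0 = `|t * (g t - g t)|); last by rewrite subrr mulr0 normr0.
    apply: cvg_norm; apply: cvgM; first exact: th.
    by apply: cvgB; [exact: gh|exact: cvg_cst].
  have lo : c h * g t - `|X h| @[h --> (0:R)^'] --> t * g t.
    rewrite -[X in _ --> X]subr0; apply: cvgB => //.
    by apply: cvgM; [exact: th|exact: cvg_cst].
  have hi : c h * g t + `|X h| @[h --> (0:R)^'] --> t * g t.
    rewrite -[X in _ --> X]addr0; apply: cvgD => //.
    by apply: cvgM; [exact: th|exact: cvg_cst].
  apply: (squeeze_cvgr _ lo hi); near=> h.
  have h0 : h != 0 by near: h; exact: nbhs_dnbhs_neq.
  have th1 : `|t + h| <= 1.
    rewrite ltW //; near: h; apply: (cvgr_norm_lt t) => //.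
    by rewrite gtr0_norm.
  rewrite /= /GRing.scale /= mulr1 [h + t]addrC.
  have U := up _ _ th1 t1'; have D := up _ _ t1' th1.
  rewrite /rate -/(M _) -/(M _).
  set a := ln _ in U D *; set b := ln _ in U D *.
  have -> : h^-1 * (- 2^-1 * a - - 2^-1 * b) = 2^-1 * ((b - a) / h) by field.
  have {}U : 2 * c h * h * g t <= b - a by rewrite /c; lra.
  have {}D : b - a <= 2 * c h * h * g (t + h) by rewrite /c; lra.
  have Qh : 2^-1 * ((b - a) / h) * (2 * h) = b - a by field.
  set Q := 2^-1 * _ in Qh *.
  have := ler_norm (X h); have := ler_norm (- X h); rewrite normrN /X.
  move: (c h) U D => e U D; case: (ltgtP h 0) h0 => // h0 _ X1 X2.
    have H1 : e * g (t + h) <= Q by nra.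
    have H2 : Q <= e * g t by nra.
    apply/andP; split; lra.
  have H1 : e * g t <= Q by nra.
  have H2 : Q <= e * g (t + h) by nra.
  apply/andP; split; lra.
apply: DeriveDef; first by apply/cvg_ex; exists (t * g t).
by rewrite E; exact/cvg_lim.
Unshelve. all: by end_near. Qed.

Lemma norm_sum_le m (F : 'I_m -> R) c :
  (forall i, `|F i| <= c) -> `|\sum_i F i| <= m%:R * c.
Proof.
move=> Fc; apply: le_trans (ler_norm_sum _ _ _) _.
apply: le_trans (ler_sum _ (fun i _ => Fc i)) _.
by rewrite sumr_const card_ord mulr_natl.
Qed.

Lemma dot_ge0 X : 0 <= dot X X.
Proof. by apply: sumr_ge0 => a _; apply: sumr_ge0 => i _; rewrite -expr2 sqr_ge0. Qed.

Lemma entry_le_dot X a i : X a i ^+ 2 <= dot X X.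
Proof.
rewrite /dot (bigD1 a) //= (bigD1 i) //= -expr2 -addrA lerDl addr_ge0 //.
  by apply: sumr_ge0 => j _; rewrite -expr2 sqr_ge0.
by apply: sumr_ge0 => b _; apply: sumr_ge0 => j _; rewrite -expr2 sqr_ge0.
Qed.

Lemma entry_le_sqrt X a i : `|X a i| <= Num.sqrt (dot X X).
Proof. by rewrite -sqrtr_sqr ler_sqrt ?entry_le_dot ?dot_ge0. Qed.

Lemma norm_dot_le X Y x y : (forall a i, `|X a i| <= x) -> (forall a i, `|Y a i| <= y) ->
  `|dot X Y| <= k%:R * (r%:R * (x * y)).
Proof.
move=> Xx Yy; apply: norm_sum_le => a; apply: norm_sum_le => i.
by rewrite normrM ler_pM.
Qed.

(** [defect A] is the smallest of the forms [defect (t *: A)], so its coercivity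
    constant bounds all their inverses. *)
Lemma drift_bound A : contraction A -> exists b, 0 <= b /\
  forall t, 0 <= t <= 1 -> forall a i, `|drift A t a i| <= b.
Proof.
move=> cA; have [c c0 Hc] := posdef_coercive cA.
exists (1 + c^-1 ^+ 2 * dot A A).
have b0 : 0 <= c^-1 ^+ 2 * dot A A by rewrite mulr_ge0 ?dot_ge0 // sqr_ge0.
split=> [|t t01 a i]; first by rewrite addr_ge0.
have cT := contractionZ cA t01.
pose x := col i (drift A t); pose v := col i A.
have xE : x a 0 = drift A t a i by rewrite mxE.
have Sx : defect (t *: A) *m x = v.
  apply/colP => j; rewrite [RHS]mxE -[in RHS](defect_drift cT) [LHS]mxE [RHS]mxE.
  by apply: eq_bigr => l _; rewrite [x l 0]mxE.
have H : c * quad 1%:M x <= \sum_j x j 0 * v j 0.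
  apply: le_trans (Hc x) _.
  have -> : \sum_j x j 0 * v j 0 = quad (defect (t *: A)) x.
    rewrite /quad -mulmxA Sx [RHS]mxE; apply: eq_bigr => j _.
    by rewrite [x^T _ _]mxE.
  rewrite quad_defect defectZ quadB quadZ lerD2l lerN2.
  by case/andP: t01 => t0 t1; rewrite ler_piMl ?quad_gram_ge0 // expr_le1.
have CS := cauchy_schwarz_sum (fun j => x j 0) (fun j => v j 0).
have Q0 : 0 <= quad 1%:M x by rewrite quad1 sumr_ge0 // => j _; exact: sqr_ge0.
rewrite -quad1 in CS.
have vA : \sum_j v j 0 ^+ 2 <= dot A A.
  apply: ler_sum => j _; rewrite mxE (bigD1 i) //= expr2 lerDl.
  by apply: sumr_ge0 => l _; rewrite -expr2 sqr_ge0.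
have H2 : c ^+ 2 * quad 1%:M x <= dot A A.
  have [->|Qn] := eqVneq (quad 1%:M x) 0; first by rewrite mulr0 dot_ge0.
  have Qp : 0 < quad 1%:M x by rewrite lt_def Qn.
  rewrite -(ler_pM2r Qp).
  have : (c * quad 1%:M x) ^+ 2 <= (\sum_j x j 0 * v j 0) ^+ 2.
    by rewrite lerXn2r ?nnegrE ?mulr_ge0 ?(le_trans _ H) ?mulr_ge0 // ltW.
  nra.
have xx : x a 0 ^+ 2 <= c^-1 ^+ 2 * dot A A.
  apply: (@le_trans _ _ (quad 1%:M x)).
    by rewrite quad1 (bigD1 a) //= lerDl sumr_ge0 // => j _; exact: sqr_ge0.
  by rewrite exprVn mulrC ler_pdivlMr ?exprn_gt0 // mulrC.
rewrite -xE; have [|x1] := leP `|x a 0| 1; first by lra.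
have : `|x a 0| <= `|x a 0| ^+ 2 by rewrite expr2 ler_peMl // ltW.
rewrite real_normK ?num_real //; lra.
Qed.

(** [A] is the value of the field at [t *: A], hence the difference is
    [(X X^T - Y Y^T) B] with [Y = t *: A], of first order in [X - Y]. *)
Lemma drift_lipschitz A t X al be : 0 <= al -> 0 <= be -> contraction (t *: A) ->
  (forall a i, `|X a i| <= al) -> (forall a i, `|(t *: A) a i| <= al) ->
  (forall a i, `|drift A t a i| <= be) ->
  `|dot (X - t *: A) (A - defect X *m drift A t)| <=
    2 * (k%:R * r%:R) ^+ 2 * al * be * dot (X - t *: A) (X - t *: A).
Proof.
move=> al0 be0 cT Xal Yal Bbe; set D := X - t *: A; set Y := t *: A in cT Yal D *.
set B := drift A t in Bbe *; pose s := Num.sqrt (dot D D).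
have s0 : 0 <= s by exact: sqrtr_ge0.
have DE : A - defect X *m B = (D *m X^T) *m B + (Y *m D^T) *m B.
  rewrite -{1}(defect_drift cT) -/B -/Y -mulmxBl -mulmxDl; congr (_ *m _).
  have -> : D^T = X^T - Y^T by rewrite /D linearB.
  rewrite /D mulmxBl mulmxBr [RHS]addrA subrK /defect opprB [LHS]addrC [LHS]addrA.
  by rewrite subrK.
have b1 a i : `|((D *m X^T) *m B) a i| <= k%:R * ((r%:R * (s * al)) * be).
  rewrite mxE; apply: norm_sum_le => b; rewrite normrM ler_pM //.
  rewrite mxE; apply: norm_sum_le => c; rewrite normrM.
  by apply: ler_pM => //; [exact: entry_le_sqrt|rewrite mxE].
have b2 a i : `|((Y *m D^T) *m B) a i| <= k%:R * ((r%:R * (al * s)) * be).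
  rewrite mxE; apply: norm_sum_le => b; rewrite normrM ler_pM //.
  rewrite mxE; apply: norm_sum_le => c; rewrite normrM.
  by apply: ler_pM => //; rewrite mxE; exact: entry_le_sqrt.
rewrite DE dotDr; apply: le_trans (ler_normD _ _) _.
have := norm_dot_le (entry_le_sqrt D) b1; have := norm_dot_le (entry_le_sqrt D) b2.
rewrite -/s; have := sqr_sqrtr (dot_ge0 D); rewrite -/s => <-.
move=> h2 h1; apply: le_trans (lerD h1 h2) _; rewrite le_eqVlt; apply/orP; left.
apply/eqP; ring.
Qed.

End RatePath.

(** * Expectations under a rotation invariant law *)

Section Observables.
Context {R : realType} {k n : nat} {d : measure_display} {T : measurableType d}.
Context (P : probability T R) (V : {mfun T >-> @borel_matrix R k n}).
Hypothesis VS : forall w, stiefel (V w).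

(** Test functions. The bound is required on the Stiefel manifold only, which
    carries all the mass; this lets polynomials be test functions. *)
Definition obs (f : 'M[R]_(k, n) -> R) : Prop :=
  measurable_fun [set: borel_matrix k n] (f : borel_matrix k n -> R) /\
  exists C, forall M, stiefel M -> `|f M| <= C.

Definition Ex (f : 'M[R]_(k, n) -> R) : R := \int[P]_w f (V w).

Lemma obs_cst c : obs (fun=> c).
Proof. by split=> //; exists `|c|. Qed.

Lemma obsD f g : obs f -> obs g -> obs (fun M => f M + g M).
Proof.
move=> [mf [C Cf]] [mg [D Dg]]; split; first exact: measurable_funD.
exists (C + D) => M MS; rewrite (le_trans (ler_normD _ _)) // lerD //; [exact: Cf|exact: Dg].
Qed.

Lemma obsM f g : obs f -> obs g -> obs (fun M => f M * g M).
Proof.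
move=> [mf [C Cf]] [mg [D Dg]]; split; first exact: measurable_funM.
by exists (C * D) => M MS; rewrite normrM ler_pM // ?Cf ?Dg.
Qed.

Lemma obsN f : obs f -> obs (fun M => - f M).
Proof.
move=> [mf [C Cf]]; split; first exact: measurable_funN.
by exists C => M MS; rewrite normrN Cf.
Qed.

Lemma obsZ c f : obs f -> obs (fun M => c * f M).
Proof. by move=> of_; apply: obsM => //; exact: obs_cst. Qed.

Lemma obsB f g : obs f -> obs g -> obs (fun M => f M - g M).
Proof. by move=> of_ og; apply: obsD => //; exact: obsN. Qed.

Lemma obsX f p : obs f -> obs (fun M => f M ^+ p).
Proof.
move=> of_; elim: p => [|p IH]; first exact: obs_cst.
have -> : (fun M => f M ^+ p.+1) = (fun M => f M * f M ^+ p).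
  by apply/funext => M; exact: exprS.
exact: obsM.
Qed.

Lemma obs_sum (I : Type) (s : seq I) (Q : pred I) (f : I -> 'M[R]_(k, n) -> R) :
  (forall i, Q i -> obs (f i)) -> obs (fun M => \sum_(i <- s | Q i) f i M).
Proof.
move=> of_; elim: s => [|x s IH].
  have -> : (fun M => \sum_(i <- [::] | Q i) f i M) = fun=> 0.
    by apply/funext => M; rewrite big_nil.
  exact: obs_cst.
have -> : (fun M => \sum_(i <- x :: s | Q i) f i M) =
    fun M => (if Q x then f x M else 0) + \sum_(i <- s | Q i) f i M.
  by apply/funext => M; rewrite big_cons; case: (Q x); rewrite ?add0r.
apply: obsD => //; case Qx: (Q x); [exact: of_|exact: obs_cst].
Qed.

Lemma measurable_of_continuous_mx (f : 'M[R]_(k, n) -> R) :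
  continuous f -> measurable_fun [set: borel_matrix k n] (f : borel_matrix k n -> R).
Proof.
move=> /continuousP cf; apply: (@measurability _ _ (borel_matrix k n) _ setT f _ (RGenOpens.measurableE R)).
move=> _ [_ [a [b ->] <-]]; rewrite setTI; apply: sub_sigma_algebra.
exact/cf/interval_open.
Qed.

Lemma stiefel_le1 (M : 'M[R]_(k, n)) a c : stiefel M -> `|M a c| <= 1.
Proof.
move=> MM; have := congr1 (fun N : 'M[R]_k => N a a) MM; rewrite !mxE eqxx => aa.
rewrite -(@expr_le1 _ 2) // real_normK ?num_real // -[leRHS]aa (bigD1 c) //= mxE -expr2.
by rewrite lerDl sumr_ge0 // => l _; rewrite mxE -expr2 sqr_ge0.
Qed.

Lemma obs_coord a c : obs (fun M => M a c).
Proof.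
split; first by apply: measurable_of_continuous_mx; exact: coord_continuous.
by exists 1 => M; exact: stiefel_le1.
Qed.

Lemma obs_integrable f : obs f -> P.-integrable setT (EFin \o (f \o V)).
Proof.
move=> [mf [C Cf]]; apply: measurable_bounded_integrable => //.
- exact: le_lt_trans (probability_le1 P measurableT) (ltry 1).
- exact: measurableT_comp.
- exists C; split; first exact: num_real.
  by move=> x Cx w _ /=; apply: le_trans (Cf _ (VS w)) _; exact: ltW.
Qed.

Lemma Ex_cst c : Ex (fun=> c) = c.
Proof.
rewrite /Ex Rintegral_cst // -[RHS]mulr1; congr (_ * _).
by rewrite -[RHS]/(fine 1%E); congr fine; exact: probability_setT.
Qed.

Lemma ExD f g : obs f -> obs g -> Ex (fun M => f M + g M) = Ex f + Ex g.
Proof. by move=> of_ og; rewrite /Ex RintegralD //; exact: obs_integrable. Qed.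

Lemma ExZ c f : obs f -> Ex (fun M => c * f M) = c * Ex f.
Proof. by move=> of_; rewrite /Ex RintegralZl //; exact: obs_integrable. Qed.

Lemma ExB f g : obs f -> obs g -> Ex (fun M => f M - g M) = Ex f - Ex g.
Proof. by move=> of_ og; rewrite /Ex RintegralB //; exact: obs_integrable. Qed.

Lemma Ex_sum (I : Type) (s : seq I) (Q : pred I) (f : I -> 'M[R]_(k, n) -> R) :
  (forall i, Q i -> obs (f i)) ->
  Ex (fun M => \sum_(i <- s | Q i) f i M) = \sum_(i <- s | Q i) Ex (f i).
Proof.
move=> of_; elim: s => [|x s IH].
  by rewrite big_nil -[RHS]Ex_cst; congr Ex; apply/funext => M; rewrite big_nil.
rewrite big_cons -IH; case: ifP => Qx; last first.
  by congr Ex; apply/funext => M; rewrite big_cons Qx.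
rewrite -ExD; [|exact: of_|exact: obs_sum].
by congr Ex; apply/funext => M; rewrite big_cons Qx.
Qed.

Lemma le_Ex f g : obs f -> obs g -> (forall M, stiefel M -> f M <= g M) -> Ex f <= Ex g.
Proof.
move=> of_ og fg; apply: le_Rintegral => //; [exact: obs_integrable..|].
by move=> w _; exact/fg/VS.
Qed.

Lemma eq_Ex f g : (forall M, stiefel M -> f M = g M) -> Ex f = Ex g.
Proof. by move=> fg; apply: eq_Rintegral => w _; exact/fg/VS. Qed.

Hypothesis VU : uniform_on_stiefel (distribution P V).

(** The Borel structure of matrices comes from their topology, so the maps of the
    invariance hypothesis are measurable by continuity. *)
Lemma continuous_mulmxr (W : 'M[R]_n) : continuous (fun M : 'M[R]_(k, n) => M *m W).
Proof.
move=> M A [Q MQ QA].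
have E : forall i j, \forall N \near M, Q i j ((N *m W) i j).
  move=> i j; have MW : mxcvg (nbhs M) (fun N : 'M[R]_(k, n) => N *m W) (M *m W).
    apply: mxcvgM; last exact: mxcvg_cst.
    by move=> a c; exact: coord_continuous.
  exact: MW (MQ i j).
have EE i := @filter_forall _ _ (fun j N => Q i j ((N *m W) i j)) _ (nbhs_filter M) (E i).
have := @filter_forall _ _ (fun i N => forall j, Q i j ((N *m W) i j)) _ (nbhs_filter M) EE.
by apply: filterS => N; exact: QA.
Qed.

Lemma measurable_mulmxr (W : 'M[R]_n) : measurable_fun [set: borel_matrix k n]
  ((fun M : 'M[R]_(k, n) => M *m W) : borel_matrix k n -> borel_matrix k n).
Proof.
pose tau : borel_matrix k n -> borel_matrix k n := fun M : 'M[R]_(k, n) => M *m W.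
apply: (@measurability _ _ _ _ _ tau (@open 'M[R]_(k, n))) => //.
move=> _ [A oA <-]; rewrite setTI; apply: sub_sigma_algebra.
by have /continuousP cW := @continuous_mulmxr W; exact: cW.
Qed.

Lemma Ex_mulmxr f W : obs f -> orthogonal_group W -> Ex (fun M => f (M *m W)) = Ex f.
Proof.
move=> of_ oW; have [mf _] := of_.
pose tau : borel_matrix k n -> borel_matrix k n := fun M : 'M[R]_(k, n) => M *m W.
have mtau : measurable_fun setT tau.
  exact: measurable_mulmxr.
have stW M : stiefel M -> stiefel (M *m W).
  by rewrite /stiefel /= => MM; rewrite trmx_mul mulmxA -(mulmxA M) oW mulmx1.
have otau : obs (fun M => f (M *m W)).
  split; first exact: (measurableT_comp mf mtau).
  by have [_ [C Cf]] := of_; exists C => M /stW /Cf.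
have mft : measurable_fun setT (EFin \o (f \o tau)).
  by apply/measurable_EFinP; exact: (measurableT_comp mf mtau).
have mfE : measurable_fun setT (EFin \o f : borel_matrix k n -> \bar R).
  by apply/measurable_EFinP; exact: mf.
have intt := obs_integrable otau; have intf := obs_integrable of_.
congr fine.
transitivity (\int[distribution P V]_M (EFin \o (f \o tau)) M)%E.
  by rewrite integral_pushforward.
transitivity (\int[pushforward (distribution P V) tau]_M (EFin \o f) M)%E.
  have H := integrable_pushforward (measurable_funPT V) mft intt measurableT.
  exact: esym (integral_pushforward mtau mfE H measurableT).
transitivity (\int[distribution P V]_M (EFin \o f) M)%E.
  apply: eq_measure_integral => B mB _.
  have [_ /(_ 1%:M W)] := VU; rewrite /orthogonal_group /= trmx1 mulmx1.
  move=> /(_ erefl oW B mB) <-; congr (distribution P V _).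
  by apply/seteqP; split => M /=; rewrite mul1mx.
by rewrite integral_pushforward.
Qed.

End Observables.

(** * Derivatives along plane rotations *)

Section Rotations.
Context {R : realType} {k n : nat}.
Implicit Types (M : 'M[R]_(k, n)) (i j : 'I_n) (t : R).

(** Rational parametrization of the circle, with unit speed at [t = 0]. *)
Definition rcos t : R := (1 - t ^+ 2 / 4) / (1 + t ^+ 2 / 4).
Definition rsin t : R := t / (1 + t ^+ 2 / 4).

Lemma rden_gt0 t : 0 < 1 + t ^+ 2 / 4.
Proof. by have := sqr_ge0 t; lra. Qed.

Lemma rcos2_rsin2 t : rcos t ^+ 2 + rsin t ^+ 2 = 1.
Proof. by rewrite /rcos /rsin; field; rewrite gt_eqF //; have := sqr_ge0 t; lra. Qed.

Lemma rcos_bound t : `|rcos t - 1| <= t ^+ 2.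
Proof.
have d0 := rden_gt0 t; have t2 := sqr_ge0 t.
have -> : rcos t - 1 = - ((t ^+ 2 / 2) / (1 + t ^+ 2 / 4)).
  by rewrite /rcos; field; rewrite gt_eqF //; lra.
rewrite normrN ger0_norm; last by apply: divr_ge0; lra.
rewrite ler_pdivrMr //; nra.
Qed.

Lemma rsin_bound t : `|t| <= 1 -> `|rsin t - t| <= t ^+ 2.
Proof.
move=> t1; have d0 := rden_gt0 t; have t2 := sqr_ge0 t.
have -> : rsin t - t = - (t * ((t ^+ 2 / 4) / (1 + t ^+ 2 / 4))).
  by rewrite /rsin; field; rewrite gt_eqF //; lra.
have z0 : 0 <= (t ^+ 2 / 4) / (1 + t ^+ 2 / 4) by apply: divr_ge0; lra.
rewrite normrN normrM (ger0_norm z0); apply: le_trans (ler_wpM2r z0 t1) _.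
rewrite mul1r ler_pdivrMr //; nra.
Qed.

(** Rotation in the plane spanned by the coordinates [i] and [j]. *)
Definition rot i j t : 'M[R]_n :=
  1%:M + (rcos t - 1) *: (delta_mx i i + delta_mx j j)
       + rsin t *: (delta_mx i j - delta_mx j i).

End Rotations.

Lemma mulmx_delta {R : realType} k n (M : 'M[R]_(k, n)) (i j : 'I_n) a q :
  (M *m delta_mx i j) a q = M a i * (q == j)%:R.
Proof.
rewrite mxE (bigD1 i) //= big1 ?addr0 => [|l li]; first by rewrite mxE eqxx.
by rewrite mxE (negbTE li) mulr0.
Qed.

Section RotationCalculus.
Context {R : realType} {k n : nat}.
Implicit Types (M : 'M[R]_(k, n)) (i j : 'I_n) (t : R).

Lemma mulmx_rot m (M : 'M[R]_(m, n)) i j t a q : (M *m rot i j t) a q =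
  M a q + (rcos t - 1) * (M a i * (q == i)%:R + M a j * (q == j)%:R)
        + rsin t * (M a i * (q == j)%:R - M a j * (q == i)%:R).
Proof.
rewrite /rot !mulmxDr mulmx1 -!scalemxAr mulmxDr mulmxBr.
by rewrite !(entryD, entryZ, entryN) !mulmx_delta.
Qed.

Lemma rot_orthogonal i j t : i != j -> orthogonal_group (rot i j t).
Proof.
move=> ij; rewrite /orthogonal_group /=.
have -> : (rot i j t)^T = rot j i t.
  apply/matrixP => p q; rewrite !mxE (eq_sym q p) ![(q == _) && _]andbC.
  by rewrite [X in (rcos t - 1) * X]addrC.
apply/matrixP => p q; rewrite mulmx_rot.
have Rpq l : rot i j t p l = (p == l)%:R
    + (rcos t - 1) * ((p == i)%:R * (l == i)%:R + (p == j)%:R * (l == j)%:R)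
    + rsin t * ((p == i)%:R * (l == j)%:R - (p == j)%:R * (l == i)%:R).
  by rewrite /rot !mxE -!natrM !mulnb.
rewrite !Rpq !mxE.
have := rcos2_rsin2 t; set c := rcos t; set s := rsin t => cs.
have ji : j != i by rewrite eq_sym.
rewrite !eqxx (negbTE ij) (negbTE ji).
have [->|pi] := eqVneq p i; have [->|qi] := eqVneq q i;
 rewrite ?(negbTE ij) ?(negbTE ji) ?(negbTE pi) ?eqxx /=.
- lra.
- ring.
- ring.
- by case: (p == j); case: (q == j); rewrite /=; lra.
Qed.

Lemma stiefel_rot M i j t : i != j -> stiefel M -> stiefel (M *m rot i j t).
Proof.
rewrite /stiefel /= => ij MM.
by rewrite trmx_mul mulmxA -(mulmxA M) (rot_orthogonal _ ij) mulmx1.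
Qed.

(** [g] is the derivative of [f] along the rotations of the columns [i] and
    [j]. The quadratic remainder is uniform on the Stiefel manifold, so that it
    survives integration; in this form the derivation rules need no
    differentiability of [f] in the ambient space. *)
Definition rotder i j (f g : 'M[R]_(k, n) -> R) : Prop :=
  [/\ obs f, obs g & exists C, forall M, stiefel M -> forall t, `|t| <= 1 ->
    `|f (M *m rot i j t) - f M - t * g M| <= C * t ^+ 2].

Lemma rotder_cst i j c : rotder i j (fun=> c) (fun=> 0).
Proof.
split; [exact: obs_cst..|exists 0 => M _ t _].
by rewrite subrr mulr0 subr0 normr0 mul0r.
Qed.

Lemma rotderD i j f g f' g' : rotder i j f f' -> rotder i j g g' ->
  rotder i j (fun M => f M + g M) (fun M => f' M + g' M).
Proof.
move=> [of_ of' [C Cf]] [og og' [D Dg]]; split; [exact: obsD..|].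
exists (C + D) => M MS t t1.
have -> : f (M *m rot i j t) + g (M *m rot i j t) - (f M + g M) - t * (f' M + g' M)
  = (f (M *m rot i j t) - f M - t * f' M) + (g (M *m rot i j t) - g M - t * g' M).
  by ring.
by rewrite mulrDl (le_trans (ler_normD _ _)) // lerD //; [exact: Cf|exact: Dg].
Qed.

Lemma rotder_lip i j f f' : rotder i j f f' -> exists C, [/\ 0 <= C,
  forall M, stiefel M -> `|f M| <= C, forall M, stiefel M -> `|f' M| <= C &
  forall M, stiefel M -> forall t, `|t| <= 1 ->
    `|f (M *m rot i j t) - f M - t * f' M| <= C * t ^+ 2 /\
    `|f (M *m rot i j t) - f M| <= 2 * C * `|t|].
Proof.
move=> [[_ [C Cf]] [_ [D Df]] [E Ef]].
pose K := `|C| + `|D| + `|E|.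
have [[c0 d0] e0] := (normr_ge0 C, normr_ge0 D, normr_ge0 E).
have [[c1 d1] e1] := (ler_norm C, ler_norm D, ler_norm E).
exists K; rewrite /K; split; [lra|by move=> M /Cf; lra|by move=> M /Df; lra|].
move=> M MS t t1; have := Ef M MS t t1; have := Df M MS.
set r := _ - _ - _ => D1 E1.
have t0 := normr_ge0 t; have t2 : t ^+ 2 = `|t| ^+ 2 by rewrite real_normK ?num_real.
have tt : t ^+ 2 <= `|t| by rewrite t2 expr2 ler_piMl.
have E2 : `|r| <= (`|C| + `|D| + `|E|) * t ^+ 2.
  by apply: le_trans E1 _; apply: ler_wpM2r; [exact: sqr_ge0|lra].
split=> //.
have -> : f (M *m rot i j t) - f M = r + t * f' M by rewrite /r; ring.
apply: le_trans (ler_normD _ _) _; rewrite normrM; nra.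
Qed.

(** The product of the two increments, of order [t ^+ 2], joins the remainder. *)
Lemma rotderM i j f g f' g' : rotder i j f f' -> rotder i j g g' ->
  rotder i j (fun M => f M * g M) (fun M => f' M * g M + f M * g' M).
Proof.
move=> df dg; have [[of_ of' _] [og og' _]] := (df, dg).
have [C [C0 Cf Cf' CL]] := rotder_lip df; have [D [D0 Dg Dg' DL]] := rotder_lip dg.
split; [exact: obsM|by apply: obsD; exact: obsM|].
exists (C * D + C * D + 4 * C * D) => M MS t t1.
have [Q1 L1] := CL M MS t t1; have [Q2 L2] := DL M MS t t1.
have := Cf M MS; have := Dg M MS.
set f1 := f (_ *m _) in Q1 L1 *; set g1 := g (_ *m _) in Q2 L2 * => G F.
have -> : f1 * g1 - f M * g M - t * (f' M * g M + f M * g' M) =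
   (f1 - f M - t * f' M) * g M + f M * (g1 - g M - t * g' M) + (f1 - f M) * (g1 - g M).
  by ring.
have t2 : t ^+ 2 = `|t| ^+ 2 by rewrite real_normK ?num_real.
have -> : (C * D + C * D + 4 * C * D) * t ^+ 2 =
  C * D * t ^+ 2 + C * D * t ^+ 2 + 4 * C * D * t ^+ 2 by ring.
apply: le_trans (ler_normD _ _) _; apply: lerD.
  apply: le_trans (ler_normD _ _) _; apply: lerD; rewrite normrM.
    by rewrite mulrAC; apply: ler_pM.
  by rewrite -mulrA; apply: ler_pM.
have -> : 4 * C * D * t ^+ 2 = (2 * C * `|t|) * (2 * D * `|t|) by rewrite t2; ring.
by rewrite normrM; apply: ler_pM.
Qed.

Lemma rotder_comp i j f f' (F F' : R -> R) K : rotder i j f f' ->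
  obs (fun M => F (f M)) -> obs (fun M => F' (f M)) -> 0 <= K ->
  (forall x y, `|F y - F x - F' x * (y - x)| <= K * (y - x) ^+ 2) ->
  rotder i j (fun M => F (f M)) (fun M => F' (f M) * f' M).
Proof.
move=> df oF oF' K0 Fq; have [of_ of' _] := df.
have [C [C0 Cf Cf' CL]] := rotder_lip df.
split=> //; first exact: obsM.
have [_ [D Db]] := oF'.
exists (4 * K * C ^+ 2 + `|D| * C) => M MS t t1.
have [Q1 L1] := CL M MS t t1; have := Fq (f M) (f (M *m rot i j t)).
set f1 := f (_ *m _) in Q1 L1 * => Q.
have -> : F f1 - F (f M) - t * (F' (f M) * f' M) =
  (F f1 - F (f M) - F' (f M) * (f1 - f M)) + F' (f M) * (f1 - f M - t * f' M) by ring.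
have t2 : t ^+ 2 = `|t| ^+ 2 by rewrite real_normK ?num_real.
rewrite [leRHS]mulrDl; apply: le_trans (ler_normD _ _) _; apply: lerD.
  have -> : 4 * K * C ^+ 2 * t ^+ 2 = K * (2 * C * `|t|) ^+ 2 by rewrite t2; ring.
  apply: le_trans Q _; rewrite ler_wpM2l //.
  by rewrite -[leLHS]real_normK ?num_real // lerXn2r // ?nnegrE // mulr_ge0 // mulr_ge0.
rewrite normrM -mulrA; apply: ler_pM => //.
exact: le_trans (Db M MS) (ler_norm D).
Qed.

Lemma rotder_coord i j a q : i != j -> rotder i j (fun M => M a q)
  (fun M => M a i * (q == j)%:R - M a j * (q == i)%:R).
Proof.
move=> ij; split; first exact: obs_coord.
  by apply: obsB; (apply: obsM; [exact: obs_coord|exact: obs_cst]).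
exists 4 => M MS t t1; rewrite mulmx_rot.
set X := M a i * (q == i)%:R + _; set Y := M a i * (q == j)%:R - _.
have B z w : (`|M a z * (w : bool)%:R| <= 1).
  by case: w; rewrite ?mulr1 ?mulr0 ?normr0 // stiefel_le1.
have X2 : `|X| <= 2 by apply: le_trans (ler_normD _ _) _; rewrite -[2]/(1 + 1) lerD.
have Y2 : `|Y| <= 2 by apply: le_trans (ler_normB _ _) _; rewrite -[2]/(1 + 1) lerD.
have -> : M a q + (rcos t - 1) * X + rsin t * Y - M a q - t * Y =
  (rcos t - 1) * X + (rsin t - t) * Y by ring.
have -> : 4 * t ^+ 2 = t ^+ 2 * 2 + t ^+ 2 * 2 :> R by ring.
apply: le_trans (ler_normD _ _) _; rewrite !normrM; apply: lerD.
  by apply: ler_pM => //; exact: rcos_bound.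
by apply: ler_pM => //; exact: rsin_bound.
Qed.

End RotationCalculus.

(** * Integration by parts for the first columns *)

Section Stein.
Context {R : realType} {k n : nat} {d : measure_display} {T : measurableType d}.
Context (P : probability T R) (V : {mfun T >-> @borel_matrix R k n}).
Hypothesis VS : forall w, stiefel (V w).
Hypothesis VU : uniform_on_stiefel (distribution P V).
Context {r : nat} (rn : (r <= n)%N).
Implicit Types (M : 'M[R]_(k, n)).

Local Notation Ex := (Ex P V).
Local Notation col := (widen_ord rn).

(** By invariance the mean increment vanishes, so [t * Ex g] is [O(t ^+ 2)]. *)
Lemma Ex_rotder i j f g : i != j -> rotder i j f g -> Ex g = 0.
Proof.
move=> ij [of_ og [C Cf]].
have oft t : obs (fun M => f (M *m rot i j t)).
  have [mf [D Df]] := of_; split; last first.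
    by exists D => M MS; apply: Df; exact: stiefel_rot.
  exact: (measurableT_comp mf (measurable_mulmxr (rot i j t))).
have bound t : `|t| <= 1 -> `|t * Ex g| <= C * t ^+ 2.
  move=> t1; rewrite -normrN.
  have <- : Ex (fun M => f (M *m rot i j t) - f M - t * g M) = - (t * Ex g).
    rewrite ExB //; [|by apply: obsB|exact: obsZ].
    rewrite ExB // ExZ // (Ex_mulmxr VS VU of_); first by rewrite subrr sub0r.
    exact: rot_orthogonal.
  have oh : obs (fun M => f (M *m rot i j t) - f M - t * g M).
    by apply: obsB; [exact: obsB|exact: obsZ].
  rewrite ler_norml; apply/andP; split.
    rewrite -(Ex_cst P V (- (C * t ^+ 2))).
    apply: le_Ex => //; first exact: obs_cst.
    by move=> M MS; have := Cf M MS t t1; rewrite ler_norml => /andP[].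
  rewrite -[leRHS](Ex_cst P V).
  apply: le_Ex => //; first exact: obs_cst.
  by move=> M MS; have := Cf M MS t t1; rewrite ler_norml => /andP[].
apply/eqP; apply: contraT => g0.
have e0 : 0 < `|Ex g| by rewrite normr_gt0.
pose t := Num.min 1 (`|Ex g| / (2 * (`|C| + 1))).
have C0 := normr_ge0 C; have C1 := ler_norm C.
have t0 : 0 < t by rewrite lt_min ltr01 divr_gt0 // mulr_gt0 // ltr_wpDl.
have t1 : t <= 1 by rewrite ge_min lexx.
have t2 : t * (2 * (`|C| + 1)) <= `|Ex g|.
  by rewrite -ler_pdivlMr ?mulr_gt0 ?ltr_wpDl // ge_min lexx orbT.
have := bound t; rewrite [`|t|]gtr0_norm // => /(_ t1).
rewrite normrM (gtr0_norm t0) expr2 mulrCA ler_pM2l //.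
nra.
Qed.

Definition lcols M : 'M[R]_(k, r) := \matrix_(a, i) M a (col i).

Lemma sum_right_cols (F : 'I_n -> R) :
  \sum_(j < n | (r <= j)%N) F j = \sum_j F j - \sum_(i < r) F (col i).
Proof.
apply/esym/eqP; rewrite subr_eq (bigID (fun j : 'I_n => (r <= j)%N)) /=.
rewrite eq_sym; apply/eqP; congr (_ + _); rewrite -(big_ord_narrow rn).
by apply: eq_bigl => j; rewrite ltnNge.
Qed.

Lemma sum_right_mul M a b : stiefel M ->
  \sum_(j < n | (r <= j)%N) M a j * M b j = defect (lcols M) a b.
Proof.
move=> MM; rewrite sum_right_cols !mxE; congr (_ - _).
  have := congr1 (fun N : 'M[R]_k => N a b) MM; rewrite !mxE => <-.
  by apply: eq_bigr => j _; rewrite mxE.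
by apply: eq_bigr => i _; rewrite !mxE.
Qed.

(** [psi] is the gradient of [phi], seen as a function of the first [r]
    columns: this is what the rotations of a column [i < r] and a column
    [j >= r] see of it. *)
Definition colgrad (phi : 'M[R]_(k, n) -> R)
    (psi : 'I_k -> 'I_r -> 'M[R]_(k, n) -> R) : Prop :=
  obs phi /\ (forall b i, obs (psi b i)) /\
  forall (i : 'I_r) (j : 'I_n), (r <= j)%N ->
    rotder (col i) j phi (fun M => - \sum_b psi b i M * M b j).

Lemma col_neq (i : 'I_r) (j : 'I_n) : (r <= j)%N -> col i != j.
Proof. by move=> rj; rewrite -val_eqE /= ltn_eqF // (leq_trans _ rj). Qed.

(** Integration by parts for the law of the first [r] columns [X]. The columns
    [j >= r] enter only through [\sum_j V a j * V b j = (1 - X X^T) a b], which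
    replaces the density of [X]. *)
Lemma stein phi psi a i : colgrad phi psi ->
  (n - r)%:R * Ex (fun M => M a (col i) * phi M) =
  Ex (fun M => \sum_b defect (lcols M) a b * psi b i M).
Proof.
move=> [ophi [opsi dphi]].
have odef b c : obs (fun M => defect (lcols M) b c).
  rewrite (_ : (fun M => defect (lcols M) b c) =
     fun M => (b == c)%:R - \sum_(l < r) M b (col l) * M c (col l)).
    apply: obsB; first exact: obs_cst.
    by apply: obs_sum => l _; apply: obsM; exact: obs_coord.
  apply/funext => M; rewrite !mxE; congr (_ - _).
  by apply: eq_bigr => l _; rewrite !mxE.
pose D (j : 'I_n) M := (M a (col i) * (j == j)%:R - M a j * (j == col i)%:R) * phi M +
    M a j * (- \sum_b psi b i M * M b j).
have oD j : obs (D j).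
  apply: obsD; first apply: obsM => //.
    by apply: obsB; (apply: obsM; [exact: obs_coord|exact: obs_cst]).
  apply: obsM; first exact: obs_coord.
  apply: obsN; apply: obs_sum => b _; apply: obsM => //; exact: obs_coord.
have D0 (j : 'I_n) : (r <= j)%N -> Ex (D j) = 0.
  move=> rj; have ij := col_neq i rj.
  exact: Ex_rotder ij (rotderM (rotder_coord a j ij) (dphi i j rj)).
have : Ex (fun M => \sum_(j < n | (r <= j)%N) D j M) = 0.
  by rewrite Ex_sum //; exact: big1.
rewrite (@eq_Ex _ _ _ _ _ P V VS _ (fun M => (n - r)%:R * (M a (col i) * phi M) -
    \sum_b defect (lcols M) a b * psi b i M)).
  rewrite ExB //.
  - rewrite ExZ //; first by move=> /eqP; rewrite subr_eq0 => /eqP.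
    by apply: obsM => //; exact: obs_coord.
  - by apply: obsZ; apply: obsM => //; exact: obs_coord.
  - by apply: obs_sum => b _; exact: obsM.
move=> M MS; rewrite /D big_split /=; congr (_ + _).
  rewrite (eq_bigr (fun=> M a (col i) * phi M)) => [|j rj].
    by rewrite sum_right_cols !sumr_const !card_ord -mulrnBr // mulr_natl.
  by rewrite eqxx eq_sym (negbTE (col_neq i rj)) mulr1 mulr0 subr0.
rewrite (eq_bigr (fun j => - \sum_b M a j * (psi b i M * M b j))) => [|j _]; last first.
  by rewrite mulrN mulr_sumr.
rewrite sumrN exchange_big /=; congr (- _); apply: eq_bigr => b _.
rewrite -sum_right_mul // mulr_suml; apply: eq_bigr => j _; ring.
Qed.

End Stein.

(** * Calculus of test functions and moments of a row *)

Section ColumnCalculus.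
Context {R : realType} {k n r : nat} (rn : (r <= n)%N).
Implicit Types (M : 'M[R]_(k, n)) (phi : 'M[R]_(k, n) -> R).
Implicit Types (psi : 'I_k -> 'I_r -> 'M[R]_(k, n) -> R).

Local Notation col := (widen_ord rn).
Local Notation colgrad := (@colgrad R k n r rn).

Lemma eq_colgrad phi psi psi' : colgrad phi psi ->
  (forall b i M, psi b i M = psi' b i M) -> colgrad phi psi'.
Proof. by move=> + E; suff -> : psi = psi' by []; apply/funext => b; apply/funext => i; apply/funext. Qed.

Lemma colgrad_cst c : colgrad (fun=> c) (fun _ _ _ => 0).
Proof.
split; [exact: obs_cst|split=> [b i|i j rj]; first exact: obs_cst].
have := rotder_cst (k := k) (col i) j c; congr rotder.
by apply/funext => M; rewrite big1 ?oppr0 // => b _; rewrite mul0r.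
Qed.

Lemma colgrad_coord a l :
  colgrad (fun M => M a (col l)) (fun b i _ => ((b == a) && (i == l))%:R).
Proof.
split; [exact: obs_coord|split=> [b i|i j rj]; first exact: obs_cst].
have := rotder_coord (R := R) a (col l) (col_neq rn i rj).
congr rotder; apply/funext => M; rewrite (bigD1 a) //= big1 ?addr0 => [|b /negbTE -> ]; last first.
  by rewrite mul0r.
rewrite eqxx /= (negbTE (col_neq rn l rj)) mulr0 sub0r mulrC eq_sym.
by congr (- (_%:R * _)); apply/eqP/eqP => [/(congr1 val)/= /val_inj|->].
Qed.

Lemma colgradD phi psi phi' psi' : colgrad phi psi -> colgrad phi' psi' ->
  colgrad (fun M => phi M + phi' M) (fun b i M => psi b i M + psi' b i M).
Proof.
move=> [of_ [og df]] [of' [og' df']]; split; first exact: obsD.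
split=> [b i|i j rj]; first exact: obsD.
have := rotderD (df i j rj) (df' i j rj); congr rotder; apply/funext => M.
by rewrite -opprD -big_split; congr (- _); apply: eq_bigr => b _; rewrite mulrDl.
Qed.

Lemma colgradM phi psi phi' psi' : colgrad phi psi -> colgrad phi' psi' ->
  colgrad (fun M => phi M * phi' M)
          (fun b i M => psi b i M * phi' M + phi M * psi' b i M).
Proof.
move=> [of_ [og df]] [of' [og' df']]; split; first exact: obsM.
split=> [b i|i j rj]; first by apply: obsD; exact: obsM.
have := rotderM (df i j rj) (df' i j rj); congr rotder; apply/funext => M.
rewrite mulNr mulrN -opprD mulr_suml mulr_sumr -big_split; congr (- _).
by apply: eq_bigr => b _ /=; ring.
Qed.

Lemma colgradZ c phi psi : colgrad phi psi ->
  colgrad (fun M => c * phi M) (fun b i M => c * psi b i M).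
Proof.
by move=> /(colgradM (colgrad_cst c)) H; apply: eq_colgrad H _ => b i M; rewrite mul0r add0r.
Qed.

Lemma colgrad_sum (I : finType) (phi : I -> 'M[R]_(k, n) -> R)
    (psi : I -> 'I_k -> 'I_r -> 'M[R]_(k, n) -> R) :
  (forall x, colgrad (phi x) (psi x)) ->
  colgrad (fun M => \sum_x phi x M) (fun b i M => \sum_x psi x b i M).
Proof.
move=> df; split; first by apply: obs_sum => x _; exact: (df x).1.
split=> [b i|i j rj]; first by apply: obs_sum => x _; exact: (df x).2.1.
have H (s : seq I) : rotder (col i) j (fun M => \sum_(x <- s) phi x M)
    (fun M => \sum_(x <- s) - \sum_b psi x b i M * M b j).
  elim: s => [|x s IH].
    have := rotder_cst (k := k) (col i) j (0 : R).
    by congr rotder; apply/funext => M; rewrite big_nil.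
  have := rotderD ((df x).2.2 i j rj) IH.
  by congr rotder; apply/funext => M; rewrite big_cons.
have := H (index_enum I); congr rotder; apply/funext => M.
rewrite sumrN exchange_big; congr (- _); apply: eq_bigr => b _.
by rewrite mulr_suml.
Qed.

Lemma colgrad_comp phi psi (F F' : R -> R) K : colgrad phi psi ->
  obs (fun M => F (phi M)) -> obs (fun M => F' (phi M)) -> 0 <= K ->
  (forall x y, `|F y - F x - F' x * (y - x)| <= K * (y - x) ^+ 2) ->
  colgrad (fun M => F (phi M)) (fun b i M => F' (phi M) * psi b i M).
Proof.
move=> [of_ [og df]] oF oF' K0 FK; split=> //.
split=> [b i|i j rj]; first exact: obsM.
have := rotder_comp (df i j rj) oF oF' K0 FK; congr rotder; apply/funext => M.
by rewrite mulrN mulr_sumr; congr (- _); apply: eq_bigr => b _; rewrite mulrA.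
Qed.

Lemma colgradX phi psi p : colgrad phi psi ->
  colgrad (fun M => phi M ^+ p) (fun b i M => p%:R * phi M ^+ p.-1 * psi b i M).
Proof.
move=> df; elim: p => [|p IH].
  by apply: eq_colgrad (colgrad_cst 1) _ => b i M; rewrite !mul0r.
have := colgradM df IH.
have -> : (fun M => phi M * phi M ^+ p) = fun M => phi M ^+ p.+1.
  by apply/funext => M; rewrite exprS.
move=> H; apply: eq_colgrad H _ => b i M /=.
case: p {IH} => [|p]; first by rewrite expr0; ring.
by rewrite /= -[p.+2%:R]natr1 exprS; ring.
Qed.

End ColumnCalculus.

Section Moments.
Context {R : realType} {k n : nat} {d : measure_display} {T : measurableType d}.
Context (P : probability T R) (V : {mfun T >-> @borel_matrix R k n}).
Hypothesis VS : forall w, stiefel (V w).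
Hypothesis VU : uniform_on_stiefel (distribution P V).
Context {r : nat} (rn : (r <= n)%N).
Implicit Types (M : 'M[R]_(k, n)).

Local Notation Ex := (Ex P V).
Local Notation lcols := (lcols rn).

Lemma obs_lcols a i : obs (fun M => lcols M a i).
Proof.
have -> : (fun M => lcols M a i) = fun M => M a (widen_ord rn i).
  by apply/funext => M; rewrite mxE.
exact: obs_coord.
Qed.

Lemma obs_defect a b : obs (fun M => defect (lcols M) a b).
Proof.
have -> : (fun M => defect (lcols M) a b) =
    fun M => (a == b)%:R - \sum_(l < r) lcols M a l * lcols M b l.
  by apply/funext => M; rewrite !mxE; congr (_ - _); apply: eq_bigr => l _; rewrite !mxE.
apply: obsB; first exact: obs_cst.
by apply: obs_sum => l _; apply: obsM; exact: obs_lcols.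
Qed.

(** [stein] for a combination of the rows with constant coefficients. *)
Lemma stein_row (w : 'cV[R]_k) phi psi i : colgrad rn phi psi ->
  (n - r)%:R * Ex (fun M => ((lcols M)^T *m w) i 0 * phi M) =
  Ex (fun M => \sum_b (defect (lcols M) *m w) b 0 * psi b i M).
Proof.
move=> df; have [of_ [og _]] := df.
have oX a : obs (fun M => M a (widen_ord rn i) * phi M) by apply: obsM => //; exact: obs_coord.
have -> : (fun M => ((lcols M)^T *m w) i 0 * phi M) =
    fun M => \sum_a w a 0 * (M a (widen_ord rn i) * phi M).
  by apply/funext => M; rewrite mxE mulr_suml; apply: eq_bigr => a _; rewrite !mxE; ring.
rewrite Ex_sum // => [|a _]; last exact: obsZ.
rewrite mulr_sumr.
transitivity (\sum_a w a 0 * Ex (fun M => \sum_b defect (lcols M) a b * psi b i M)).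
  by apply: eq_bigr => a _; rewrite ExZ // -(stein VS VU _ _ df); ring.
have oS a : obs (fun M => \sum_b defect (lcols M) a b * psi b i M).
  by apply: obs_sum => b _; apply: obsM => //; exact: obs_defect.
under eq_bigr => a _ do rewrite -ExZ //.
rewrite -Ex_sum // => [|a _]; last exact: obsZ.
congr Ex; apply/funext => M.
under eq_bigr do rewrite mulr_sumr.
rewrite exchange_big; apply: eq_bigr => b _ /=.
rewrite mxE mulr_suml; apply: eq_bigr => a _.
have -> : defect (lcols M) b a = defect (lcols M) a b by rewrite -{1}defect_sym mxE.
ring.
Qed.

Definition rowsq (w : 'cV[R]_k) M : R := quad (lcols M *m (lcols M)^T) w.

Lemma rowsqE w M : rowsq w M = \sum_l (((lcols M)^T *m w) l 0) ^+ 2.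
Proof. exact: quad_gram. Qed.

Lemma colgrad_row (w : 'cV[R]_k) l : colgrad rn (fun M => ((lcols M)^T *m w) l 0)
  (fun b i _ => w b 0 * (i == l)%:R).
Proof.
have := colgrad_sum (fun a : 'I_k => colgradZ (w a 0) (colgrad_coord rn a l)).
have -> : (fun M => \sum_a w a 0 * M a (widen_ord rn l)) = (fun M => ((lcols M)^T *m w) l 0).
  by apply/funext => M; rewrite mxE; apply: eq_bigr => a _; rewrite !mxE mulrC.
move=> H; apply: eq_colgrad H _ => b i M.
rewrite (bigD1 b) //= eqxx big1 ?addr0 // => a ab.
by rewrite eq_sym (negbTE ab) mulr0.
Qed.

Lemma colgrad_rowsq w : colgrad rn (rowsq w)
  (fun b i M => 2 * w b 0 * ((lcols M)^T *m w) i 0).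
Proof.
have := colgrad_sum (fun l => colgradX 2 (colgrad_row w l)).
have -> : (fun M => \sum_l (((lcols M)^T *m w) l 0) ^+ 2) = rowsq w.
  by apply/funext => M; rewrite rowsqE.
move=> H; apply: eq_colgrad H _ => b i M.
rewrite (bigD1 i) //= eqxx big1 ?addr0 => [|l li]; first by rewrite expr1 mulr1 mulrAC.
by rewrite eq_sym (negbTE li) !mulr0.
Qed.

(** The squared length of a unit row truncated to [r] columns follows a Beta law;
    its moments come from [stein_row] with the functions [y l * rowsq w ^+ p],
    where [y l] are the coordinates of that row. *)
Lemma rowsq_moment w p : quad 1%:M w = 1 ->
  (n + p.*2)%:R * Ex (fun M => rowsq w M ^+ p.+1) =
  (r + p.*2)%:R * Ex (fun M => rowsq w M ^+ p).
Proof.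
move=> w1.
have oq : obs (rowsq w) by have [] := colgrad_rowsq w.
have oX m : obs (fun M => rowsq w M ^+ m) by exact: obsX.
pose y l M := ((lcols M)^T *m w) l 0.
have oy l : obs (y l) by have [] := colgrad_row w l.
have S l := stein_row w l (colgradM (colgrad_row w l) (colgradX p (colgrad_rowsq w))).
have oA : obs (fun M => (1 - rowsq w M) * ((r + p.*2)%:R * rowsq w M ^+ p)).
  by apply: obsM; [apply: obsB => //; exact: obs_cst|exact: obsZ].
have E : (n - r)%:R * Ex (fun M => rowsq w M ^+ p.+1) =
    Ex (fun M => (1 - rowsq w M) * ((r + p.*2)%:R * rowsq w M ^+ p)).
  have -> : (fun M => rowsq w M ^+ p.+1) =
      (fun M => \sum_l y l M * (y l M * rowsq w M ^+ p)).
    apply/funext => M; rewrite exprS {1}rowsqE mulr_suml.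
    by apply: eq_bigr => l _; rewrite /y; ring.
  rewrite Ex_sum // => [|l _]; last by apply: obsM => //; apply: obsM.
  rewrite mulr_sumr (eq_bigr _ (fun l _ => S l)) -Ex_sum // => [|l _]; last first.
    apply: obs_sum => b _; apply: obsM.
      have -> : (fun M => (defect (lcols M) *m w) b 0) =
          fun M => \sum_a defect (lcols M) b a * w a 0 by apply/funext => M; rewrite mxE.
      by apply: obs_sum => a _; apply: obsM; [exact: obs_defect|exact: obs_cst].
    apply: obsD; first by apply: obsM; [exact: obs_cst|exact: oX].
    apply: obsM; first exact: (oy l).
    apply: obsM; first exact: obsZ.
    by apply: obsM; [exact: obs_cst|exact: (oy l)].
  congr Ex; apply/funext => M.
  have qS : 1 - rowsq w M = \sum_b (defect (lcols M) *m w) b 0 * w b 0.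
    rewrite -w1 -quadB /quad -mulmxA mxE; apply: eq_bigr => b _.
    by rewrite mxE mulrC.
  rewrite qS.
  transitivity (\sum_l (\sum_b (defect (lcols M) *m w) b 0 * w b 0) *
      (rowsq w M ^+ p + p.*2%:R * (y l M ^+ 2 * rowsq w M ^+ p.-1))).
    apply: eq_bigr => l _; rewrite mulr_suml; apply: eq_bigr => b _.
    by rewrite eqxx /= mulr1 /y -muln2 natrM; ring.
  rewrite -mulr_sumr; congr (_ * _); rewrite big_split /= sumr_const card_ord.
  rewrite -mulr_sumr -mulr_suml -rowsqE natrD mulrDl -[X in X + _]mulr_natl; congr (_ + _).
  by case: p {oX S oA} => [|p]; rewrite /= ?mul0r // -exprS.
have {}E : (n - r)%:R * Ex (fun M => rowsq w M ^+ p.+1) =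
  (r + p.*2)%:R * Ex (fun M => rowsq w M ^+ p) -
  (r + p.*2)%:R * Ex (fun M => rowsq w M ^+ p.+1).
  rewrite E -!ExZ // -ExB //; [|exact: obsZ..].
  by congr Ex; apply/funext => M; rewrite exprS; ring.
move/eqP: E; rewrite eq_sym subr_eq => /eqP ->.
by rewrite -mulrDl -natrD addnA subnK.
Qed.

End Moments.

(** * Exponential tails at the boundary *)

Section Events.
Context {R : realType} {k n : nat} {d : measure_display} {T : measurableType d}.
Context (P : probability T R) (V : {mfun T >-> @borel_matrix R k n}).
Hypothesis VS : forall w, stiefel (V w).

Local Notation Ex := (Ex P V).

Lemma Rintegral_event (E : set T) c : measurable E ->
  P.-integrable setT (EFin \o (fun w => c * \1_E w : R)) /\
  \int[P]_w (c * \1_E w) = c * fine (P E).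
Proof.
move=> mE; have iE : P.-integrable setT (EFin \o (\1_E : T -> R)).
  exact: integrable_indic.
split.
  have := integrableZl measurableT c iE.
  by congr (_.-integrable _ _); apply/funext => w /=; rewrite EFinM.
rewrite RintegralZl //; congr (_ * _).
by rewrite /Rintegral integral_indic // setIT.
Qed.

Lemma prob_le_Ex f c (E : set T) : measurable E -> obs f -> 0 <= c ->
  (forall M, stiefel M -> 0 <= f M) -> (forall w, E w -> c <= f (V w)) ->
  c * fine (P E) <= Ex f.
Proof.
move=> mE of_ c0 f0 fE; have [iE <-] := Rintegral_event c mE.
apply: le_Rintegral => //; first exact: obs_integrable.
move=> w _; rewrite indicE; have [/set_mem Ew|_] := boolP (w \in E).
  by rewrite mulr1; exact: fE.
by rewrite mulr0; exact: f0.
Qed.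

Lemma Ex_le_prob f c (E : set T) : measurable E -> obs f -> 0 <= c ->
  (forall w, f (V w) <= c) -> (forall w, ~ E w -> f (V w) <= 0) ->
  Ex f <= c * fine (P E).
Proof.
move=> mE of_ c0 f0 fE; have [iE <-] := Rintegral_event c mE.
apply: le_Rintegral => //; first exact: obs_integrable.
move=> w _; rewrite indicE; have [/set_mem Ew|/negP Ew] := boolP (w \in E).
  by rewrite mulr1; exact: f0.
by rewrite mulr0; apply: fE => /mem_set.
Qed.

End Events.

Section Tail.
Context {R : realType} {k n : nat} {d : measure_display} {T : measurableType d}.
Context (P : probability T R) (V : {mfun T >-> @borel_matrix R k n}).
Hypothesis VS : forall w, stiefel (V w).
Hypothesis VU : uniform_on_stiefel (distribution P V).
Context {r : nat} (rn : (r <= n)%N) (n_gt0 : (0 < n)%N) (rn2 : (r.*2 <= n)%N).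
Context (w : 'cV[R]_k) (w1 : quad 1%:M w = 1).

Local Notation Ex := (Ex P V).

Let u p := Ex (fun M => rowsq rn w M ^+ p).

Lemma obs_rowsq p : obs (fun M => rowsq rn w M ^+ p).
Proof. by apply: obsX; have [] := colgrad_rowsq rn w. Qed.

Lemma rowsq_ge0 M : 0 <= rowsq rn w M.
Proof. exact: quad_gram_ge0. Qed.

Lemma rowsq_le1 M : stiefel M -> rowsq rn w M <= 1.
Proof.
move=> MM; rewrite rowsqE.
have -> : 1 = \sum_j ((M^T *m w) j 0) ^+ 2 by rewrite -quad_gram MM w1.
have E i : ((lcols rn M)^T *m w) i 0 = (M^T *m w) (widen_ord rn i) 0.
  by rewrite !mxE; apply: eq_bigr => a _; rewrite !mxE.
under eq_bigr do rewrite E.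
rewrite -subr_ge0 -(sum_right_cols rn (fun j => ((M^T *m w) j 0) ^+ 2)).
by apply: sumr_ge0 => j _; exact: sqr_ge0.
Qed.

Let u_ge0 p : 0 <= u p.
Proof.
rewrite -(Ex_cst P V 0); apply: le_Ex => //; [exact: obs_cst|exact: obs_rowsq|].
by move=> M _; exact/exprn_ge0/rowsq_ge0.
Qed.

(** The ratio of consecutive moments increases with the order; up to order
    [2 * p] it is at most the one bounded here. *)
Let u_step p m : (n <= p)%N -> (m <= p)%N ->
  u (p + m) <= ((r + 4 * p)%:R / (n + 4 * p)%:R) ^+ m * u p.
Proof.
move=> np; elim: m => [|m IH] mp; first by rewrite addn0 expr0 mul1r.
have n0 j : 0 < (n + j)%:R :> R by rewrite ltr0n addn_gt0 n_gt0.
have := rowsq_moment VS VU rn (p + m) w1; rewrite -/(u _) -addnS => E.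
have {}E : u (p + m.+1) = (r + (p + m).*2)%:R / (n + (p + m).*2)%:R * u (p + m).
  by rewrite mulrAC -[RHS]mulrC -E mulKf // gt_eqF.
rewrite E exprS -[leRHS]mulrA; apply: ler_pM; [by apply: divr_ge0|exact: u_ge0| |].
- rewrite ler_pdivrMr // mulrAC ler_pdivlMr // -!natrM ler_nat.
  have H : ((p + m).*2 <= 4 * p)%N by rewrite -muln2 mulnC; lia.
  nia.
- exact: IH (ltnW mp).
Qed.

(** Each doubling of the order gains a factor exponential in [n]. *)
Let u_double p : (n <= p)%N -> u (p + p) <= expR (- (n%:R / 10)) * u p.
Proof.
move=> np; apply: le_trans (u_step np (leqnn p)) _.
have p0 : 0 < p%:R :> R by rewrite ltr0n (leq_trans n_gt0).
have D0 : 0 < (n + 4 * p)%:R :> R by rewrite ltr0n addn_gt0 n_gt0.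
apply: ler_wpM2r => //.
(* [1 - (n - r) / (n + 4 p)] with [r <= n / 2] and [n <= p]. *)
apply: (@le_trans _ _ (expR (- (n%:R / (10 * p%:R))) ^+ p)); last first.
  have E : p%:R * (n%:R / (10 * p%:R)) = n%:R / 10 :> R by field; rewrite gt_eqF.
  by rewrite -expRM_natl ler_expR mulrN E.
rewrite lerXn2r ?nnegrE ?expR_ge0 ?divr_ge0 //.
apply: le_trans (expR_ge1Dx _); rewrite ler_pdivrMr //.
have [np' rn'] : n%:R <= p%:R :> R /\ (2 * r)%:R <= n%:R :> R.
  by rewrite !ler_nat mul2n.
rewrite !(natrM, natrD); rewrite natrM in rn'.
have -> : n%:R / (10 * p%:R) = (n%:R / p%:R) / 10 :> R by field; rewrite gt_eqF.
have [x0 x1] : (0 : R) <= n%:R / p%:R /\ n%:R / p%:R <= 1 :> R.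
  by split; [exact: divr_ge0|rewrite ler_pdivrMr ?mul1r].
have : n%:R / p%:R * p%:R = n%:R :> R by rewrite divfK // gt_eqF.
set x := n%:R / p%:R in x0 x1 * => xp.
have n0 : 0 <= n%:R :> R by [].
nra.
Qed.

Lemma rowsq_moment_decay m : u (2 ^ m * n) <= expR (- (m%:R * n%:R / 10)).
Proof.
elim: m => [|m IH].
  rewrite mul0r mul0r oppr0 expR0 mul1n -[leRHS](Ex_cst P V).
  apply: le_Ex => //; [exact: obs_rowsq|exact: obs_cst|].
  by move=> M MS; rewrite exprn_ile1 ?rowsq_ge0 // rowsq_le1.
rewrite expnS mul2n -addnn mulnDl; apply: le_trans (u_double _) _.
  by rewrite leq_pmull // expn_gt0.
apply: le_trans (ler_wpM2l (expR_ge0 _) IH) _.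
rewrite -expRD ler_expR -natr1; lra.
Qed.

(** Markov's inequality for the moment of order [2 ^ m * n]: at a threshold
    close enough to 1, it costs only the factor [expR n]. *)
Lemma rowsq_tail m (E : set T) : measurable E ->
  (forall x, E x -> expR (- (2 ^ m)%:R^-1) <= rowsq rn w (V x)) ->
  fine (P E) <= expR (n%:R * (1 - m%:R / 10)).
Proof.
move=> mE HE.
have := @prob_le_Ex _ _ _ _ _ P V VS (fun M => rowsq rn w M ^+ (2 ^ m * n))
  (expR (- n%:R)) E mE (obs_rowsq _) (expR_ge0 _).
have H1 M : stiefel M -> 0 <= rowsq rn w M ^+ (2 ^ m * n).
  by move=> _; exact/exprn_ge0/rowsq_ge0.
have H2 x : E x -> expR (- n%:R) <= rowsq rn w (V x) ^+ (2 ^ m * n).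
  move=> /HE Hx; have -> : expR (- n%:R) = expR (- (2 ^ m)%:R^-1) ^+ (2 ^ m * n) :> R.
    have m0 : (2 ^ m)%:R != 0 :> R by rewrite pnatr_eq0 -lt0n expn_gt0.
    by rewrite -expRM_natl mulrN natrM mulrAC mulfV // mul1r.
  by rewrite lerXn2r ?nnegrE ?expR_ge0 ?rowsq_ge0.
move=> /(_ H1 H2) H.
have := le_trans H (rowsq_moment_decay m).
rewrite mulrC -ler_pdivlMr ?expR_gt0 // => /le_trans; apply.
rewrite -expRN opprK -expRD ler_expR; lra.
Qed.

End Tail.

(** * A moving bump *)

Section SquarePositivePart.
Context {R : realType}.

(** Square of the positive part: a bump profile with Lipschitz derivative. *)
Definition sqp (x : R) : R := Num.max 0 x ^+ 2.
Definition dsqp (x : R) : R := 2 * Num.max 0 x.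

(** The quadratic remainder asked by [colgrad_comp]. *)
Lemma sqp_quad x y : `|sqp y - sqp x - dsqp x * (y - x)| <= 1 * (y - x) ^+ 2.
Proof.
rewrite /sqp /dsqp mul1r ler_norml.
have [sx [sy sxy]] := (sqr_ge0 x, (sqr_ge0 y, sqr_ge0 (y - x))).
case: (leP 0 x) => x0; case: (leP 0 y) => y0.
- by apply/andP; split; nra.
- have : x * y <= 0 by rewrite mulr_ge0_le0 // ltW.
  by move=> xy; apply/andP; split; nra.
- have : x * y <= 0 by rewrite mulr_le0_ge0 // ltW.
  by move=> xy; apply/andP; split; nra.
- by apply/andP; split; nra.
Qed.

Lemma dsqp_ge0 x : 0 <= dsqp x.
Proof. by rewrite mulr_ge0 // le_max lexx. Qed.

Lemma sqp_ge0 x : 0 <= sqp x.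
Proof. exact: sqr_ge0. Qed.

Lemma dsqp_le x y : x <= y -> 0 <= y -> dsqp x <= 2 * y.
Proof. by move=> xy y0; rewrite ler_wpM2l // ge_max y0. Qed.

Lemma sqp_le x y : x <= y -> 0 <= y -> sqp x <= y ^+ 2.
Proof.
by move=> xy y0; rewrite lerXn2r ?nnegrE ?le_max ?lexx // ge_max y0.
Qed.

Lemma sqp_eq0 x : x <= 0 -> sqp x = 0 /\ dsqp x = 0.
Proof. by move=> x0; rewrite /sqp /dsqp max_l // expr0n mulr0. Qed.

Lemma is_derive_sqp (x : R) : is_derive x 1 sqp (dsqp x).
Proof.
have H : h^-1 *: ((sqp \o shift x) (h *: 1) - sqp x) @[h --> (0:R)^'] --> dsqp x.
  have h0 : `|h| @[h --> (0:R)^'] --> (0 : R).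
    rewrite -[X in _ --> X](@normr0 _ R); apply: cvg_norm; exact: cvg_within.
  have lo : dsqp x - `|h| @[h --> (0:R)^'] --> dsqp x.
    by rewrite -[X in _ --> X]subr0; apply: cvgB => //; exact: cvg_cst.
  have hi : dsqp x + `|h| @[h --> (0:R)^'] --> dsqp x.
    by rewrite -[X in _ --> X]addr0; apply: cvgD => //; exact: cvg_cst.
  apply: (squeeze_cvgr _ lo hi); near=> h.
  have hn0 : h != 0 by near: h; exact: nbhs_dnbhs_neq.
  rewrite /= /GRing.scale /= mulr1 -ler_distlC distrC.
  have := sqp_quad x (h + x); rewrite addrK mul1r => Q.
  rewrite -(ler_pM2r (x := `|h|)) ?normr_gt0 // -normrM -expr2 real_normK ?num_real //.
  apply: le_trans Q; rewrite le_eqVlt; apply/orP; left; apply/eqP; congr `|_|.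
  by field.
apply: DeriveDef; first by apply/cvg_ex; exists (dsqp x).
exact/cvg_lim.
Unshelve. all: by end_near. Qed.

End SquarePositivePart.

Section Flow.
Context {R : realType} {k n : nat} {d : measure_display} {T : measurableType d}.
Context (P : probability T R) (V : {mfun T >-> @borel_matrix R k n}).
Hypothesis VS : forall w, stiefel (V w).
Hypothesis VU : uniform_on_stiefel (distribution P V).
Context {r : nat} (rn : (r <= n)%N).
Context (A : 'M[R]_(k, r)) (delta c : R) (delta_gt0 : 0 < delta).
Implicit Types (M : 'M[R]_(k, n)) (t : R).

Local Notation Ex := (Ex P V).
Local Notation X := (lcols rn).

(** [rad t] is the squared radius, at time [t], of the ball around [t *: A]
    that carries the bump. *)
Definition rad t : R := delta * expR (c * t).
Definition gap t M : R := rad t - dot (X M - t *: A) (X M - t *: A).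
Definition bump t M : R := sqp (gap t M).
Definition dbump t M : R := dsqp (gap t M) * (c * rad t + 2 * dot (X M - t *: A) A).

Lemma rad_gt0 t : 0 < rad t.
Proof. by rewrite mulr_gt0 // expR_gt0. Qed.

Lemma obs_max0 f : @obs R k n f -> obs (fun M => Num.max 0 (f M)).
Proof.
move=> [mf [C Cf]]; split.
  by apply: (@measurable_maxr _ _ _ _ (cst 0) (f : borel_matrix k n -> R)).
exists C => M MS; have := Cf M MS; case: (leP 0 (f M)) => // f0; rewrite normr0.
exact: le_trans (normr_ge0 _).
Qed.

Lemma obs_dot (F G : 'M[R]_(k, n) -> 'M[R]_(k, r)) :
  (forall a i, obs (fun M => F M a i)) -> (forall a i, obs (fun M => G M a i)) ->
  obs (fun M => dot (F M) (G M)).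
Proof.
move=> oF oG; apply: (@obs_sum _ _ _ _ _ _ (fun a M => \sum_i F M a i * G M a i)) => a _.
by apply: obs_sum => i _; exact: obsM.
Qed.

Lemma obs_disp t a i : obs (fun M => (X M - t *: A) a i).
Proof.
have -> : (fun M => (X M - t *: A) a i) = fun M => X M a i - t * A a i.
  by apply/funext => M; rewrite entryD entryN entryZ.
by apply: obsB; [exact: obs_lcols|exact: obs_cst].
Qed.

Lemma obs_gap t : obs (gap t).
Proof. by apply: obsB; [exact: obs_cst|apply: obs_dot => a i; exact: obs_disp]. Qed.

Lemma obs_bump t : obs (bump t).
Proof. by apply: obsX; apply: obs_max0; exact: obs_gap. Qed.

Lemma obs_dsqp_gap t : obs (fun M => dsqp (gap t M)).
Proof. by apply: obsZ; apply: obs_max0; exact: obs_gap. Qed.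

Lemma obs_dbump t : obs (dbump t).
Proof.
apply: obsM; first exact: obs_dsqp_gap.
apply: obsD; first exact: obs_cst.
apply: obsZ; apply: obs_dot => a i; [exact: obs_disp|exact: obs_cst].
Qed.

Lemma colgrad_bump t : colgrad rn (bump t)
  (fun b i M => dsqp (gap t M) * (- 2 * (X M - t *: A) b i)).
Proof.
have H : colgrad rn (gap t) (fun b i M => - 2 * (X M - t *: A) b i).
  have co a i := colgradX 2 (colgradD (colgrad_coord rn a i) (colgrad_cst rn (- (t * A a i)))).
  have := colgradD (colgrad_cst rn (rad t)) (colgradZ (-1)
    (colgrad_sum (fun a => colgrad_sum (fun i => co a i)))).
  have E a i M : M a (widen_ord rn i) + - (t * A a i) = (X M - t *: A) a i.
    by rewrite !mxE.
  have -> : (fun M => rad t + -1 * \sum_a \sum_i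
      (M a (widen_ord rn i) + - (t * A a i)) ^+ 2) = gap t.
    apply/funext => M; rewrite /gap mulN1r; congr (_ - _).
    by apply: eq_bigr => a _; apply: eq_bigr => i _; rewrite E expr2.
  move=> H; apply: eq_colgrad H _ => b i M.
  rewrite add0r (bigD1 b) //= (bigD1 i) //= !eqxx big1 => [|j ji]; last first.
    by rewrite eq_sym (negbTE ji) addr0 mulr0.
  rewrite big1 => [|a ab]; last first.
    by rewrite big1 // => j _; rewrite eq_sym (negbTE ab) /= addr0 mulr0.
  by rewrite expr1 E /= !addr0; ring.
apply: (colgrad_comp H (obs_bump t) (obs_dsqp_gap t) ler01).
exact: sqp_quad.
Qed.

(** Integration by parts along the field [X |-> defect X *m B]. *)
Lemma flow_identity t (B : 'M[R]_(k, r)) :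
  Ex (dbump t) + (n - r)%:R * Ex (fun M => dot (X M) B * bump t M) =
  Ex (fun M => dsqp (gap t M) *
    (c * rad t + 2 * dot (X M - t *: A) (A - defect (X M) *m B))).
Proof.
have oSB a i : obs (fun M => (defect (X M) *m B) a i).
  have -> : (fun M => (defect (X M) *m B) a i) =
      fun M => \sum_b defect (X M) a b * B b i by apply/funext => M; rewrite mxE.
  by apply: obs_sum => b _; apply: obsM; [exact: obs_defect|exact: obs_cst].
have oXB i : obs (fun M => ((X M)^T *m col i B) i 0 * bump t M).
  apply: obsM; last exact: obs_bump.
  by have [] := colgrad_row rn (col i B) i.
have E1 : (n - r)%:R * Ex (fun M => dot (X M) B * bump t M) =
    Ex (fun M => dsqp (gap t M) * (- 2 * dot (X M - t *: A) (defect (X M) *m B))).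
  have -> : (fun M => dot (X M) B * bump t M) =
      fun M => \sum_i ((X M)^T *m col i B) i 0 * bump t M.
    apply/funext => M; rewrite -mulr_suml; congr (_ * _).
    rewrite /dot exchange_big; apply: eq_bigr => i _ /=.
    by rewrite mxE; apply: eq_bigr => a _; rewrite !mxE.
  rewrite Ex_sum // mulr_sumr.
  rewrite (eq_bigr _ (fun i _ => stein_row VS VU (col i B) i (colgrad_bump t))).
  have oT i b : obs (fun M => (defect (X M) *m col i B) b 0 *
      (dsqp (gap t M) * (- 2 * (X M - t *: A) b i))).
    apply: obsM.
      have -> : (fun M => (defect (X M) *m col i B) b 0) =
          fun M => (defect (X M) *m B) b i.
        by apply/funext => M; rewrite !mxE; apply: eq_bigr => l _; rewrite !mxE.
      exact: oSB.
    by apply: obsM; [exact: obs_dsqp_gap|apply: obsZ; exact: obs_disp].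
  rewrite -Ex_sum // => [|i _]; last by apply: obs_sum => b _; exact: oT.
  congr Ex; apply/funext => M; rewrite exchange_big /dot !mulr_sumr.
  apply: eq_bigr => b _; rewrite !mulr_sumr; apply: eq_bigr => i _.
  have -> : (defect (X M) *m col i B) b 0 = (defect (X M) *m B) b i.
    by rewrite !mxE; apply: eq_bigr => l _; rewrite !mxE.
  by ring.
rewrite E1 -ExD //; [|exact: obs_dbump|]; last first.
  by apply: obsM; [exact: obs_dsqp_gap|apply: obsZ; apply: obs_dot => // a i; exact: obs_disp].
congr Ex; apply/funext => M; rewrite /dbump dotBr; ring.
Qed.

Lemma is_derive_bump M t : is_derive t 1 (fun s => bump s M) (dbump t M).
Proof.
have gE : (fun s => gap s M) = (fun s => delta * expR (c * s) -
    (dot (X M) (X M) - 2 * s * dot (X M) A + s * s * dot A A)).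
  apply/funext => s; rewrite /gap /rad !(dotBl, dotBr) [dot (_ *: A) (X M)]dotC.
  have dZ Y z : dot Y (z *: A) = z * dot Y A.
    rewrite /dot mulr_sumr; apply: eq_bigr => a _; rewrite mulr_sumr.
    by apply: eq_bigr => i _; rewrite mxE; ring.
  by rewrite !dZ [dot (_ *: A) A]dotC dZ; ring.
have gD : is_derive t 1 (fun s => gap s M) (c * rad t + 2 * dot (X M - t *: A) A).
  rewrite gE; apply: is_derive_eq.
  have -> : dot (X M - t *: A) A = dot (X M) A - t * dot A A.
    rewrite dotBl; congr (_ - _); rewrite /dot mulr_sumr; apply: eq_bigr => a _.
    by rewrite mulr_sumr; apply: eq_bigr => i _; rewrite mxE mulrA.
  rewrite /rad /GRing.scale /=; ring.
have := @is_derive1_comp _ sqp (fun s => gap s M) t _ _ (is_derive_sqp (gap t M)) gD.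
by rewrite /GRing.scale.
Qed.

Let alpha : R := Num.sqrt (dot A A).

Lemma dbump_bound : exists G, forall M, stiefel M -> forall t, -1 < t < 2 ->
  `|dbump t M| <= G.
Proof.
pose rho := delta * expR (2 * `|c|).
exists (2 * rho * (`|c| * rho + 2 * (k%:R * (r%:R * ((1 + 2 * alpha) * alpha))))).
move=> M MS t /andP[t1 t2].
have rho_gt0 : 0 < rho by rewrite mulr_gt0 // expR_gt0.
have rt : rad t <= rho.
  rewrite ler_pM2l // ler_expR; apply: le_trans (ler_norm _) _.
  by rewrite normrM mulrC ler_wpM2r // ler_norml; apply/andP; split; lra.
have gt_rho : gap t M <= rho.
  by apply: le_trans rt; rewrite lerBlDr lerDl dot_ge0.
rewrite normrM; apply: ler_pM => //.
  by rewrite ger0_norm ?dsqp_ge0 // dsqp_le // ltW.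
apply: le_trans (ler_normD _ _) _; apply: lerD; rewrite normrM.
  by rewrite ler_wpM2l // ger0_norm // ltW // rad_gt0.
rewrite ger0_norm // ler_wpM2l //; apply: norm_dot_le => a i; last exact: entry_le_sqrt.
rewrite entryD entryN entryZ; apply: le_trans (ler_normB _ _) _.
apply: lerD; first by rewrite mxE stiefel_le1.
rewrite normrM; apply: ler_pM => //; last exact: entry_le_sqrt.
by rewrite ler_norml; apply/andP; split; lra.
Qed.

(** Differentiation under the integral sign, dominated by [dbump_bound]. *)
Lemma is_derive_Ex_bump t : -1 < t < 2 ->
  is_derive t 1 (fun s => Ex (bump s)) (Ex (dbump t)).
Proof.
move=> t12; have [G HG] := dbump_bound.
pose f s (w : T) := bump s (V w).
have dE s w : partial1of2 f s w = dbump s (V w).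
  by rewrite partial1of2E; have := is_derive_bump (V w) s => -[_ ->].
have It : (`]-1, 2[%classic : set R) t by rewrite /= in_itv.
have intf s : (`]-1, 2[%classic : set R) s -> P.-integrable setT (EFin \o f s).
  by move=> _; apply: (obs_integrable P VS); exact: obs_bump.
have df s w : (`]-1, 2[%classic : set R) s -> setT w -> derivable (f ^~ w) s 1.
  by move=> _ _; have [] := is_derive_bump (V w) s.
have G0 (w : T) : 0 <= `|G| by [].
have intG : P.-integrable setT (EFin \o (fun=> `|G|) : T -> \bar R).
  exact: (obs_integrable P VS (obs_cst `|G|)).
have ub s w : (`]-1, 2[%classic : set R) s -> setT w -> `|partial1of2 f s w| <= `|G|.
  rewrite /= in_itv /= => s12 _; rewrite dE; apply: le_trans (ler_norm G).
  exact: HG.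
apply: DeriveDef.
  exact: (derivable_under_integral measurableT It intf df G0 intG ub).
rewrite -derive1E.
have := differentiation_under_integral measurableT It intf df G0 intG ub.
move=> ->; apply: eq_Rintegral => w _; exact: dE.
Qed.

End Flow.

(** * Gronwall estimates along the flow *)

Section Gronwall.
Context {R : realType} {k n : nat} {d : measure_display} {T : measurableType d}.
Context (P : probability T R) (V : {mfun T >-> @borel_matrix R k n}).
Hypothesis VS : forall w, stiefel (V w).
Hypothesis VU : uniform_on_stiefel (distribution P V).
Context {r : nat} (rn : (r <= n)%N).
Context (A : 'M[R]_(k, r)) (cA : contraction A) (delta eps be sgn : R).
Hypotheses (delta_gt0 : 0 < delta) (be_ge0 : 0 <= be) (sgn2 : sgn = 1 \/ sgn = -1).
Hypothesis drift_be : forall t, 0 <= t <= 1 -> forall a i, `|drift A t a i| <= be.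

Let L : R := 2 * (k%:R * r%:R) ^+ 2 * (1 + Num.sqrt (dot A A)) * be.

Hypothesis delta_small : k%:R * (r%:R * (Num.sqrt (delta * expR (2 * L)) * be)) <= eps.

Local Notation Ex := (Ex P V).
Local Notation X := (lcols rn).
Local Notation c := (sgn * (2 * L)).
Local Notation bump := (bump rn A delta c).
Local Notation dbump := (dbump rn A delta c).
Local Notation gap := (gap rn A delta c).
Let N : R := (n - r)%:R.

Let L_ge0 : 0 <= L.
Proof.
by rewrite !mulr_ge0 ?sqr_ge0 // addr_ge0 // sqrtr_ge0.
Qed.

Let sgnsgn : sgn * sgn = 1.
Proof. by case: sgn2 => ->; rewrite ?mulrNN mulr1. Qed.

Let abs_sgn x : sgn * x <= `|x|.
Proof.
case: sgn2 => ->; first by rewrite mul1r ler_norm.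
by rewrite mulN1r -normrN ler_norm.
Qed.

Let obs_dotX (B : 'M[R]_(k, r)) : obs (fun M : 'M[R]_(k, n) => dot (X M) B).
Proof. by apply: obs_dot => a i; [exact: obs_lcols|exact: obs_cst]. Qed.

Let oB t : obs (bump t).
Proof. exact: obs_bump. Qed.

(** Inside the bump the field [defect X *m drift A t] differs from the speed
    [A] of its centre by at most [L] times the distance to the centre, which the
    change of radius of the bump compensates. *)
Let flow_sign t M : 0 <= t <= 1 -> stiefel M ->
  0 <= sgn * (dsqp (gap t M) * (c * rad delta c t +
     2 * dot (X M - t *: A) (A - defect (X M) *m drift A t))).
Proof.
move=> t01 MS; rewrite mulrCA.
have [g0|g0] := leP (gap t M) 0; first by rewrite (sqp_eq0 g0).2 mul0r.
apply: mulr_ge0; first exact: dsqp_ge0.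
have t1 : t <= 1 by case/andP: t01.
have t0 : 0 <= t by case/andP: t01.
have Xal a i : `|X M a i| <= 1 + Num.sqrt (dot A A).
  by rewrite mxE (le_trans (stiefel_le1 _ _ MS)) // lerDl sqrtr_ge0.
have Yal a i : `|(t *: A) a i| <= 1 + Num.sqrt (dot A A).
  rewrite entryZ normrM ger0_norm //; have := entry_le_sqrt A a i.
  have := normr_ge0 (A a i); nra.
have := drift_lipschitz (addr_ge0 ler01 (sqrtr_ge0 _)) be_ge0 (contractionZ cA t01) Xal Yal
  (drift_be t01).
rewrite -/L; set D := dot _ (_ - _ *m _); set DD := dot _ _ => LD.
have gE : DD < rad delta c t by move: g0; rewrite /gap subr_gt0.
have := abs_sgn (- D); rewrite normrN => sD.
have -> : sgn * (c * rad delta c t + 2 * D) =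
  (sgn * sgn) * (2 * L * rad delta c t) + 2 * (sgn * D) by ring.
rewrite sgnsgn mul1r; move: sD; rewrite mulrN => sD.
have : L * DD <= L * rad delta c t by rewrite ler_wpM2l // ltW.
lra.
Qed.

Let pairing_le t M : 0 <= t <= 1 ->
  sgn * (dot (X M) (drift A t) * bump t M) <=
  (sgn * dot (t *: A) (drift A t) + eps) * bump t M.
Proof.
move=> t01; rewrite mulrA.
have [g0|g0] := leP (gap t M) 0; first by rewrite /bump (sqp_eq0 g0).1 !mulr0.
apply: ler_wpM2r; first exact: sqp_ge0.
have -> : dot (X M) (drift A t) = dot (t *: A) (drift A t) + dot (X M - t *: A) (drift A t).
  by rewrite dotBl addrC subrK.
rewrite mulrDr lerD2l; apply: le_trans (abs_sgn _) _.
apply: le_trans delta_small.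
apply: le_trans (norm_dot_le (entry_le_sqrt _) (drift_be t01)) _.
rewrite ler_wpM2l // ler_wpM2l // ler_wpM2r // ler_wsqrtr //.
move: g0; rewrite subr_gt0 => /ltW /le_trans; apply.
rewrite ler_pM2l // ler_expR; case/andP: t01 => t0 t1.
have Lt := mulr_ge0 L_ge0 t0.
have Lt1 : L * t <= L by rewrite ler_piMr.
by case: sgn2 => ->; lra.
Qed.

(** [flow_sign] discards the error term of [flow_identity]. *)
Let differential_inequality t : 0 <= t <= 1 ->
  0 <= sgn * (Ex (dbump t) + N * (dot (t *: A) (drift A t) + sgn * eps) * Ex (bump t)).
Proof.
move=> t01; have od := obs_dbump rn A delta c t.
have F := flow_identity VS VU rn A delta c t (drift A t).
have oprod : obs (fun M => dot (X M) (drift A t) * bump t M) by exact: obsM.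
have oI : obs (fun M => dsqp (gap t M) * (c * rad delta c t +
    2 * dot (X M - t *: A) (A - defect (X M) *m drift A t))).
  apply: obsM; first exact: obs_dsqp_gap.
  apply: obsD; first exact: obs_cst.
  apply: obsZ; apply: obs_dot => a i; first exact: obs_disp.
  have -> : (fun M => (A - defect (X M) *m drift A t) a i) = fun M =>
      A a i - \sum_b defect (X M) a b * drift A t b i.
    by apply/funext => M; rewrite entryD entryN mxE.
  apply: obsB; first exact: obs_cst.
  by apply: obs_sum => b _; apply: obsM; [exact: obs_defect|exact: obs_cst].
have H1 : 0 <= sgn * (Ex (dbump t) + N * Ex (fun M => dot (X M) (drift A t) * bump t M)).
  rewrite /N F -ExZ // -[leLHS](Ex_cst P V).
  by apply: le_Ex => //; [exact: obs_cst|exact: obsZ|move=> M MS; exact: flow_sign].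
have H2 : sgn * Ex (fun M => dot (X M) (drift A t) * bump t M) <=
    (sgn * dot (t *: A) (drift A t) + eps) * Ex (bump t).
  rewrite -!ExZ //; apply: le_Ex => //; [exact: obsZ|exact: obsZ|].
  by move=> M _; exact: pairing_le.
have N0 : 0 <= N by [].
have := ler_wpM2l N0 H2.
have E : sgn * (N * (dot (t *: A) (drift A t) + sgn * eps) * Ex (bump t)) =
    N * ((sgn * dot (t *: A) (drift A t) + (sgn * sgn) * eps) * Ex (bump t)) by ring.
rewrite sgnsgn mul1r in E; rewrite mulrDr E; move: H1; rewrite mulrDr; lra.
Qed.

(** The mean of the bump times [expR] of the primitive of
    [N * (dot (t *: A) (drift A t) + sgn * eps)] is monotone in [t]. The case
    [sgn = 1], of a growing ball, bounds the mass near [A] from below, the case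
    [sgn = -1] from above. *)
Lemma flow_gronwall :
  sgn * Ex (bump 0) <= sgn * (Ex (bump 1) * expR (N * (rate A + sgn * eps))).
Proof.
pose H t := N * (rate (t *: A) + sgn * eps * t).
pose W t := sgn * (Ex (bump t) * expR (H t)).
have dW (t : R) : 0 < t < 1 -> is_derive t 1 W (sgn * ((Ex (dbump t) +
    N * (dot (t *: A) (drift A t) + sgn * eps) * Ex (bump t)) * expR (H t))).
  move=> t01; have dr := is_derive_rate_path cA t01.
  have t12 : -1 < t < 2 by case/andP: t01 => t0 t1; apply/andP; split; lra.
  have db := is_derive_Ex_bump P VS rn A c delta_gt0 t12.
  have dH : is_derive t 1 H (N * (dot (t *: A) (drift A t) + sgn * eps)).
    rewrite /H; apply: is_derive_eq; rewrite /GRing.scale /=; ring.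
  rewrite /W; apply: is_derive_eq; rewrite /GRing.scale /=; ring.
have cW (t : R) : 0 <= t <= 1 -> W s @[s --> t] --> W t.
  move=> /andP[t0 t1]; apply: cvgMl_tmp; apply: cvgM.
    have t12 : -1 < t < 2 by apply/andP; split; lra.
    have [db _] := is_derive_Ex_bump P VS rn A c delta_gt0 t12.
    by have /derivable1_diffP/differentiable_continuous := db.
  apply: continuous_cvg; first exact: continuous_expR.
  apply: cvgMl_tmp; apply: cvgD; first by apply: cvg_rate_path => //; rewrite ger0_norm.
  apply: cvgMl_tmp; exact: cvg_id.
have W01 : W 0 <= W 1.
  apply: (@ger0_derive1_ndecr _ W 0 1) => //.
  - by move=> t; rewrite in_itv /= => /dW[].
  - move=> t; rewrite in_itv /= => t01; have [_ dv] := dW t t01; rewrite derive1E dv.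
    rewrite mulrA mulr_ge0 ?expR_ge0 //; apply: differential_inequality.
    by case/andP: t01 => t0 t1; rewrite !ltW.
  - apply/subspace_continuousP => t; rewrite /= in_itv /= => t01.
    by apply: cvg_within_filter; exact: cW.
move: W01; rewrite /W /H scale0r scale1r !mulr1 mulr0 addr0.
have -> : rate (0 : 'M[R]_(k, r)) = 0.
  by rewrite /rate /defect mul0mx subr0 det1 ln1 mulr0.
by rewrite mulr0 expR0 mulr1.
Qed.

End Gronwall.

(** * Probabilities of small balls *)

Section BallEstimates.
Context {R : realType} {k r : nat}.
Implicit Types (A : 'M[R]_(k, r)).

Lemma not_contraction A : ~ contraction A ->
  exists w, quad 1%:M w = 1 /\ quad (defect A) w <= 0.
Proof.
move=> nA; have [x [x0 xA]] : exists x, x != 0 /\ quad (defect A) x <= 0.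
  apply: contrapT => H; apply: nA; split=> [|x x0]; first exact: defect_sym.
  by rewrite ltNge; apply/negP => xA; apply: H; exists x.
have s0 : 0 < quad 1%:M x by rewrite quad1; exact: sumsq_gt0.
have quadZv (M : 'M[R]_k) c : quad M (c *: x) = c ^+ 2 * quad M x.
  by rewrite /quad [(c *: x)^T]linearZ /= -!scalemxAl -scalemxAr scalerA entryZ expr2.
exists ((Num.sqrt (quad 1%:M x))^-1 *: x); rewrite !quadZv exprVn (sqr_sqrtr (ltW s0)).
by rewrite mulVf ?gt_eqF //; split=> //; rewrite pmulr_rle0 // invr_gt0.
Qed.

(** A radius for the moving bump which is at most [s] and small enough for the
    error terms of the Gronwall estimate. *)
Let small_delta (K L eps s : R) : 0 <= K -> 0 < eps -> 0 < s ->
  exists2 delta, 0 < delta &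
    delta * expR (2 * L) <= s /\ K * Num.sqrt (delta * expR (2 * L)) <= eps.
Proof.
move=> K0 e0 s0; have K1 : 0 < K + 1 by rewrite ltr_wpDl.
have q0 : 0 < eps / (K + 1) by rewrite divr_gt0.
exists (Num.min s ((eps / (K + 1)) ^+ 2) * expR (- (2 * L))).
  by rewrite mulr_gt0 ?expR_gt0 // lt_min s0 exprn_gt0.
rewrite -mulrA -expRD addNr expR0 mulr1; split; first by rewrite ge_min lexx.
have : Num.sqrt (Num.min s ((eps / (K + 1)) ^+ 2)) <= eps / (K + 1).
  apply: (@le_trans _ _ (Num.sqrt ((eps / (K + 1)) ^+ 2))).
    by rewrite ler_wsqrtr // ge_min lexx orbT.
  by rewrite sqrtr_sqr gtr0_norm.
move=> /(ler_wpM2l K0) /le_trans; apply.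
by rewrite mulrCA ler_piMr ?(ltW e0) // ler_pdivrMr // mul1r lerDl.
Qed.

(** At time [0] the bump has mass at least [delta ^+ 2 / 2]: it dominates
    [delta ^+ 2 - 2 * delta * |X|^2], and [X] has mean square [k * r / n]. *)
Lemma ball_lower A eps s : contraction A -> 0 < eps -> 0 < s ->
  exists2 c0, 0 < c0 & exists n0, forall n (rn : (r <= n)%N) d (T : measurableType d)
    (P : probability T R) (V : {mfun T >-> @borel_matrix R k n})
    (VS : forall w, stiefel (V w)) (VU : uniform_on_stiefel (distribution P V)),
    (n0 <= n)%N -> forall E : set T, measurable E ->
    (forall w, dot (lcols rn (V w) - A) (lcols rn (V w) - A) < s -> E w) ->
    c0 * expR (- (n%:R * (rate A + eps))) <= fine (P E).
Proof.
move=> cA e0 s0; have [be [be0 Hbe]] := drift_bound cA.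
pose L : R := 2 * (k%:R * r%:R) ^+ 2 * (1 + Num.sqrt (dot A A)) * be.
have [|delta d0 [ds deps]] := small_delta (K := k%:R * (r%:R * be)) L _ e0 s0.
  by rewrite !mulr_ge0.
exists (delta ^+ 2 / 2 / s ^+ 2); first by rewrite !divr_gt0 ?exprn_gt0.
exists (Num.bound (4 * k%:R * r%:R / delta)).+1 => n rn d T P V VS VU n0 E mE HE.
have n1 : 4 * k%:R * r%:R <= delta * n%:R.
  rewrite [leRHS]mulrC -ler_pdivrMr //; apply: ltW; apply: lt_le_trans (archi_boundP _) _.
    by apply: divr_ge0; [rewrite !mulr_ge0|exact: ltW].
  by rewrite ler_nat ltnW.
have n_gt0 : 0 < n%:R :> R by rewrite ltr0n (leq_trans _ n0).
have deps' : k%:R * (r%:R * (Num.sqrt (delta * expR (2 * L)) * be)) <= eps.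
  by apply: le_trans deps; rewrite le_eqVlt; apply/orP; left; apply/eqP; ring.
have := flow_gronwall VS VU rn cA d0 be0 (or_introl erefl) Hbe deps'.
rewrite -/L !mul1r; set u0 := Ex _ _ _; set u1 := Ex _ _ _ => G.
have b0E M : bump rn A delta (2 * L) 0 M = sqp (delta - dot (lcols rn M) (lcols rn M)).
  by rewrite /bump /gap /rad mulr0 expR0 mulr1 scale0r subr0.
pose e_ a : 'cV[R]_k := delta_mx a 0.
have eE (M : 'M[R]_(k, n)) a : rowsq rn (e_ a) M = \sum_i lcols rn M a i ^+ 2.
  rewrite rowsqE; apply: eq_bigr => i _; congr (_ ^+ 2).
  rewrite mxE (bigD1 a) //= big1 ?addr0 => [|b ba]; first by rewrite !mxE !eqxx mulr1.
  by rewrite !mxE (negbTE ba) mulr0.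
have e1 a : quad 1%:M (e_ a) = 1.
  rewrite quad1 (bigD1 a) //= big1 ?addr0 => [|b ba]; first by rewrite mxE !eqxx expr1n.
  by rewrite mxE (negbTE ba) expr0n.
have orow a : obs (rowsq rn (e_ a)) by have [] := colgrad_rowsq rn (e_ a).
have mom a : n%:R * Ex P V (rowsq rn (e_ a)) = r%:R.
  have := rowsq_moment VS VU rn 0 (e1 a); rewrite !addn0 (_ : (fun M => _ ^+ 0) = fun=> 1).
    rewrite Ex_cst mulr1 => <-; congr (_ * Ex _ _ _).
  by apply/funext => M; rewrite expr0.
have dotE' (M : 'M[R]_(k, n)) : dot (lcols rn M) (lcols rn M) = \sum_a rowsq rn (e_ a) M.
  by apply: eq_bigr => a _; rewrite eE; apply: eq_bigr => i _; rewrite expr2.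
have odot : obs (fun M : 'M[R]_(k, n) => dot (lcols rn M) (lcols rn M)).
  by apply: obs_dot => a i; exact: obs_lcols.
have Edot : n%:R * Ex P V (fun M => dot (lcols rn M) (lcols rn M)) = k%:R * r%:R.
  have -> : (fun M : 'M[R]_(k, n) => dot (lcols rn M) (lcols rn M)) =
    fun M => \sum_a rowsq rn (e_ a) M by apply/funext.
  rewrite Ex_sum // mulr_sumr (eq_bigr _ (fun a _ => mom a)).
  by rewrite sumr_const card_ord mulr_natl.
have u0E : delta ^+ 2 / 2 <= u0.
  apply: (@le_trans _ _ (Ex P V (fun M => delta ^+ 2 - 2 * delta * dot (lcols rn M) (lcols rn M)))).
    rewrite ExB //; [|exact: obs_cst|exact: obsZ].
    rewrite Ex_cst ExZ //; move: Edot; set z := Ex _ _ _ => zE.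
    have : z * 4 <= delta.
      rewrite -(ler_pM2l n_gt0) (_ : n%:R * (z * 4) = 4 * (n%:R * z)); last by ring.
      rewrite zE; lra.
    move=> /(ler_wpM2l (ltW d0)); rewrite !expr2; lra.
  apply: le_Ex => //; [|exact: obs_bump|].
    by apply: obsB; [exact: obs_cst|exact: obsZ].
  move=> M _; rewrite b0E /sqp; set z := dot _ _.
  by case: (leP 0 (delta - z)) => dz; nra.
have u1E : u1 <= s ^+ 2 * fine (P E).
  apply: Ex_le_prob => //; [exact: obs_bump|exact: sqr_ge0| |].
    move=> w; apply: sqp_le; last exact: ltW.
    apply: (@le_trans _ _ (rad delta (2 * L) 1)); first by rewrite gerBl dot_ge0.
    by rewrite /rad mulr1.
  move=> w nEw; rewrite /bump (sqp_eq0 _).1 // /gap subr_le0.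
  rewrite leNgt; apply/negP => H; apply: nEw; apply: HE.
  by move: H; rewrite scale1r => /lt_le_trans; apply; rewrite /rad mulr1.
have R0 := rate_ge0 cA.
have eN : expR ((n - r)%:R * (rate A + eps)) <= expR (n%:R * (rate A + eps)).
  by rewrite ler_expR ler_wpM2r ?ler_nat ?leq_subr // addr_ge0 // ltW.
rewrite expRN -mulrA -mulrA.
have H : delta ^+ 2 / 2 <= s ^+ 2 * fine (P E) * expR (n%:R * (rate A + eps)).
  apply: le_trans u0E _; apply: le_trans G _; apply: ler_pM; [|exact: expR_ge0|exact: u1E|exact: eN].
    rewrite -(Ex_cst P V 0); apply: le_Ex => //; [exact: obs_cst|exact: obs_bump|].
    by move=> M _; exact: sqp_ge0.
rewrite mulrA -invfM ler_pdivrMr ?mulr_gt0 ?exprn_gt0 ?expR_gt0 //.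
by apply: le_trans H _; rewrite le_eqVlt; apply/orP; left; apply/eqP; ring.
Qed.

(** At time [1] the bump is at least [(rho / 2) ^+ 2] on the ball of squared
    radius [rho / 2], and at time [0] it is at most [delta ^+ 2]. *)
Lemma ball_upper A eps : contraction A -> 0 < eps ->
  exists2 s, 0 < s & exists2 C, 0 < C & forall n (rn : (r <= n)%N) d (T : measurableType d)
    (P : probability T R) (V : {mfun T >-> @borel_matrix R k n})
    (VS : forall w, stiefel (V w)) (VU : uniform_on_stiefel (distribution P V)),
    forall E : set T, measurable E ->
    (forall w, E w -> dot (lcols rn (V w) - A) (lcols rn (V w) - A) < s) ->
    fine (P E) <= C * expR (- (n%:R * (rate A - eps))).
Proof.
move=> cA e0; have [be [be0 Hbe]] := drift_bound cA.
pose L : R := 2 * (k%:R * r%:R) ^+ 2 * (1 + Num.sqrt (dot A A)) * be.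
have [|delta d0 [_ deps]] := small_delta (K := k%:R * (r%:R * be)) L _ e0 ltr01.
  by rewrite !mulr_ge0.
pose rho := delta * expR (- (2 * L)).
have rho0 : 0 < rho by rewrite mulr_gt0 // expR_gt0.
exists (rho / 2); first by rewrite divr_gt0.
exists (delta ^+ 2 / (rho / 2) ^+ 2 * expR (r%:R * rate A)).
  by rewrite mulr_gt0 ?expR_gt0 // divr_gt0 ?exprn_gt0 // divr_gt0.
move=> n rn d T P V VS VU E mE HE.
have deps' : k%:R * (r%:R * (Num.sqrt (delta * expR (2 * L)) * be)) <= eps.
  by apply: le_trans deps; rewrite le_eqVlt; apply/orP; left; apply/eqP; ring.
have := flow_gronwall VS VU rn cA d0 be0 (or_intror erefl) Hbe deps'.
rewrite -/L !mulN1r lerN2; set u0 := Ex _ _ _; set u1 := Ex _ _ _ => G.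
have u0E : u1 <= delta ^+ 2.
  rewrite -[leRHS](Ex_cst P V); apply: le_Ex => //; [exact: obs_bump|exact: obs_cst|].
  move=> M _; apply: sqp_le; last exact: ltW.
  by rewrite /gap /rad mulr0 expR0 mulr1 gerBl dot_ge0.
have u1E : (rho / 2) ^+ 2 * fine (P E) <= u0.
  apply: prob_le_Ex => //; [exact: obs_bump|exact: sqr_ge0| |].
    by move=> M _; exact: sqp_ge0.
  move=> w /HE H; rewrite /bump /sqp; apply: lerXn2r.
  - by rewrite nnegrE divr_ge0 // ltW.
  - by rewrite nnegrE le_max lexx.
  rewrite /gap scale1r /rad mulr1 -/rho le_max; apply/orP; right; lra.
have Nn : (n - r)%:R = n%:R - r%:R :> R by rewrite natrB.
have q0 : 0 < (rho / 2) ^+ 2 by rewrite exprn_gt0 // divr_gt0.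
have eN : (rho / 2) ^+ 2 * fine (P E) * expR (n%:R * (rate A - eps)) <=
    delta ^+ 2 * expR (r%:R * rate A).
  apply: (@le_trans _ _ (u0 * (expR ((n - r)%:R * (rate A - eps)) * expR (r%:R * rate A)))).
    rewrite -expRD; apply: ler_pM => //; first by apply: mulr_ge0; [exact: ltW|exact: fine_ge0].
    rewrite ler_expR Nn mulrBl; have : 0 <= r%:R * eps by rewrite mulr_ge0 // ltW.
    lra.
  rewrite mulrA ler_wpM2r ?expR_ge0 //; exact: le_trans G u0E.
rewrite expRN ler_pdivlMr ?expR_gt0 // mulrAC ler_pdivlMr // mulrC mulrA.
exact: eN.
Qed.

(** Near a boundary matrix some unit row of [X] keeps almost its full length. *)
Lemma boundary_upper A (L : R) : ~ contraction A ->
  exists2 s, 0 < s & forall n (rn : (r <= n)%N) d (T : measurableType d)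
    (P : probability T R) (V : {mfun T >-> @borel_matrix R k n})
    (VS : forall w, stiefel (V w)) (VU : uniform_on_stiefel (distribution P V)),
    (r.*2 < n)%N -> forall E : set T, measurable E ->
    (forall w, E w -> dot (lcols rn (V w) - A) (lcols rn (V w) - A) < s) ->
    fine (P E) <= expR (- (n%:R * L)).
Proof.
move=> /not_contraction[w [w1 wA]].
pose m := Num.bound (10 * (`|L| + 1)).
have mL : 10 * (L + 1) <= m%:R.
  apply: ltW; apply: le_lt_trans (archi_boundP _); last first.
    by rewrite mulr_ge0 // addr_ge0.
  by rewrite ler_wpM2l // lerD2r ler_norm.
pose kap : R := expR (- (2 ^ m)%:R^-1).
have kap1 : kap < 1 by rewrite -[ltRHS]expR0 ltr_expR oppr_lt0 invr_gt0 ltr0n expn_gt0.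
have kap0 : 0 < kap by exact: expR_gt0.
pose eta := (1 - kap) / 2.
have eta0 : 0 < eta by rewrite divr_gt0 // subr_gt0.
exists (eta ^+ 2); first by rewrite exprn_gt0.
move=> n rn d T P V VS VU n0 E mE HE.
apply: (@le_trans _ _ (expR (n%:R * (1 - m%:R / 10)))); last first.
  have n00 : 0 <= n%:R :> R by [].
  rewrite ler_expR -[leRHS]mulrN ler_wpM2l //; lra.
have n1 : (0 < n)%N by exact: leq_ltn_trans n0.
apply: (rowsq_tail VS VU (rn := rn) n1 (ltnW n0) w1) => // x /HE; rewrite -/kap; set X := lcols rn (V x); set D := X - A => Ds.
rewrite rowsqE -/X.
have XE l : (X^T *m w) l 0 = (A^T *m w) l 0 + (D^T *m w) l 0.
  by rewrite -entryD -mulmxDl /D linearB /= addrC subrK.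
have A1 : 1 <= \sum_l (A^T *m w) l 0 ^+ 2.
  by move: wA; rewrite quad_defect w1 quad_gram subr_le0.
have D1 : \sum_l (D^T *m w) l 0 ^+ 2 <= eta ^+ 2.
  apply: le_trans (ltW Ds); rewrite /dot exchange_big /=.
  apply: ler_sum => l _; rewrite mxE.
  apply: le_trans (cauchy_schwarz_sum _ _) _.
  rewrite -quad1 w1 mulr1; apply: ler_sum => a _.
  by rewrite mxE expr2.
(* [(a + e)^2 >= (1 - eta) a^2 - e^2 / eta] for each coordinate. *)
have K : (1 - eta) * \sum_l (A^T *m w) l 0 ^+ 2 - eta^-1 * \sum_l (D^T *m w) l 0 ^+ 2
    <= \sum_l (X^T *m w) l 0 ^+ 2.
  rewrite !mulr_sumr -sumrB; apply: ler_sum => l _; rewrite XE.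
  set a := (A^T *m w) l 0; set e := (D^T *m w) l 0.
  have : 0 <= eta^-1 * (eta * a + e) ^+ 2 by rewrite mulr_ge0 ?invr_ge0 ?sqr_ge0 // ltW.
  have -> : eta^-1 * (eta * a + e) ^+ 2 = eta * a ^+ 2 + 2 * a * e + eta^-1 * e ^+ 2.
    by field; rewrite gt_eqF.
  have := sqr_ge0 e; rewrite sqrrD; lra.
apply: le_trans K.
have eta1 : eta <= 1 by rewrite /eta; lra.
have H1 : 1 - eta <= (1 - eta) * \sum_l (A^T *m w) l 0 ^+ 2.
  by rewrite ler_peMr // subr_ge0.
have H2 : eta^-1 * \sum_l (D^T *m w) l 0 ^+ 2 <= eta.
  by rewrite mulrC ler_pdivrMr // -expr2.
rewrite /eta in H1 H2 *; lra.
Qed.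

End BallEstimates.

(** * The box and the rate function on it *)

Section Box.
Context {R : realType} {k : nat}.
Implicit Types (A B : box R k).

Local Notation blk A r := (block (entries A) r).
Local Notation dist2 A B r := (dot (blk A r - blk B r) (blk A r - blk B r)).

Lemma entries_continuous i j : continuous (fun A : box R k => entries A i j).
Proof.
move=> A; apply: (@continuous_comp _ _ _ (fun A : box R k => A (i, j)) (fun x => \val x)).
  exact: (@proj_continuous _ (fun _ : 'I_k * nat => set_type (`[-1, 1]%classic : set R)) (i, j)).
exact: initial_continuous.
Qed.

Lemma mxcvg_block A r : mxcvg (nbhs A) (fun B => blk B r) (blk A r).
Proof.
move=> i j; rewrite mxE; under eq_cvg do rewrite mxE.
exact: entries_continuous.
Qed.

Lemma mxcvg_defect_box A r : mxcvg (nbhs A) (fun B => defect (blk B r)) (defect (blk A r)).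
Proof.
apply: mxcvgB; first exact: mxcvg_cst.
by apply: mxcvgM; [exact: mxcvg_block|apply: mxcvg_tr; exact: mxcvg_block].
Qed.

Lemma dist2_le A B r m : (r <= m)%N -> dist2 A B r <= dist2 A B m.
Proof.
move=> rm; apply: ler_sum => i _.
pose f j := (entries A i j - entries B i j) ^+ 2.
have E p : \sum_l (blk A p - blk B p) i l * (blk A p - blk B p) i l = \sum_(0 <= j < p) f j.
  by rewrite big_mkord; apply: eq_bigr => j _; rewrite !mxE /f expr2.
rewrite !E [leRHS](big_cat_nat (n := r)) //= lerDl.
by apply: sumr_ge0 => j _; exact: sqr_ge0.
Qed.

Lemma nbhs_box_dist2 A r s : 0 < s -> \forall B \near A, dist2 B A r < s.
Proof.
move=> s0; have FF : Filter (nbhs A) by exact: nbhs_filter.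
suff : dist2 B A r @[B --> A] --> (0 : R) by move=> /cvgr_lt; apply.
have -> : (0 : R) = dist2 A A r.
  by rewrite subrr /dot big1 // => i _; rewrite big1 // => j _; rewrite !mxE mul0r.
have D : mxcvg (nbhs A) (fun B => blk B r - blk A r) (blk A r - blk A r).
  by apply: mxcvgB; [exact: mxcvg_block|exact: mxcvg_cst].
apply: cvg_fsum => i _; apply: cvg_fsum => j _.
by apply: cvgM; exact: D.
Qed.

(** The filter of the balls of finite blocks converges to [A] coordinate by
    coordinate, hence in the product topology. *)
Lemma nbhs_box_sub A (U : set (box R k)) : nbhs A U -> exists r0 s, 0 < s /\
  forall r B, (r0 <= r)%N -> dist2 B A r < s -> U B.
Proof.
move=> AU.
pose S (p : nat * R) := [set B | dist2 B A p.1 < p.2].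
pose F := filter_from [set p : nat * R | 0 < p.2] S.
have FF : Filter F.
  apply: filter_from_filter; first by exists (0%N, 1) => /=.
  move=> [r s] [r' s'] /= s0 s0'; exists (maxn r r', Num.min s s') => /=.
    by rewrite lt_min s0.
  move=> B; rewrite /S /= lt_min => /andP[H1 H2]; split.
    by apply: le_lt_trans H1; apply: dist2_le; rewrite leq_maxl.
  by apply: le_lt_trans H2; apply: dist2_le; rewrite leq_maxr.
have FA : F --> A.
  apply/cvg_sup; case=> [i j] N [W [[Z oZ <-] ZA WN]].
  case: oZ ZA WN => Q oQ <- QA WN.
  have /nbhs_ballP[e e0 He] : nbhs (entries A i j) Q by exact: open_nbhs_nbhs.
  exists (j.+1, e ^+ 2) => /=; first by rewrite exprn_gt0.
  move=> B HB; apply: WN; apply: He; rewrite /ball /=.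
  have := entry_le_dot (blk B j.+1 - blk A j.+1) i ord_max; rewrite !mxE /= => H.
  have {}H := le_lt_trans H HB; rewrite -(@ltr_pXn2r _ 2) ?nnegrE //; last exact: ltW.
  by rewrite real_normK ?num_real // -sqrrN opprB.
have [[r0 s] s0 HS] := FA _ AU.
exists r0, s; split=> // r B rr BA; apply: HS; rewrite /S /=.
by apply: le_lt_trans BA; exact: dist2_le.
Qed.

Local Notation I := (`[-1, 1]%classic : set R).

Definition clamp (x : R) : R := Num.max (-1) (Num.min 1 x).

Lemma clamp_itv x : clamp x \in I.
Proof.
by apply/mem_set; rewrite /= in_itv /= le_max lexx ge_max ge_min lexx /= andbT; lra.
Qed.

Lemma clamp_id x : x \in I -> clamp x = x.
Proof.
move/set_mem; rewrite /= in_itv /= => /andP[x1 x2].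
by rewrite /clamp (min_idPr x2) (max_idPr x1).
Qed.

Lemma continuous_clamp : continuous clamp.
Proof.
move=> x; apply/cvgrPdist_lt => e e0; near=> y.
apply: (@le_lt_trans _ _ `|x - y|); last first.
  by near: y; apply/(cvgrPdist_lt _ _).1 => //; exact: cvg_id.
rewrite ler_norml; have := ler_norm (x - y); have := ler_norm (- (x - y)).
rewrite normrN /clamp => h1 h2.
case: (leP 1 x) => x1; case: (leP 1 y) => y1;
  repeat (case: (leP (-1) _) => ?); apply/andP; split; lra.
Unshelve. all: by end_near. Qed.

(** A continuous retraction of all arrays onto the box. *)
Definition clamp_box (f : 'I_k * nat -> R) : box R k :=
  fun ij => exist (fun x => x \in I) _ (clamp_itv (f ij)).

Lemma continuous_clamp_box (T : topologicalType) (f : T -> 'I_k * nat -> R) :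
  (forall ij, continuous (f ^~ ij)) -> continuous (fun x => clamp_box (f x)).
Proof.
move=> cf x; apply/cvg_sup; case=> [i j] N [W [[Z oZ <-] ZA WN]].
case: oZ ZA WN => Q oQ <- QA WN.
have : clamp (f y (i, j)) @[y --> x] --> clamp (f x (i, j)).
  by apply: continuous_cvg; [exact: continuous_clamp|exact: cf].
move=> /(_ Q (open_nbhs_nbhs (conj oQ QA))) H.
suff : nbhs x [set y | N (clamp_box (f y))] by [].
have {}H : nbhs x [set y | Q (clamp (f y (i, j)))] by [].
by apply: filterS H => y Qy; exact: WN.
Qed.

Lemma compact_box : compact [set: box R k].
Proof.
have cI : compact [set: set_type I].
  have -> : [set: set_type I] = (fun x => exist (fun y => y \in I) _ (clamp_itv x)) @` I.
    apply/seteqP; split => // -[x xI] _; exists x; first exact: set_mem.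
    by apply: val_inj; exact: clamp_id.
  apply: continuous_compact; last exact: segment_compact.
  apply: continuous_subspaceT; apply/continuousP => W [Z oZ <-].
  by have /continuousP/(_ Z oZ) := continuous_clamp.
have := @tychonoff _ (fun _ : 'I_k * nat => set_type I) (fun=> setT) (fun=> cI).
by congr compact; apply/seteqP; split.
Qed.

Lemma stiefel_rateE A : stiefel_rate A =
  if `[< subunital (entries A) >]
  then (- 2^-1 * ln (\det (1%:M - gram (entries A))))%:E else +oo%E.
Proof. by []. Qed.

Lemma stiefel_rate_gt A (L : R) : (L%:E < stiefel_rate A)%E ->
  exists r, contraction (blk A r) -> L < rate (blk A r).
Proof.
rewrite stiefel_rateE => H; apply: rate_block_gt => su.
by move: H; rewrite (asboolT su) lte_fin.
Qed.

Lemma stiefel_rate_fin A : stiefel_rate A != +oo%E -> subunital (entries A).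
Proof. by rewrite stiefel_rateE; case: asboolP. Qed.

Lemma rate_block_le_stiefel A r : subunital (entries A) ->
  ((rate (blk A r))%:E <= stiefel_rate A)%E.
Proof.
move=> su; rewrite stiefel_rateE (asboolT su) lee_fin -(cvg_lim _ (cvg_rate_block su)) //.
apply: limr_ge; first by apply/cvg_ex; eexists; exact: cvg_rate_block.
exists r => // m /= rm; apply: rate_block_le => //; exact: subunital_contraction.
Qed.

Lemma stiefel_rate_ge0 A : (0 <= stiefel_rate A)%E.
Proof.
have [su|nsu] := pselect (subunital (entries A)); last first.
  by rewrite stiefel_rateE (asboolF nsu) leey.
apply: le_trans (rate_block_le_stiefel 0 su); rewrite lee_fin.
exact: rate_ge0 (subunital_contraction 0 su).
Qed.

Lemma stiefel_rate_le A (K : R) : (forall r, contraction (blk A r) /\ rate (blk A r) <= K) ->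
  (stiefel_rate A <= K%:E)%E.
Proof.
move=> H; rewrite leNgt; apply/negP => /stiefel_rate_gt[r Hr].
by have [cr] := H r; rewrite leNgt (Hr cr).
Qed.

(** A block that witnesses [L < stiefel_rate A] witnesses it near [A]: by
    continuity of the determinant, or by [det_defect_small] when the block of
    [A] is not a contraction. *)
Lemma stiefel_rate_lsc : lower_semicontinuous (@stiefel_rate R k).
Proof.
move=> A L /stiefel_rate_gt[r Hr]; have FF : Filter (nbhs A) by exact: nbhs_filter.
suff [U AU HU] : exists2 U, nbhs A U & forall B, U B -> contraction (blk B r) -> L < rate (blk B r).
  exists U => // B /HU HB; have [su|nsu] := pselect (subunital (entries B)); last first.
    by rewrite stiefel_rateE (asboolF nsu) ltry.
  apply: lt_le_trans (rate_block_le_stiefel r su); rewrite lte_fin.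
  exact/HB/subunital_contraction.
have [cA|nA] := pselect (contraction (blk A r)).
  exists [set B | L < rate (blk B r)] => //.
  have : rate (blk B r) @[B --> A] --> rate (blk A r).
    apply: cvgMl_tmp; apply: continuous_cvg; last by apply: cvg_det; exact: mxcvg_defect_box.
    by apply: continuous_ln; exact: posdef_det_gt0.
  by move=> /cvgr_gt; apply; exact: Hr.
have [w [w1 wA]] := not_posdef (defect_sym _) nA.
pose eta := expR (- (2 * `|L| + 2)) : R.
have eta0 : 0 < eta by exact: expR_gt0.
have eta1 : eta <= 1 by rewrite -[leRHS]expR0 ler_expR oppr_le0 addr_ge0 // mulr_ge0.
exists [set B | quad (defect (blk B r)) w < eta].
  have : quad (defect (blk B r)) w @[B --> A] --> quad (defect (blk A r)) w.
    by apply: cvg_quad; exact: mxcvg_defect_box.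
  by move=> /cvgr_lt; apply; exact: le_lt_trans eta0.
move=> B /= /ltW qB cB; have := det_defect_small cB w1 _ qB.
rewrite eta0 eta1 => /(_ isT); rewrite /eta expRK /rate mulNr => D.
have := ler_norm L; lra.
Qed.

Lemma stiefel_rate_good : good_rate_function (@stiefel_rate R k).
Proof.
split; first by split; [exact: stiefel_rate_ge0|exact: stiefel_rate_lsc].
move=> a a0; apply: (subclosed_compact _ compact_box) => //.
have /lower_semicontinuousP/(_ a) := stiefel_rate_lsc.
move=> /open_closedC; congr closed; apply/seteqP; split => A /=.
  by move=> /negP; rewrite -leNgt => H.
by move=> H; apply/negP; rewrite -leNgt.
Qed.

Lemma stiefel_rate_convex : convex_on_box (@stiefel_rate R k).
Proof.
move=> t A B; set C := box_conv t A B.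
have t0 : 0 <= t%:num :> R by [].
have t1 : t%:num <= 1 :> R by [].
pose s : R := t%:num; have [s0 s1] : 0 <= s /\ s <= 1 by [].
have CE r : blk C r = s *: blk A r + (1 - s) *: blk B r.
  by apply/matrixP => i j; rewrite !mxE.
have [tB tA] : (s = 0 -> C = B) /\ (s = 1 -> C = A).
  split=> sE; apply/funext => ij; apply: val_inj; rewrite /= -/s sE.
    by rewrite mul0r subr0 mul1r add0r.
  by rewrite subrr mul0r mul1r addr0.
have ge0 (c : R) (D : box R k) : 0 <= c -> (0 <= c%:E * stiefel_rate D)%E.
  by move=> c0; apply: mule_ge0; [rewrite lee_fin|exact: stiefel_rate_ge0].
rewrite -/s; have [/eqP IA|IA] := boolP (stiefel_rate A == +oo%E).
  have [sE|sn] := eqVneq s 0; first by rewrite tB // sE subr0 mul0e add0e mul1e.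
  by rewrite IA gt0_muley ?lte_fin ?lt_def ?sn // addye ?leey // gt_eqF // (lt_le_trans _ (ge0 _ _ _)) ?ltNy0 ?subr_ge0.
have [/eqP IB|IB] := boolP (stiefel_rate B == +oo%E).
  have [sE|sn] := eqVneq s 1; first by rewrite tA // sE subrr mul0e adde0 mul1e.
  have s1' : 0 < 1 - s by rewrite subr_gt0 lt_def eq_sym sn.
  rewrite IB [X in (_ + X)%E]gt0_muley ?lte_fin // addey ?leey // gt_eqF //.
  by rewrite (lt_le_trans _ (ge0 _ _ _)).
have [suA suB] := (stiefel_rate_fin IA, stiefel_rate_fin IB).
have fin (D : box R k) : subunital (entries D) -> exists2 x, stiefel_rate D = x%:E & forall r, rate (blk D r) <= x.
  move=> su; have := fun r => rate_block_le_stiefel r su; rewrite stiefel_rateE (asboolT su) => H.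
  by eexists; first reflexivity; move=> r; rewrite -lee_fin.
have [x -> Hx] := fin A suA; have [y -> Hy] := fin B suB.
rewrite -!EFinM -EFinD; apply: stiefel_rate_le => r; rewrite CE.
have [cA cB] := (subunital_contraction r suA, subunital_contraction r suB).
have s01 : 0 <= s <= 1 by rewrite s0.
split; first exact: contraction_mix.
apply: le_trans (rate_convex s01 cA cB) _.
by apply: lerD; rewrite ler_wpM2l ?subr_ge0.
Qed.

End Box.

(** * The large deviation principle *)

Section EventuallyBounds.
Context {R : realType}.
Local Open Scope ereal_scope.

Lemma limn_esup_le (u : nat -> \bar R) l :
  (exists N, forall n, (N <= n)%N -> u n <= l) -> limn_esup u <= l.
Proof.
move=> [N HN]; rewrite /limn_esup /limf_esup.
apply: (@le_trans _ _ (ereal_sup (u @` [set n | (N <= n)%N]))).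
  by apply: ereal_inf_lbound; exists [set n | (N <= n)%N] => //; exists N.
by apply: ge_ereal_sup => _ [n /= Nn <-]; exact: HN.
Qed.

Lemma limn_einf_ge (u : nat -> \bar R) l :
  (exists N, forall n, (N <= n)%N -> l <= u n) -> l <= limn_einf u.
Proof.
move=> [N HN]; rewrite /limn_einf leeNr; apply: limn_esup_le.
by exists N => n /HN; rewrite leeN2.
Qed.

Lemma ereal_density (a b : \bar R) : a < b -> exists2 c : R, a < c%:E & c%:E < b.
Proof.
case: a => [a| |] //; case: b => [b| |] //.
- rewrite lte_fin => ab; exists ((a + b) / 2)%R; rewrite lte_fin; lra.
- by move=> _; exists (a + 1)%R; rewrite ?ltry // lte_fin ltrDl.
- by move=> _; exists (b - 1)%R; rewrite ?ltNyr // lte_fin gtrDl oppr_lt0.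
- by move=> _; exists 0%R; rewrite ?ltNyr ?ltry.
Qed.

(** A constant factor is negligible at speed [n]. *)
Lemma scaled_lne_le (p C L eps : R) (n : nat) : (0 < n)%N -> (0 < C)%R -> (0 <= p)%R ->
  (p <= C * expR (- (n%:R * L)))%R -> (ln C <= eps * n%:R)%R ->
  (n%:R^-1)%:E * lne p%:E <= (eps - L)%:E.
Proof.
move=> n0 C0; rewrite le_eqVlt => /predU1P[<- _ _|p0 pC Cn].
  by rewrite le0_lneNy // gt0_muleNy ?leNye // lte_fin invr_gt0 ltr0n.
rewrite lne_EFin // -EFinM lee_fin mulrC ler_pdivrMr ?ltr0n // mulrBl.
have : (ln p <= ln (C * expR (- (n%:R * L))))%R by rewrite ler_ln ?posrE ?mulr_gt0 ?expR_gt0.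
rewrite lnM ?posrE ?expR_gt0 // expRK; lra.
Qed.

Lemma scaled_lne_ge (p c h eps : R) (n : nat) : (0 < n)%N -> (0 < c)%R ->
  (c * expR (- (n%:R * h)) <= p)%R -> (- ln c <= eps * n%:R)%R ->
  (- (h + eps))%:E <= (n%:R^-1)%:E * lne p%:E.
Proof.
move=> n0 c0 pc cn.
have e0 : (0 < c * expR (- (n%:R * h)))%R by rewrite mulr_gt0 ?expR_gt0.
have p0 : (0 < p)%R := lt_le_trans e0 pc.
rewrite lne_EFin // -EFinM lee_fin [(_^-1 * _)%R]mulrC ler_pdivlMr ?ltr0n //.
have : (ln (c * expR (- (n%:R * h))) <= ln p)%R by rewrite ler_ln ?posrE.
rewrite lnM ?posrE ?expR_gt0 // expRK; lra.
Qed.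

End EventuallyBounds.

Section LargeDeviations.
Context {R : realType} {k : nat} (k_gt0 : (0 < k)%N)
    {d : nat -> measure_display} {Omega : forall m, measurableType (d m)}
    (P : forall m, probability (Omega m) R)
    (V : forall m, {mfun Omega m >-> @borel_matrix R k (k + m)})
    (V_stiefel : forall m (w : Omega m), stiefel (V m w))
    (V_uniform : forall m, uniform_on_stiefel (distribution (P m) (V m))).

Local Notation blk A r := (block (entries A) r).
Local Notation dist2 A B r := (dot (blk A r - blk B r) (blk A r - blk B r)).

Let xi m (w : Omega m) : box R k := embed (@V_stiefel m w).
Arguments xi : clear implicits.

Lemma block_embed m (w : Omega m) r (rn : (r <= k + m)%N) :
  blk (xi m w) r = lcols rn (V m w).
Proof.
apply/matrixP => i j; rewrite !mxE /entries /= /zero_pad.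
case: insubP => [j' _ jj'|]; last by rewrite (leq_trans (ltn_ord j) rn).
by congr (V m w i _); apply: val_inj; rewrite /= jj'.
Qed.

(** [embed] agrees on the Stiefel manifold with a continuous map defined on all
    matrices, which truncates the entries to [-1, 1]. *)
Lemma measurable_embed m (B : set (box R k)) : borel B -> measurable (xi m @^-1` B).
Proof.
pose clip (M : 'M[R]_(k, k + m)) : box R k := clamp_box (fun ij => zero_pad M ij.1 ij.2).
have clipE w : xi m w = clip (V m w).
  apply/funext => ij; apply: val_inj; rewrite /= clamp_id //.
  exact: zero_pad_itv (@V_stiefel m w).
have cclip : continuous clip.
  apply: continuous_clamp_box => -[i j]; rewrite /zero_pad /=.
  by case: insubP => [j' _ _|_]; [exact: coord_continuous|exact: cst_continuous].
apply: (@smallest_sub _ _ _ [set B | measurable (xi m @^-1` B)]); last first.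
  move=> U oU /=.
  have -> : xi m @^-1` U = V m @^-1` (clip @^-1` U).
    by apply/seteqP; split => w /=; rewrite clipE.
  rewrite -[X in measurable X]setTI; apply: (measurable_funPT (V m)) => //.
  by apply: sub_sigma_algebra; move/continuousP : cclip; exact.
split=> [|A mA|F mF] /=.
- by rewrite preimage_set0.
- by rewrite setTD preimage_setC; exact: measurableC.
- by rewrite preimage_bigcup; apply: bigcup_measurable => i _; exact: mF.
Qed.

Lemma ldp_lower (B : set (box R k)) : borel B ->
  let u m := ((((k + m)%:R : R)^-1)%:E * lne (P m (xi m @^-1` B)))%E in
  (- ereal_inf (@stiefel_rate R k @` B°) <= limn_einf u)%E.
Proof.
move=> mB /=; set u := (X in limn_einf X); rewrite leeNl; apply: le_ereal_inf_tmp => _ [A AB <-].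
rewrite leeNl; have [IA|IA] := eqVneq (stiefel_rate A) +oo%E; first by rewrite IA leNye.
have su := stiefel_rate_fin IA.
have [r [s [s0 HB]]] := nbhs_box_sub AB.
have cA := subunital_contraction r su.
apply: (@le_trans _ _ (- (rate (blk A r))%:E)%E).
  by rewrite leeN2; exact: rate_block_le_stiefel.
apply/lee_addgt0Pr => e e0; rewrite -leeBlDr // -EFinN -EFinB.
have e2 : 0 < e / 2 by rewrite divr_gt0.
have [c0 c00 [n0 Hn]] := ball_lower cA e2 s0.
apply: limn_einf_ge; exists (maxn (maxn n0 r) (Num.bound (`|ln c0| / (e / 2)))) => m.
rewrite !geq_max => /andP[/andP[mn0 mr] me].
have rn : (r <= k + m)%N by rewrite (leq_trans mr) // leq_addl.
have kn : (0 < k + m)%N by rewrite addn_gt0 k_gt0.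
have mE : measurable (xi m @^-1` B) by exact: measurable_embed.
have := Hn _ rn _ _ (P m) (V m) (@V_stiefel m) (V_uniform m) _ _ mE.
move=> /(_ (leq_trans mn0 (leq_addl _ _))) Hp.
have {}Hp : c0 * expR (- ((k + m)%:R * (rate (blk A r) + e / 2))) <=
    fine (P m (xi m @^-1` B)).
  by apply: Hp => w Hw; apply: (HB r) => //; rewrite block_embed.
rewrite /u -(@fineK _ (P m _)) ?fin_num_measure //.
have -> : - rate (blk A r) - e = - ((rate (blk A r) + e / 2) + e / 2) by lra.
apply: scaled_lne_ge c00 Hp _ => //.
rewrite -ler_pdivrMl // mulrC.
apply: (@le_trans _ _ (`|ln c0| / (e / 2))).
  by rewrite ler_pM2r ?invr_gt0 // -normrN ler_norm.
apply: ltW; apply: lt_le_trans (archi_boundP _) _; first by rewrite divr_ge0 // ltW.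
by rewrite ler_nat (leq_trans me) // leq_addl.
Qed.

(** Exponential smallness at rate [L], in terms of measurable supersets [E] so
    that it applies to all sets of the box; these sets form an ideal. *)
Let negligible (L : R) (U : set (box R k)) : Prop := exists2 C, 0 < C &
  exists N, forall m, (N <= m)%N -> exists E : set (Omega m),
  [/\ measurable E, xi m @^-1` U `<=` E & fine (P m E) <= C * expR (- ((k + m)%:R * L))].

Let negligibleS L U W : U `<=` W -> negligible L W -> negligible L U.
Proof.
move=> UW [C C0 [N HN]]; exists C => //; exists N => m /HN[E [mE sE PE]]; exists E.
by split=> // w /= /UW; exact: sE.
Qed.

Let negligible0 L : negligible L set0.
Proof.
exists 1 => //; exists 0%N => m _; exists set0.
by split=> //; rewrite measure0 mul1r expR_ge0.
Qed.

Let negligibleU L U W : negligible L U -> negligible L W -> negligible L (U `|` W).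
Proof.
move=> [C C0 [N HN]] [D D0 [N' HN']]; exists (C + D); first exact: addr_gt0.
exists (maxn N N') => m; rewrite geq_max => /andP[/HN[E [mE sE PE]] /HN'[F [mF sF PF]]].
exists (E `|` F); split; first exact: measurableU.
  by move=> w [/sE|/sF]; [left|right].
rewrite mulrDl; apply: le_trans (lerD PE PF).
rewrite -fineD ?fin_num_measure // fine_le ?fin_num_measure //.
- exact: measurableU.
- by rewrite fin_numD !fin_num_measure.
exact: measureU2.
Qed.

Lemma negligible_near A (L : R) : (L%:E < stiefel_rate A)%E ->
  exists2 U, nbhs A U & negligible L U.
Proof.
move=> /stiefel_rate_gt[r Hr].
have mdist m (rn : (r <= k + m)%N) s : measurable [set w | dot (lcols rn (V m w) - blk A r)
    (lcols rn (V m w) - blk A r) < s].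
  have [mf _] : obs (fun M : 'M[R]_(k, k + m) => dot (lcols rn M - blk A r) (lcols rn M - blk A r)).
    have o i j : obs (fun M : 'M[R]_(k, k + m) => (lcols rn M - blk A r) i j).
      have -> : (fun M => (lcols rn M - blk A r) i j) = fun M => lcols rn M i j - blk A r i j.
        by apply/funext => M; rewrite entryD entryN.
      by apply: obsB; [exact: obs_lcols|exact: obs_cst].
    exact: obs_dot.
  have := measurableT_comp mf (measurable_funPT (V m)) measurableT (measurable_itv `]-oo, s[).
  by rewrite setTI; congr measurable; apply/seteqP; split => w /=; rewrite in_itv.
have [cA|nA] := pselect (contraction (blk A r)).
  have e0 : 0 < rate (blk A r) - L by rewrite subr_gt0 Hr.
  have [s s0 [C C0 H]] := ball_upper cA e0.
  exists [set B | dist2 B A r < s]; first exact: nbhs_box_dist2.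
  exists C => //; exists r => m rm.
  have rn : (r <= k + m)%N by rewrite (leq_trans rm) // leq_addl.
  exists [set w | dot (lcols rn (V m w) - blk A r) (lcols rn (V m w) - blk A r) < s].
  split; [exact: mdist|by move=> w /=; rewrite block_embed|].
  have := H _ rn _ _ _ _ (@V_stiefel m) (V_uniform m) _ (mdist m rn s) (fun w Hw => Hw).
  by rewrite opprB addrCA subrr addr0.
have [s s0 H] := boundary_upper L nA.
exists [set B | dist2 B A r < s]; first exact: nbhs_box_dist2.
exists 1 => //; exists r.*2.+1 => m rm.
have rn : (r <= k + m)%N by lia.
exists [set w | dot (lcols rn (V m w) - blk A r) (lcols rn (V m w) - blk A r) < s].
split; [exact: mdist|by move=> w /=; rewrite block_embed|].
rewrite mul1r; apply: (H _ rn _ _ _ _ (@V_stiefel m) (V_uniform m)) => //.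
by rewrite (leq_trans rm) // leq_addl.
Qed.

(** The complements of the negligible sets, relative to [K], form a filter. If
    [K] were not negligible, this filter would cluster at a point of [K], which
    has a negligible neighbourhood. *)
Lemma negligible_closed (K : set (box R k)) (L : R) : closed K ->
  (forall A, K A -> (L%:E < stiefel_rate A)%E) -> negligible L K.
Proof.
move=> cK HK; have compK : compact K by apply: (subclosed_compact cK compact_box).
apply: contrapT => nK.
pose F : set (set (box R k)) := [set S | negligible L (K `\` S)].
have FF : ProperFilter F.
  apply: Build_ProperFilter_ex; last first.
    split.
    - by rewrite /F /= setDT; exact: negligible0.
    - by move=> S S' FS FS'; rewrite /F /= setDIr; exact: negligibleU.
    - by move=> S S' SS'; apply: negligibleS => A [KA nS]; split=> // /SS'.
  move=> S FS; apply: contrapT => S0; apply: nK.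
  by apply: negligibleS FS => A KA; split=> // SA; apply: S0; exists A.
have FK : F K by rewrite /F /= setDv; exact: negligible0.
have [A [KA clA]] := compK F FF FK.
have [U AU nU] := negligible_near (HK A KA).
have FU : F (~` U) by rewrite /F /=; apply: negligibleS nU => B [_ /contrapT].
by have [B [nUB UB]] := clA _ _ FU AU.
Qed.

Lemma ldp_upper (B : set (box R k)) : borel B ->
  let u m := ((((k + m)%:R : R)^-1)%:E * lne (P m (xi m @^-1` B)))%E in
  (limn_esup u <= - ereal_inf (@stiefel_rate R k @` closure B))%E.
Proof.
move=> mB /=; set u := (X in limn_esup X); rewrite leNgt; apply/negP; rewrite lteNl => /ereal_density[L lL LJ].
have [L0 lL0] := ereal_density lL; rewrite lte_fin => L0L.
have [C C0 [N HN]] : negligible L (closure B).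
  apply: negligible_closed; first exact: closed_closure.
  by move=> A clA; apply: lt_le_trans LJ _; apply: ereal_inf_lbound; exists A.
move: lL0; rewrite lteNl ltNge => /negP; apply.
apply: limn_esup_le; exists (maxn N (Num.bound (`|ln C| / (L - L0)))) => m.
rewrite geq_max => /andP[mN me].
have [E [mE sE PE]] := HN m mN.
have kn : (0 < k + m)%N by rewrite addn_gt0 k_gt0.
have mX : measurable (xi m @^-1` B) by exact: measurable_embed.
have e0 : 0 < L - L0 by rewrite subr_gt0.
have pE : fine (P m (xi m @^-1` B)) <= fine (P m E).
  rewrite fine_le ?fin_num_measure // le_measure ?inE //.
  by apply: subset_trans sE => w /=; exact: subset_closure.
rewrite /u -(@fineK _ (P m _)) ?fin_num_measure // -EFinN.
have -> : - L0 = (L - L0) - L by ring.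
apply: (scaled_lne_le kn C0 _ (le_trans pE PE)); first exact: fine_ge0.
rewrite -ler_pdivrMl // mulrC.
apply: (@le_trans _ _ (`|ln C| / (L - L0))); first by rewrite ler_pM2r ?invr_gt0 // ler_norm.
apply: ltW; apply: lt_le_trans (archi_boundP _) _; first by rewrite divr_ge0 // ltW.
by rewrite ler_nat (leq_trans me) // leq_addl.
Qed.

End LargeDeviations.

(* [V m] is the random matrix V_{k,n} with n = k + m. *)
Theorem theoremA (R : realType) (k : nat) (k_gt0 : (0 < k)%N)
    (d : nat -> measure_display) (Omega : forall m, measurableType (d m))
    (P : forall m, probability (Omega m) R)
    (V : forall m, {mfun Omega m >-> @borel_matrix R k (k + m)})
    (V_stiefel : forall m (w : Omega m), stiefel (V m w))
    (V_uniform : forall m, uniform_on_stiefel (distribution (P m) (V m))) :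
  [/\ good_rate_function (@stiefel_rate R k),
      convex_on_box (@stiefel_rate R k) &
      satisfies_LDP (fun m => (k + m)%:R) P
        (fun m (w : Omega m) => embed (V_stiefel m w))
        (@stiefel_rate R k)].
Proof.
split; [exact: stiefel_rate_good|exact: stiefel_rate_convex|].
split; first by move=> m B; exact: measurable_embed.
  by split; [exact: stiefel_rate_ge0|exact: stiefel_rate_lsc].
move=> B mB u; split; last exact: ldp_upper.
  exact: ldp_lower.
exact: limn_einf_sup.
Qed.
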